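(* For $\lambda\in(0,1)$ and $r\in[-1,1]\setminus\{0\}$, let $f_{r,\lambda}(x)=[1-\lambda+\lambda x^r]^{1/r}$. Let $H$ be an infinite dimensional Hilbert space, and let $T=U|T|\in\mathcal{B}(H)$ be invertible and centered. If $T\in\mathcal{AN}(H)$ (resp. $T\in\mathcal{AM}(H)$), then the limit $\lim_{n\to\infty}\Delta_{f_{r,\lambda}}^n(T)=UL$ exists (for some $L\in\mathcal{B}(H)$), and $UL\in\mathcal{AN}(H)$ (resp. $UL\in\mathcal{AM}(H)$). Moreover, the limit point does not depend on $\lambda$.
   Context: $H$ is a complex Hilbert space, $\mathcal{B}(H)$ the bounded operators, $|T|=(T^*T)^{1/2}$; limits of operators are in the strong operator topology. If $T$ is invertible, $U$ in the polar decomposition $T=U|T|$ is unitary. $\mathcal{AN}(H)$: the operators $T\in\mathcal{B}(H)$ such that for every non-zero closed subspace $M\subseteq H$ there is a unit vector $x\in M$ with $\|T|_M\|=\|T|_Mx\|$. $\mathcal{AM}(H)$: the operators $T\in\mathcal{B}(H)$ such that for every non-zero closed subspace $M\subseteq H$ there is a unit vector $x\in M$ with $m(T|_M)=\|T|_Mx\|$, where $m(T|_M)=\inf\{\|Ty\|: y\in M,\ \|y\|=1\}$. The functions $f=f_{r,\lambda}$ are representing functions of operator means (power means): operator monotone on $(0,\infty)$ with $f(1)=1$. Induced Aluthge transformation: for invertible $T=U|T|$ with spectral decomposition $|T|=\int_{\sigma(|T|)}s\,dE_s$, define $\Delta_f(T):=\int_{\sigma(|T|)}\int_{\sigma(|T|)}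 s f(t/s)\,dE_s\,U\,dE_t$ (double operator integral). Concretely (known fact), if $\mu$ is a probability measure on $[0,1]$ with $f(x)=\int_0^1[1-\theta+\theta x^{-1}]^{-1}d\mu(\theta)$ for $x>0$ (such $\mu$ exists), then $\Delta_f(T)=\int_0^1\int_0^\infty e^{-(1-\theta)s|T|^{-1}}\,U\,e^{-\theta s|T|^{-1}}\,ds\,d\mu(\theta)$. Iterates: $\Delta_f^0(T)=T$, $\Delta_f^n(T)=\Delta_f(\Delta_f^{n-1}(T))$. $T=U|T|$ is centered if $\{U^{*m}|T|U^m,\ |T|,\ U^n|T|U^{*n}: n,m=1,2,\dots\}$ is a commuting set. *)

(* Defs.v *)
From HB Require Import structures.
From mathcomp Require Import all_boot all_order all_algebra.
From mathcomp Require Import all_classical all_reals all_analysis.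
From mathcomp Require Import complex.

Set Implicit Arguments.
Unset Strict Implicit.
Unset Printing Implicit Defensive.

Import Order.TTheory GRing.Theory Num.Theory.
Import numFieldNormedType.Exports.

Local Open Scope classical_set_scope.
Local Open Scope ring_scope.
Local Open Scope complex_scope.

(* A complex Hilbert space is a complete normed space H over R[i] together
   with an inner product, linear in its first argument, that induces the norm
   of H. *)
Definition induces_norm (R : realType) (H : completeNormedModType R[i])
    (ip : {dot H for Num.conj}) : Prop :=
  forall x : H, `|x| ^+ 2 = ip x x.

Section Operators.
Context {R : realType} {H : completeNormedModType R[i]}.
Implicit Types (A T D L U X : H -> H) (M : set H) (E : R -> H -> H).

Definition infinite_dimensional : Prop :=
  forall n : nat, exists v : 'I_n -> H, forall c : 'I_n -> R[i],
    \sum_(i < n) c i *: v i = 0 -> forall i, c i = 0.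

(* The norm of H takes its values in R[i]; this is the same norm in R. *)
Definition rnorm (x : H) : R := complex.Re `|x|.

Definition bounded_op T : Prop := linear T /\ continuous T.

Definition invertible_op T : Prop :=
  exists S : H -> H, [/\ bounded_op S, S \o T = id & T \o S = id].

Definition closed_subspace M : Prop :=
  [/\ closed M, M 0 & forall (c : R[i]) x y, M x -> M y -> M (c *: x + y)].

Definition nonzero_subspace M : Prop := exists2 x, M x & x != 0.

Definition unit_image T M : set R :=
  [set rnorm (T x) | x in M `&` [set x | rnorm x = 1]].

Definition norm_on T M : R := sup (unit_image T M).

Definition min_modulus_on T M : R := inf (unit_image T M).

Definition AN T : Prop := bounded_op T /\
  forall M, closed_subspace M -> nonzero_subspace M ->
    exists x, [/\ M x, rnorm x = 1 & norm_on T M = rnorm (T x)].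

Definition AM T : Prop := bounded_op T /\
  forall M, closed_subspace M -> nonzero_subspace M ->
    exists x, [/\ M x, rnorm x = 1 & min_modulus_on T M = rnorm (T x)].

(* Partitions a = x_0 <= ... <= x_n = b of mesh less than d, with tags xi_i
   in [x_i, x_(i+1)]. *)
Definition tagged_partition (a b d : R) (n : nat) (x xi : nat -> R) : Prop :=
  [/\ x 0%N = a, x n = b &
      forall i, (i < n)%N -> [/\ x i <= xi i, xi i <= x i.+1 &
                                x i.+1 - x i < d]].

Definition increment E (x : nat -> R) (i : nat) : H -> H :=
  fun h => E (x i.+1) h - E (x i) h.

(* A = \int_[a, b] phi(s) dE_s, as the limit in operator norm of the
   Riemann-Stieltjes sums when the mesh goes to 0. *)
Definition is_spectral_integral (a b : R) E (phi : R -> R) A : Prop :=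
  forall e : R, 0 < e -> exists2 d : R, 0 < d &
  forall n x xi, tagged_partition a b d n x xi ->
  forall h : H,
    rnorm (\sum_(i < n) (phi (xi i))%:C *: increment E x i h - A h)
      <= e * rnorm h.

(* D = \int_[a, b] \int_[a, b] phi(s, t) dE_s X dE_t, as the limit in operator
   norm of the double Riemann-Stieltjes sums, the partitions of the two
   variables being independent. *)
Definition is_double_operator_integral (a b : R) E (phi : R -> R -> R) X D
    : Prop :=
  forall e : R, 0 < e -> exists2 d : R, 0 < d &
  forall n x xi m y eta, tagged_partition a b d n x xi ->
    tagged_partition a b d m y eta ->
  forall h : H,
    rnorm (\sum_(i < n) \sum_(j < m)
             (phi (xi i) (eta j))%:C *: increment E x i (X (increment E y j h))
           - D h)
      <= e * rnorm h.

Variable ip : {dot H for Num.conj}.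

Definition adjoint_of T S : Prop :=
  bounded_op S /\ forall x y, ip (T x) y = ip x (S y).

Definition adj T : H -> H := xget (fun=> 0) [set S | adjoint_of T S].

(* The order of R[i] makes 0 <= z include that z is real. *)
Definition positive_op A : Prop :=
  bounded_op A /\ forall x, 0 <= ip (A x) x.

(* |T|, the positive square root of T^*T. *)
Definition modulus T : H -> H :=
  xget (fun=> 0) [set P | positive_op P /\ P \o P = adj T \o T].

(* T = U|T| where U is a partial isometry with the same kernel as T. *)
Definition polar_decomposition T U : Prop :=
  [/\ bounded_op U, U \o adj U \o U = U, T = U \o modulus T &
      forall x, U x = 0 <-> T x = 0].

Definition centered T U : Prop :=
  let family := [set A |
    [\/ exists2 m, (0 < m)%N & A = iter m (adj U) \o modulus T \o iter m U,
        A = modulus T |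
        exists2 n, (0 < n)%N & A = iter n U \o modulus T \o iter n (adj U)]]
  in forall A B, family A -> family B -> A \o B = B \o A.

Definition orthogonal_projection A : Prop :=
  [/\ bounded_op A, A \o A = A & forall x y, ip (A x) y = ip x (A y)].

(* Spectral families (E_s) carried by ]a, b]: since E is monotone, E_s = 0 for
   s <= a and E_s = 1 for b <= s. *)
Definition spectral_family (a b : R) E : Prop :=
  [/\ forall s, orthogonal_projection (E s),
      forall s t, E s \o E t = E (Num.min s t),
      forall s x, E t x @[t --> s^'+] --> E s x,
      E a = (fun=> 0) & E b = id].

(* A = \int s dE_s. The measure dE is supported by the spectrum of A, so that
   integrating over any [a, b] as above is integrating over the spectrum. *)
Definition spectral_decomposition (a b : R) A E : Prop :=
  spectral_family a b E /\ is_spectral_integral a b E id A.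

(* D = \int \int s f(t / s) dE_s U dE_t. The condition 0 < a is available
   exactly when |T| is bounded below, in particular when T is invertible. *)
Definition induced_aluthge_of (f : R -> R) T D : Prop :=
  bounded_op D /\
  exists U E (a b : R),
    [/\ 0 < a, polar_decomposition T U,
        spectral_decomposition a b (modulus T) E &
        is_double_operator_integral a b E (fun s t => s * f (t / s)) U D].

Definition induced_aluthge (f : R -> R) T : H -> H :=
  xget (fun=> 0) [set D | induced_aluthge_of f T D].

End Operators.

Arguments infinite_dimensional {R} H.

Definition power_mean_fun (R : realType) (r lambda : R) (x : R) : R :=
  (1 - lambda + lambda * x `^ r) `^ r^-1.

(* Main.v *)
Require Import Defs.
From mathcomp Require Import all_boot all_order all_algebra.
From mathcomp Require Import all_classical all_reals all_analysis.
From mathcomp Require Import complex ring lra.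

Set Implicit Arguments.
Unset Strict Implicit.
Unset Printing Implicit Defensive.

Import Order.TTheory GRing.Theory Num.Theory.
Import numFieldNormedType.Exports.

Local Open Scope classical_set_scope.
Local Open Scope ring_scope.
Local Open Scope complex_scope.

(* T is AN (resp. AM) exactly when the quadratic form of s T^*T, with s = 1
   (resp. s = -1), attains its supremum on the unit sphere of every closed
   subspace.  For a bounded self-adjoint A this happens iff there is a real a
   such that <Au, u> <= c <u, u> on a subspace of finite codimension for every
   c > a, and <Au, u> >= a <u, u> on a subspace of finite codimension.
   Consequently the commuting operators U^-k |T| U^k have a total set of joint
   eigenvectors, on which |T| acts by a function g and
   |Delta^n(T)|^r by the binomial averages of k |-> g(U^k x)^r.
   Along the orbit of a joint eigenvector x either the eigenvalues are periodic,
   and the averages tend to the mean over a period, or the U^k x are pairwise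
   orthogonal, and g(U^k x)^2 tends to s a; in both cases the limit is
   independent of lambda.  Since the orbits through a finite-dimensional set of
   eigenvectors that are periodic have bounded period, the two conditions on
   finite codimension pass to the limit. *)

(** * Power means and binomial averages *)

(** [induced_aluthge] is picked by [xget] among all operators satisfying its defining relation, so
    each iteration step must prove that the double integral exists and that every other spectral
    family yields the same operator. Joint eigenvectors settle both: any spectral family of a
    diagonal operator with eigenvalues g acts on such an x as the indicator of g x <= c, and the
    double sums tend to the power mean of g (U x) and g x. This shift from x to U x is why
    eigenvectors of |T| alone do not suffice and all its conjugates are diagonalized together.

    The obstacle in the limit is that the exceptional eigenvectors, with value at least some c > a
    or below a, are met by the orbits of all their preimages under powers of U, which may span an
    infinite-dimensional space. What saves the argument is that a nonperiodic orbit has limit value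
    exactly a and so is never exceptional for the limit operator.

    No orthonormal basis of joint eigenvectors is chosen: a bounded function of the joint
    eigenvalues already determines a diagonal operator. *)

Lemma powR_mono_pos (R : realType) (r p q : R) : 0 < r -> 0 < p -> 0 < q ->
  (p `^ r <= q `^ r) = (p <= q).
Proof.
move=> r0 p0 q0; apply/idP/idP => [|pq]; last first.
  by apply: ge0_ler_powR => //; rewrite ?nnegrE; exact: ltW.
apply: contraTT; rewrite -!ltNge => qp.
by apply: gt0_ltr_powR => //; rewrite ?nnegrE; exact: ltW.
Qed.

Lemma powR_mono_neg (R : realType) (r p q : R) : r < 0 -> 0 < p -> 0 < q ->
  (p `^ r <= q `^ r) = (q <= p).
Proof.
move=> r0 p0 q0; rewrite -[r]opprK !(powRN _ (- r)) lef_pV2 ?posrE ?powR_gt0 //.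
by rewrite powR_mono_pos // oppr_gt0.
Qed.

(** This is the integrand s f(t / s) at s = p and t = q, that is, the weighted power mean in which p
    has weight 1 - lam. *)
Definition pmean (R : realType) (r lam p q : R) := p * power_mean_fun r lam (q / p).

Section PowerMean.
Context (R : realType) (r lam : R) (r0 : r != 0) (lam01 : 0 < lam < 1).

Let w1 : 0 < 1 - lam. Proof. by case/andP: lam01 => ? ?; rewrite subr_gt0. Qed.
Let w2 : 0 < lam. Proof. by case/andP: lam01. Qed.

Lemma pmeanE (p q : R) : 0 < p -> 0 < q ->
  pmean r lam p q = ((1 - lam) * p `^ r + lam * q `^ r) `^ r^-1.
Proof.
move=> p0 q0; rewrite /pmean /power_mean_fun.
have hp : p = (p `^ r) `^ r^-1 by rewrite -powRrM mulfV // powRr1 // ltW.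
have qp : 0 < q / p by rewrite divr_gt0.
rewrite {1}hp -powRM; last 2 first.
- by rewrite powR_ge0.
- by rewrite addr_ge0 ?mulr_ge0 ?powR_ge0 // ltW.
congr (_ `^ _); rewrite mulrDr mulrCA mulrC; congr (_ + lam * _).
by rewrite -powRM ?ltW // mulrC mulfVK // gt_eqF.
Qed.

Lemma pmean_arg_gt0 (p q : R) : 0 < p -> 0 < q -> 0 < (1 - lam) * p `^ r + lam * q `^ r.
Proof. by move=> p0 q0; rewrite addr_gt0 // mulr_gt0 // powR_gt0. Qed.

Lemma pmean_gt0 (p q : R) : 0 < p -> 0 < q -> 0 < pmean r lam p q.
Proof. by move=> p0 q0; rewrite pmeanE // powR_gt0 // pmean_arg_gt0. Qed.

Lemma pmean_pow (p q : R) : 0 < p -> 0 < q ->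
  pmean r lam p q `^ r = (1 - lam) * p `^ r + lam * q `^ r.
Proof.
by move=> p0 q0; rewrite pmeanE // -powRrM mulVf // powRr1 // ltW // pmean_arg_gt0.
Qed.

Lemma pmean_homog (c p q : R) : 0 < c -> 0 < p -> 0 < q ->
  pmean r lam (c * p) (c * q) = c * pmean r lam p q.
Proof.
move=> c0 p0 q0; rewrite /pmean -mulrA; congr (_ * (_ * power_mean_fun _ _ _)).
by field; rewrite !gt_eqF.
Qed.

Lemma pmean_id (p : R) : 0 < p -> pmean r lam p p = p.
Proof.
move=> p0; rewrite pmeanE // -mulrDl subrK mul1r -powRrM mulfV // powRr1 //.
exact: ltW.
Qed.

(** After raising to the power r the mean is an affine combination with positive weights; for r < 0
    the order is reversed on the arguments and again on the result. *)
Lemma pmean_mono (p q p' q' : R) : 0 < p -> 0 < q -> p <= p' -> q <= q' ->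
  pmean r lam p q <= pmean r lam p' q'.
Proof.
move=> p0 q0 pp qq; have p'0 := lt_le_trans p0 pp; have q'0 := lt_le_trans q0 qq.
have G := pmean_gt0 p0 q0; have G' := pmean_gt0 p'0 q'0.
have := pmean_pow p0 q0; have := pmean_pow p'0 q'0.
move: (pmean r lam p q) (pmean r lam p' q') G G' => u v u0 v0 vE uE.
have [rn|rp|re] := ltgtP r 0; last by case: (elimN eqP r0 re).
- rewrite -(powR_mono_neg rn v0 u0) uE vE.
  by apply: lerD; rewrite ?(ler_pM2l w1) ?(ler_pM2l w2) powR_mono_neg.
- rewrite -(powR_mono_pos rp u0 v0) uE vE.
  by apply: lerD; rewrite ?(ler_pM2l w1) ?(ler_pM2l w2) powR_mono_pos.
Qed.

Lemma pmean_le (p q M : R) : 0 < p -> 0 < q -> p <= M -> q <= M -> pmean r lam p q <= M.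
Proof.
move=> p0 q0 pM qM; rewrite -(pmean_id (lt_le_trans p0 pM)).
exact: pmean_mono.
Qed.

Lemma pmean_ge (p q m : R) : 0 < m -> m <= p -> m <= q -> m <= pmean r lam p q.
Proof. by move=> m0 mp mq; rewrite -{1}(pmean_id m0); exact: pmean_mono. Qed.

(* A power mean is monotone and homogeneous of degree 1, so a relative
   perturbation of its arguments by e / b changes it by at most that factor. *)
Lemma pmean_unif (a b e : R) : 0 < a -> a <= b -> 0 < e ->
  exists2 d : R, 0 < d & forall p q p' q' : R, a <= p <= b -> a <= q <= b ->
    a <= p' <= b -> a <= q' <= b -> `|p - p'| <= d -> `|q - q'| <= d ->
    `|pmean r lam p q - pmean r lam p' q'| <= e.
Proof.
move=> a0 ab e0; have b0 := lt_le_trans a0 ab.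
exists (e * a / b); first by rewrite divr_gt0 // mulr_gt0.
suff h p q p' q' : a <= p <= b -> a <= q <= b ->
    a <= p' <= b -> a <= q' <= b -> `|p - p'| <= e * a / b -> `|q - q'| <= e * a / b ->
    pmean r lam p q - pmean r lam p' q' <= e.
  move=> p q p' q' hp hq hp' hq' pp qq; rewrite ler_norml lerNl opprB.
  by apply/andP; split; apply: h => //; rewrite distrC.
move=> /andP[ap pb] /andP[aq qb] /andP[ap' pb'] /andP[aq' qb'] pp qq.
have p0 := lt_le_trans a0 ap; have q0 := lt_le_trans a0 aq.
have p'0 := lt_le_trans a0 ap'; have q'0 := lt_le_trans a0 aq'.
have c0 : 0 < 1 + e / b by rewrite addr_gt0 // divr_gt0.
have grow t t' : a <= t' -> `|t - t'| <= e * a / b -> t <= (1 + e / b) * t'.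
  move=> at'; rewrite ler_norml => /andP[_ h].
  have : e / b * a <= e / b * t' by rewrite ler_wpM2l // divr_ge0 // ltW.
  have -> : e / b * a = e * a / b by rewrite mulrAC.
  by rewrite mulrDl mul1r; lra.
have := pmean_mono p0 q0 (grow _ _ ap' pp) (grow _ _ aq' qq).
rewrite pmean_homog // => h.
have : e / b * pmean r lam p' q' <= e / b * b.
  by rewrite ler_wpM2l ?pmean_le // divr_ge0 // ltW.
rewrite mulfVK ?gt_eqF // => h2.
by move: h; rewrite mulrDl mul1r lerBlDl => /le_trans; apply; rewrite lerD2l.
Qed.

End PowerMean.

Section Averages.
Context (R : realType).
Implicit Types (y : nat -> R) (lam c l e : R).

(** With S the shift of sequences this is (1 - lam) S + lam, so its n-th iterate weights y (k + j)
    by the binomial probability of j steps to the right. *)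
Definition shift_avg lam y k := (1 - lam) * y k.+1 + lam * y k.

Lemma iter_shift_avgS lam y n k :
  iter n.+1 (shift_avg lam) y k = (1 - lam) * iter n (shift_avg lam) y k.+1 + lam *
    iter n (shift_avg lam) y k.
Proof. by []. Qed.

(** The map t |-> (1 - lam) (c + e) + lam t contracts towards c + e, so the excess of v decays like
    lam ^+ k. It carries an asymptotic bound from position k.+1 of a sequence back to position k. *)
Lemma contract_le (v : nat -> R) lam c : 0 < lam < 1 ->
  (forall e, 0 < e -> exists N, forall n, (N <= n)%N ->
    v n.+1 <= (1 - lam) * (c + e) + lam * v n) ->
  forall e, 0 < e -> exists N, forall n, (N <= n)%N -> v n <= c + e.
Proof.
move=> /andP[l0 l1] h e e0; have e2 : 0 < e / 2 by rewrite divr_gt0.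
have [N hN] := h _ e2; pose M := `|v N - (c + e / 2)| + 1.
have M0 : 0 < M by rewrite ltr_wpDl.
have bd k : v (k + N)%N - (c + e / 2) <= lam ^+ k * M.
  elim: k => [|k ih]; first by rewrite expr0 mul1r /M (le_trans (ler_norm _)) // lerDl.
  have := hN (k + N)%N (leq_addl _ _); rewrite exprS -mulrA addSn.
  have : lam * (v (k + N)%N - (c + e / 2)) <= lam * (lam ^+ k * M) by rewrite
    ler_wpM2l // ltW.
  lra.
have /cvgrPdist_lt /(_ (e / 2 / M)) [|K _ hK] : (GRing.exp lam : R ^nat) x @[x -->
  \oo] --> 0.
- by apply: cvg_expr; rewrite gtr0_norm.
- by rewrite divr_gt0.
exists (K + N)%N => n Kn; have := bd (n - N)%N.
rewrite subnK ?(leq_trans (leq_addl _ _) Kn) // => h1.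
have := hK (n - N)%N; rewrite /= leq_subRL ?(leq_trans (leq_addl _ _) Kn) // addnC =>
  /(_ Kn).
rewrite sub0r normrN ger0_norm ?exprn_ge0 ?(ltW l0) // ltr_pdivlMr // => h2.
lra.
Qed.

(** Averages look only to the right, so from the index K on, where y is close to l, they stay close
    for every n. The finitely many positions before K follow one at a time from the right, by
    [contract_le]. *)
Lemma shift_avg_tail lam y l : 0 < lam < 1 -> y k @[k --> \oo] --> l ->
  iter n (shift_avg lam) y 0%N @[n --> \oo] --> l.
Proof.
move=> lam01 /cvgrPdist_lt hy; have /andP[l0 l1] := lam01.
apply/cvgrPdist_lt => e e0; have e4 : 0 < e / 4 by rewrite divr_gt0.
have [K _ hK] := hy _ e4.
pose d n k := `|iter n (shift_avg lam) y k - l|.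
have dS n k : d n.+1 k <= (1 - lam) * d n k.+1 + lam * d n k.
  rewrite /d iter_shift_avgS.
  set p := iter n _ _ k.+1; set q := iter n _ _ k.
  have -> : (1 - lam) * p + lam * q - l = (1 - lam) * (p - l) + lam * (q - l) by ring.
  apply: le_trans (ler_normD _ _) _; rewrite !normrM (gtr0_norm l0) ger0_norm //.
  by rewrite subr_ge0 ltW.
have far n k : (K <= k)%N -> d n k <= e / 4.
  elim: n k => [|n ih] k Kk; first by rewrite /d distrC; apply/ltW/hK.
  apply: le_trans (dS n k) _; have := ih k Kk; have := ih k.+1 (leqW Kk).
  set p := d n k.+1; set q := d n k => hp hq.
  have : (1 - lam) * p <= (1 - lam) * (e / 4) by rewrite ler_wpM2l // subr_ge0 ltW.
  have : lam * q <= lam * (e / 4) by rewrite ler_wpM2l // ltW.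
  lra.
have near j : forall k, (K <= k + j)%N -> forall e', 0 < e' ->
  exists N, forall n, (N <= n)%N -> d n k <= e / 4 + e'.
  elim: j => [|j ih] k Kk e' e'0.
    exists 0%N => n _; apply: le_trans (far n k _) _; first by rewrite addn0 in Kk.
    by rewrite lerDl ltW.
  apply: (@contract_le (fun n => d n k) lam (e / 4)) => // e1 e10.
  have [|N hN] := ih k.+1 _ e1 e10; first by rewrite addSnnS.
  exists N => n Nn; apply: le_trans (dS n k) _;
    rewrite lerD2r ler_wpM2l ?subr_ge0 ?(ltW l1) //.
  exact: hN.
have [N hN] := near K 0%N (leqnn _) _ e4.
exists N => // n /= Nn; rewrite distrC; apply: le_lt_trans (hN n Nn) _; lra.
Qed.

Lemma sum_shift (f : nat -> R) p : f p = f 0%N ->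
  \sum_(k < p) f k.+1 = \sum_(k < p) f k.
Proof.
move=> fp; apply/eqP; rewrite -subr_eq0 -sumrB.
rewrite -(big_mkord xpredT (fun k => f k.+1 - f k)) telescope_sumr //.
by rewrite fp subrr.
Qed.

(* The energy \sum_(k < p) Y n k ^+ 2 decreases by exactly
   lam (1 - lam) \sum_(k < p) (Y n k.+1 - Y n k) ^+ 2, so these differences vanish
   in the limit, while the sum over a period is constant. *)
Lemma shift_avg_periodic lam y p : 0 < lam < 1 -> (0 < p)%N ->
  (forall k, y (k + p)%N = y k) ->
  iter n (shift_avg lam) y 0%N @[n --> \oo] --> (\sum_(k < p) y k) / p%:R.
Proof.
move=> lam01 p0 yp; have /andP[l0 l1] := lam01.
pose Y n := iter n (shift_avg lam) y.
have Yp n k : Y n (k + p)%N = Y n k.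
  by elim: n k => [|n ih] k //; rewrite /Y !iter_shift_avgS -!/(Y n) -addSn !ih.
have YS n k : Y n.+1 k = (1 - lam) * Y n k.+1 + lam * Y n k by [].
have sh (f : nat -> R) : (forall k, f (k + p)%N = f k) ->
  \sum_(k < p) f k.+1 = \sum_(k < p) f k.
  by move=> fp; apply: sum_shift; rewrite -[p in LHS]add0n fp.
have Ysum n : \sum_(k < p) Y n k = \sum_(k < p) y k.
  elim: n => // n ih; rewrite -ih.
  under eq_bigr do rewrite YS.
  rewrite big_split /= -!mulr_sumr (sh (Y n)) //; ring.
pose E n := \sum_(k < p) Y n k ^+ 2.
pose D n := \sum_(k < p) (Y n k.+1 - Y n k) ^+ 2.
have ED n : E n - E n.+1 = lam * (1 - lam) * D n.
  have h2 : \sum_(k < p) Y n k.+1 ^+ 2 = E n.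
    by apply: (sh (fun k => Y n k ^+ 2)) => k; rewrite Yp.
  have -> : E n = (1 - lam) * (\sum_(k < p) Y n k.+1 ^+ 2) + lam * E n by rewrite h2;
    ring.
  rewrite /E /D !mulr_sumr -big_split /= -sumrB; apply: eq_bigr => k _.
  rewrite /= /shift_avg; ring.
have D0 n : 0 <= D n by apply: sumr_ge0 => k _; exact: sqr_ge0.
have ll : 0 < lam * (1 - lam) by rewrite mulr_gt0 // subr_gt0.
have Ecv : cvgn E.
  apply: nonincreasing_is_cvgn.
    by apply/nonincreasing_seqP => n; rewrite -subr_ge0 ED mulr_ge0 // ltW.
  by exists 0 => _ [n _ <-]; apply: sumr_ge0 => k _; exact: sqr_ge0.
have p1 : 0 < (p%:R : R) by rewrite ltr0n.
apply/cvgrPdist_lt => e e0; pose d := e / 2 / p%:R.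
have d0 : 0 < d by rewrite /d !divr_gt0.
have /cvg_ex [l /cvgrPdist_lt hl] := Ecv.
have [|N _ hN] := hl (lam * (1 - lam) * d ^+ 2 / 2).
  by rewrite divr_gt0 // mulr_gt0 // exprn_gt0.
exists N => // n /= Nn.
have Dn : D n <= d ^+ 2.
  rewrite -(ler_pM2l ll) -ED.
  have := hN n Nn; have := hN n.+1 (leqW Nn).
  rewrite /= !ltr_norml => /andP[h1 h2] /andP[h3 h4]; lra.
have step k : (k < p)%N -> `|Y n k.+1 - Y n k| <= d.
  move=> kp; rewrite -(@ler_pXn2r _ 2) ?nnegrE ?(ltW d0) // real_normK ?num_real //.
  apply: le_trans Dn; rewrite /D (bigD1 (Ordinal kp)) //= lerDl.
  by apply: sumr_ge0 => j _; exact: sqr_ge0.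
have dist k : (k <= p)%N -> `|Y n k - Y n 0%N| <= k%:R * d.
  elim: k => [_|k ih kp]; first by rewrite subrr normr0 mul0r.
  apply: le_trans (ler_distD (Y n k) _ _) _.
  have := ih (ltnW kp); have := step k kp; rewrite -natr1 mulrDl mul1r; lra.
(* Since the sum over a period is invariant, the error is the mean of the differences Y n k - Y n 0,
   each at most p * d = e / 2. *)
have -> : (\sum_(k < p) y k) / p%:R - iter n (shift_avg lam) y 0%N = (\sum_(k < p) (Y
  n k - Y n 0%N)) / p%:R.
  rewrite sumrB Ysum sumr_const card_ord -[Y n 0%N *+ p]mulr_natr mulrBl -mulrA divff
    ?mulr1 //.
  by rewrite gt_eqF.
rewrite normrM normfV (ger0_norm (ltW p1)) ltr_pdivrMr //.
apply: le_lt_trans (ler_norm_sum _ _ _) _.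
apply: le_lt_trans (_ : \sum_(k < p) (e / 2) < _).
  apply: ler_sum => k _; apply: le_trans (dist k (ltnW (ltn_ord k))) _.
  apply: (@le_trans _ _ (p%:R * d));
    first by rewrite ler_wpM2r ?(ltW d0) // ler_nat ltnW.
  by rewrite /d mulrC mulfVK // gt_eqF.
rewrite sumr_const card_ord -[_ *+ p]mulr_natr ltr_pM2r //; lra.
Qed.

Lemma powR_cvg r (u : nat -> R) l : 0 < l -> (forall n, 0 < u n) ->
  u n @[n --> \oo] --> l ->
  u n `^ r @[n --> \oo] --> l `^ r.
Proof.
move=> l0 u0 ul.
have powE (p : R) : 0 < p -> p `^ r = expR (r * ln p).
  by move=> p0; rewrite /powR gt_eqF.
rewrite powE //; under eq_fun do rewrite powE //.
apply: cvg_comp; last exact: continuous_expR.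
apply: cvgM; first exact: cvg_cst.
by apply: cvg_comp ul _; exact: continuous_ln.
Qed.

End Averages.

(** * Limits of iterated power means *)

Section MeanLimit.
Context (R : realType) (r : R) (r0 : r != 0).
Implicit Types (a : nat -> R) (lam m M : R).

(** The later term comes first because dE_s stands to the left of U and therefore reads the
    eigenvalue at U x. *)
Definition mean_step lam a k := pmean r lam (a k.+1) (a k).

Lemma mean_step_bounds lam a m M : 0 < lam < 1 -> 0 < m -> (forall k, m <= a k <= M) ->
  forall n k, m <= iter n (mean_step lam) a k <= M.
Proof.
move=> lam01 m0 ha; elim=> // n ih k.
have /andP[h1 h2] := ih k; have /andP[h3 h4] := ih k.+1.
by rewrite /= /mean_step pmean_ge ?pmean_le //; apply: lt_le_trans m0 _.
Qed.

Lemma mean_step_pow lam a n k : 0 < lam < 1 -> (forall k, 0 < a k) ->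
  0 < iter n (mean_step lam) a k /\ iter n (mean_step lam) a k `^ r = iter n
    (shift_avg lam) (fun k => a k `^ r) k.
Proof.
move=> lam01 a0; elim: n k => // n ih k.
have [h1 h2] := ih k; have [h3 h4] := ih k.+1.
rewrite /= /mean_step /shift_avg; split; first exact: pmean_gt0.
by rewrite pmean_pow // h2 h4.
Qed.

(** The weight 1/2 is only a representative: [mean_step_lim] gives the same limit for every weight
    once the averages of the r-th powers have a limit common to all weights. *)
Definition mean_lim a := lim (iter n (mean_step 2^-1) a 0%N @[n --> \oo]).

Lemma iter_mean_step_shift lam n (a : nat -> R) k :
  iter n (mean_step lam) (fun k => a k.+1) k = iter n (mean_step lam) a k.+1.
Proof.
elim: n k => [|n ih] k; first by [].
exact: (f_equal2 (pmean r lam) (ih k.+1) (ih k)).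
Qed.

Lemma half01 : 0 < (2^-1 : R) < 1.
Proof. by apply/andP; split; lra. Qed.

Lemma mean_step_lim a (l m M : R) : 0 < m -> (forall k, m <= a k <= M) ->
  (forall lam, 0 < lam < 1 -> iter n (shift_avg lam) (fun k => a k `^ r) 0%N
    @[n --> \oo] --> l) ->
  forall lam, 0 < lam < 1 -> iter n (mean_step lam) a 0%N @[n --> \oo] --> mean_lim a.
Proof.
move=> m0 ha hl.
have a0 k : 0 < a k by have /andP[h _] := ha k; exact: lt_le_trans m0 h.
have M0 : 0 < M by have /andP[_ h] := ha 0%N; exact: lt_le_trans (a0 0%N) h.
(* The sign of r decides which of the two powers is the lower bound of the averages. As b > 0, the
   limit l is positive, and the power 1/r is continuous there. *)
pose b := Num.min (m `^ r) (M `^ r).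
have b0 : 0 < b by rewrite lt_min !powR_gt0.
have bb n : b <= iter n (shift_avg 2^-1) (fun k => a k `^ r) 0%N.
  have [h <-] := mean_step_pow n 0 half01 a0.
  have /andP[h1 h2] := mean_step_bounds half01 m0 ha n 0.
  rewrite ge_min; have [rn|rp|re] := ltgtP r 0; last by case: (elimN eqP r0 re).
    by rewrite (powR_mono_neg rn M0 h) h2 orbT.
  by rewrite (powR_mono_pos rp m0 h) h1.
have l0 : 0 < l.
  have /cvgrPdist_lt /(_ b b0) [N _ /(_ N (leqnn N))] := hl _ half01.
  by rewrite /= ltr_norml => /andP[h _]; have := bb N; lra.
have key lam : 0 < lam < 1 -> iter n (mean_step lam) a 0%N @[n --> \oo] --> l `^ r^-1.
  move=> lam01; have -> : (fun n => iter n (mean_step lam) a 0%N) =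
      (fun n => iter n (shift_avg lam) (fun k => a k `^ r) 0%N `^ r^-1).
    apply/funext => n; have [h <-] := mean_step_pow n 0 lam01 a0.
    by rewrite -powRrM mulfV // powRr1 // ltW.
  apply: powR_cvg => //; last exact: hl.
  by move=> n; have [h <-] := mean_step_pow n 0 lam01 a0; exact: powR_gt0.
have -> : mean_lim a = l `^ r^-1 by apply: cvg_lim => //; exact: key half01.
exact: key.
Qed.

Lemma mean_lim_const a (l m M : R) : 0 < m -> (forall k, m <= a k <= M) ->
  a k @[k --> \oo] --> l ->
  (forall lam, 0 < lam < 1 -> iter n (mean_step lam) a 0%N @[n --> \oo] --> mean_lim
    a) /\ mean_lim a = l.
Proof.
move=> m0 ha al.
have a0 k : 0 < a k by have /andP[h _] := ha k; exact: lt_le_trans m0 h.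
have l0 : 0 < l.
  have /cvgrPdist_lt /(_ m m0) [N _ /(_ N (leqnn N))] := al.
  by rewrite /= ltr_norml => /andP[h _]; have /andP[h1 _] := ha N; lra.
have hl lam : 0 < lam < 1 -> iter n (shift_avg lam) (fun k => a k `^ r) 0%N
  @[n --> \oo] --> l `^ r.
  by move=> lam01; apply: shift_avg_tail => //; exact: powR_cvg.
split; first exact: mean_step_lim m0 ha hl.
apply: cvg_lim => //.
have -> : (fun n => iter n (mean_step 2^-1) a 0%N) =
      (fun n => iter n (shift_avg 2^-1) (fun k => a k `^ r) 0%N `^ r^-1).
  apply/funext => n; have [h <-] := mean_step_pow n 0 half01 a0.
  by rewrite -powRrM mulfV // powRr1 // ltW.
rewrite -[X in _ --> X](_ : (l `^ r) `^ r^-1 = l);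
  last by rewrite -powRrM mulfV // powRr1 // ltW.
apply: powR_cvg; [exact: powR_gt0 | | exact: hl half01].
by move=> n; have [h <-] := mean_step_pow n 0 half01 a0; exact: powR_gt0.
Qed.

Lemma mean_lim_periodic a (m M : R) p : 0 < m -> (forall k, m <= a k <= M) ->
  (0 < p)%N ->
  (forall k, a (k + p)%N = a k) ->
  forall lam, 0 < lam < 1 -> iter n (mean_step lam) a 0%N @[n --> \oo] --> mean_lim a.
Proof.
move=> m0 ha p0 ap; apply: (mean_step_lim m0 ha) => lam lam01.
by apply: shift_avg_periodic p0 _ => // k; rewrite ap.
Qed.

Lemma mean_lim_bounds a m M : 0 < m -> (forall k, m <= a k <= M) ->
  iter n (mean_step 2^-1) a 0%N @[n --> \oo] --> mean_lim a -> m <= mean_lim a <= M.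
Proof.
move=> m0 ha /cvgrPdist_lt hl; apply/andP; split; apply/ler_addgt0Pr => e e0;
  have [N _ /(_ N (leqnn N))] := hl e e0; rewrite /= ltr_norml => /andP[h1 h2];
  have /andP[h3 h4] := mean_step_bounds half01 m0 ha N 0; lra.
Qed.

End MeanLimit.

(** * The real inner product of a complex Hilbert space *)

Section Hilbert.
Context {R : realType} {H : completeNormedModType R[i]}.
Context (ip : {dot H for Num.conj}) (hip : induces_norm ip).
Implicit Types (x y z u v w : H) (a b c : R) (A B T V : H -> H) (M : set H).

(** Taking real parts makes H a real inner product space, with inequalities stated in R. The
    imaginary part comes back by pairing with multiples by i, as in [ip_rip]. *)
Definition rip x y : R := complex.Re (ip x y).
Local Notation "''[' x , y ]" := (rip x y) : ring_scope.
Local Notation "a *:r x" := (a%:C *: x) (at level 40) : ring_scope.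

Lemma ReD (p q : R[i]) : complex.Re (p + q) = complex.Re p + complex.Re q.
Proof. by case: p q => [? ?] [? ?]. Qed.

Lemma ReN (p : R[i]) : complex.Re (- p) = - complex.Re p.
Proof. by case: p. Qed.

Lemma ReZ a (p : R[i]) : complex.Re (a%:C * p) = a * complex.Re p.
Proof. by case: p => p q /=; rewrite mul0r subr0. Qed.

Lemma ipC x y : ip x y = (ip y x)^*%C.
Proof. by rewrite hermC expr0 mul1r. Qed.

Lemma ipZr (c : R[i]) x y : ip x (c *: y) = c^*%C * ip x y.
Proof. by rewrite ipC linearZl_LR rmorphM /= -ipC. Qed.

Lemma ripC x y : '[x, y] = '[y, x].
Proof. by rewrite /rip ipC; case: (ip y x). Qed.

Lemma ripDl x y z : '[x + y, z] = '[x, z] + '[y, z].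
Proof. by rewrite /rip linearDl ReD. Qed.

Lemma ripDr x y z : '[z, x + y] = '[z, x] + '[z, y].
Proof. by rewrite !(ripC z) ripDl. Qed.

Lemma ripZl a x y : '[a *:r x, y] = a * '[x, y].
Proof. by rewrite /rip linearZl_LR /= ReZ. Qed.

Lemma ripZr a x y : '[x, a *:r y] = a * '[x, y].
Proof. by rewrite !(ripC x) ripZl. Qed.

Lemma ripNl x y : '[- x, y] = - '[x, y].
Proof. by rewrite /rip linearNl ReN. Qed.

Lemma ripNr x y : '[x, - y] = - '[x, y].
Proof. by rewrite !(ripC x) ripNl. Qed.

Lemma ripBl x y z : '[x - y, z] = '[x, z] - '[y, z].
Proof. by rewrite ripDl ripNl. Qed.

Lemma ripBr x y z : '[z, x - y] = '[z, x] - '[z, y].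
Proof. by rewrite ripDr ripNr. Qed.

Lemma rip0l x : '[0, x] = 0.
Proof. by rewrite /rip linear0l. Qed.

Lemma rip0r x : '[x, 0] = 0.
Proof. by rewrite ripC rip0l. Qed.

Definition ripE := (ripDl, ripDr, ripBl, ripBr, ripZl, ripZr, ripNl, ripNr, rip0l,
  rip0r).

Lemma ripii x y : '['i%C *: x, 'i%C *: y] = '[x, y].
Proof.
rewrite /rip linearZl_LR /= ipZr; case: (ip x y) => p q /=.
by rewrite !mul0r !mul1r !sub0r !add0r mulNr mul1r opprK.
Qed.

Lemma ripix x : '['i%C *: x, x] = 0.
Proof.
have /eqP := ripC ('i%C *: x) x; rewrite -[X in _ == X]ripii scalerA.
rewrite -expr2 sqr_i scaleN1r ripNr -subr_eq0 opprK -mulr2n mulrn_eq0 /=.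
by move/eqP.
Qed.

Lemma ripiNl x y : '['i%C *: x, y] = - '[x, 'i%C *: y].
Proof. by rewrite -ripii scalerA -expr2 sqr_i scaleN1r ripNl. Qed.

Lemma ip_rip x y : ip x y = ('[x, y] +i* '[x, 'i%C *: y])%C.
Proof.
rewrite /rip ipZr; case: (ip x y) => p q /=; congr (_ +i* _)%C.
by rewrite mul0r mulNr mul1r opprK add0r.
Qed.

Lemma ip_ext x y x' y' : (forall c : R[i], '[x, c *: y] = '[x', c *: y']) ->
  ip x y = ip x' y'.
Proof.
move=> h; rewrite !ip_rip; congr (_ +i* _)%C; last exact: h.
by have := h 1; rewrite !scale1r.
Qed.

Lemma scale_split (c : R[i]) x :
  c *: x = complex.Re c *:r x + complex.Im c *:r ('i%C *: x).
Proof.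
rewrite scalerA -scalerDl; congr (_ *: _); case: c => p q /=.
by apply/eqP; rewrite eq_complex /=;
  rewrite !mul0r !mulr0 !mulr1 !subr0 !addr0 !add0r !eqxx.
Qed.

Lemma normHE x : `|x| = (rnorm x)%:C.
Proof.
have h : 0 <= `|x| by exact: normr_ge0.
rewrite /rnorm; move: h; case: `|x| => p q /=.
by rewrite lecE /= => /andP[/eqP ->].
Qed.

Lemma rnorm_ge0 x : 0 <= rnorm x.
Proof. by have := normr_ge0 x; rewrite normHE ler0c. Qed.
#[local] Hint Resolve rnorm_ge0 : core.

Lemma ripxx x : '[x, x] = rnorm x ^+ 2.
Proof. by rewrite /rip -hip normHE /= mulr0 subr0. Qed.

Lemma rnorm0 : rnorm (0 : H) = 0.
Proof. by rewrite /rnorm normr0. Qed.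

Lemma rnorm_eq0 x : (rnorm x == 0) = (x == 0).
Proof. by rewrite -[RHS]normr_eq0 normHE eq_complex /= eqxx andbT. Qed.

Lemma rnorm_gt0 x : (0 < rnorm x) = (x != 0).
Proof. by rewrite lt_def rnorm_ge0 andbT rnorm_eq0. Qed.

Lemma ripxx_ge0 x : 0 <= '[x, x].
Proof. by rewrite ripxx sqr_ge0. Qed.

Lemma ripxx_eq0 x : ('[x, x] == 0) = (x == 0).
Proof. by rewrite ripxx sqrf_eq0 rnorm_eq0. Qed.

Lemma ripxx_gt0 x : (0 < '[x, x]) = (x != 0).
Proof. by rewrite lt_def ripxx_ge0 andbT ripxx_eq0. Qed.

Lemma rip_eq0 x : (forall y, '[x, y] = 0) -> x = 0.
Proof. by move=> h; apply/eqP; rewrite -ripxx_eq0 h. Qed.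

Lemma rnormD x y : rnorm (x + y) <= rnorm x + rnorm y.
Proof.
by have := ler_normD x y; rewrite !normHE -rmorphD lecR.
Qed.

Lemma rnormN x : rnorm (- x) = rnorm x.
Proof. by rewrite /rnorm normrN. Qed.

Lemma rnormB x y : rnorm (x - y) = rnorm (y - x).
Proof. by rewrite -rnormN opprB. Qed.

Lemma rnorm_tri x y z : rnorm (x - z) <= rnorm (x - y) + rnorm (y - z).
Proof. by apply: le_trans (rnormD _ _); rewrite addrA subrK. Qed.

Lemma rnormZ (c : R[i]) x : rnorm (c *: x) = complex.Re `|c| * rnorm x.
Proof.
rewrite /rnorm normrZ !normHE.
by rewrite mulrC ReZ mulrC.
Qed.

Lemma rnormZr a x : rnorm (a *:r x) = `|a| * rnorm x.
Proof. by rewrite rnormZ normc_def /= expr0n addr0 sqrtr_sqr. Qed.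

(** The square of the norm of '[y, y] x - '[x, y] y equals '[y, y] times the difference of the two
    sides. *)
Lemma cauchy_schwarz_sqr x y : '[x, y] ^+ 2 <= '[x, x] * '[y, y].
Proof.
have [->|y0] := eqVneq y 0; first by rewrite !rip0r mulr0 expr0n.
have yy : 0 < '[y, y] by rewrite ripxx_gt0.
have := ripxx_ge0 ('[y, y] *:r x - '[x, y] *:r y).
rewrite !ripE (ripC y x).
set p := '[x, x]; set q := '[y, y]; set s := '[x, y] => h.
have : 0 <= q * (p * q - s ^+ 2) by apply: le_trans h _; lra.
by rewrite pmulr_rge0 // subr_ge0.
Qed.

Lemma cauchy_schwarz x y : `|'[x, y]| <= rnorm x * rnorm y.
Proof.
rewrite -(@ler_pXn2r _ 2) ?nnegrE ?mulr_ge0 //.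
by rewrite exprMn -!ripxx real_normK ?num_real // cauchy_schwarz_sqr.
Qed.

Lemma rip_le x y : '[x, y] <= rnorm x * rnorm y.
Proof. exact: le_trans (ler_norm _) (cauchy_schwarz x y). Qed.

Lemma rip_suml (I : Type) (s : seq I) (f : I -> H) y :
  '[\sum_(i <- s) f i, y] = \sum_(i <- s) '[f i, y].
Proof. by elim/big_rec2: _ => [|i a x _ <-]; rewrite ?rip0l ?ripDl. Qed.

Lemma rip_sumr (I : Type) (s : seq I) (f : I -> H) y :
  '[y, \sum_(i <- s) f i] = \sum_(i <- s) '[y, f i].
Proof. by rewrite ripC rip_suml; apply: eq_bigr => i _; rewrite ripC. Qed.

(** * Convergence, completeness and boundedness through the real norm *)

Definition tends (f : nat -> H) x :=
  forall e : R, 0 < e -> exists N, forall n, (N <= n)%N -> rnorm (f n - x) < e.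

Definition cauchyH (f : nat -> H) := forall e : R, 0 < e -> exists N,
  forall m n, (N <= m)%N -> (N <= n)%N -> rnorm (f m - f n) < e.

Lemma gt0_complexE (e : R[i]) : 0 < e -> e = (complex.Re e)%:C /\ 0 < complex.Re e.
Proof. by case: e => p q; rewrite ltcE /= => /andP[/eqP -> ->]. Qed.

Lemma tendsP (f : nat -> H) x : f n @[n --> \oo] --> x <-> tends f x.
Proof.
split.
  move=> /cvgrPdist_lt h e e0.
  have /h [N _ hN] : 0 < e%:C by rewrite -[0]/(0%:C) ltcR.
  by exists N => n /hN /=; rewrite normHE ltcR rnormB.
move=> h; apply/cvgrPdist_lt => e /gt0_complexE [-> /h [N hN]].
by exists N => // n /= /hN; rewrite normHE ltcR rnormB.
Qed.

Lemma completeH (f : nat -> H) : cauchyH f -> exists x, tends f x.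
Proof.
move=> h.
have /cauchy_cvgP /cvg_ex [x hx] : cauchy (f n @[n --> \oo]).
  apply/cauchy_ballP => e /gt0_complexE [-> /h [N hN]].
  exists ([set f n | n in [set n | (N <= n)%N]], [set f n | n in [set n | (N <= n)%N]]).
    by split; exists N => // n /= nN; exists n.
  move=> [x y] /= [[m mN <-] [n nN <-]].
  by rewrite -ball_normE /ball_ /= normHE ltcR; exact: hN.
by exists x; apply/tendsP.
Qed.

Lemma closedHP M : closed M <->
  forall x, (forall e : R, 0 < e -> exists2 y, M y & rnorm (x - y) < e) -> M x.
Proof.
split=> [cM x h|h].
  apply: cM => B /nbhs_ballP [e /gt0_complexE [-> e0] hB].
  have [y My xy] := h _ e0; exists y; split=> //; apply: hB.
  by rewrite -ball_normE /ball_ /= normHE ltcR.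
move=> x cx; apply: h => e e0.
have /cx [y [My]] : nbhs x (ball x e%:C).
  by apply: nbhsx_ballx; rewrite -[0]/(0%:C) ltcR.
by rewrite -ball_normE /ball_ /= normHE ltcR; exists y.
Qed.

Lemma closed_tends M f x : closed M -> (forall n, M (f n)) -> tends f x -> M x.
Proof.
move=> /closedHP cM Mf fx; apply: cM => e /fx [N hN].
by exists (f N) => //; rewrite rnormB hN.
Qed.

Definition bounded_lin T := linear T /\ exists2 C : R, 0 <= C &
  forall x, rnorm (T x) <= C * rnorm x.

Lemma linZ T (c : R[i]) x : linear T -> T (c *: x) = c *: T x.
Proof.
move=> lT; have T0 : T 0 = 0.
  by have := lT (-1) 0 0; rewrite scaler0 scaleN1r addr0 addNr.
by rewrite -[c *: x]addr0 lT T0 addr0.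
Qed.

Lemma linD T x y : linear T -> T (x + y) = T x + T y.
Proof. by move=> lT; rewrite -[x in LHS]scale1r lT scale1r. Qed.

Lemma lin0 T : linear T -> T 0 = 0.
Proof. by move=> lT; have := lT (-1) 0 0; rewrite scaler0 scaleN1r addr0 addNr. Qed.

Lemma linN T x : linear T -> T (- x) = - T x.
Proof. by move=> lT; rewrite -scaleN1r linZ // scaleN1r. Qed.

Lemma linB T x y : linear T -> T (x - y) = T x - T y.
Proof. by move=> lT; rewrite linD // linN. Qed.

Lemma lin_sum T (I : Type) (s : seq I) (f : I -> H) : linear T ->
  T (\sum_(i <- s) f i) = \sum_(i <- s) T (f i).
Proof.
move=> lT; elim/big_rec2: _ => [|i x y _ <-]; rewrite ?lin0 // linD //.
Qed.

Lemma bounded_linP T : bounded_op T <-> bounded_lin T.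
Proof.
split=> [[lT cT]|[lT [C C0 hC]]]; split=> //.
  have /cvgrPdist_lt /(_ 1%:C) := cT 0.
  rewrite ltcR ltr01 => /(_ isT) /nbhs_ballP [d /gt0_complexE [-> d0] hd].
  exists (2 / complex.Re d) => [|x]; first by rewrite divr_ge0 // ltW.
  have [->|x0] := eqVneq x 0; first by rewrite lin0 // rnorm0 mulr0.
  set k := complex.Re d / (2 * rnorm x).
  have nx : 0 < rnorm x by rewrite rnorm_gt0.
  have k0 : 0 < k by rewrite divr_gt0 // mulr_gt0.
  have := hd (k *:r x); rewrite -ball_normE /ball_ /= sub0r normrN normHE.
  rewrite rnormZr gtr0_norm // ltcR lin0 // sub0r normrN normHE ltcR linZ //.
  rewrite rnormZr gtr0_norm // => h.
  have /h h1 : k * rnorm x < complex.Re d.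
    rewrite /k -mulrA invfM -[_ * rnorm x]mulrA mulVf ?gt_eqF // mulr1.
    by rewrite ltr_pdivrMr // ltr_pMr // ltr1n.
  have : rnorm (T x) < k^-1 by rewrite -(ltr_pM2l k0) mulfV // gt_eqF.
  by move/ltW/le_trans; apply; rewrite /k invf_div mulrAC.
move=> x; apply/cvgrPdist_lt => e /gt0_complexE [-> e0].
have C1 : 0 < C + 1 by rewrite ltr_wpDl.
apply/nbhs_ballP; exists (complex.Re e / (C + 1))%:C => /=.
  by rewrite -[0]/(0%:C) ltcR divr_gt0.
move=> y; rewrite -ball_normE /ball_ /= !normHE !ltcR => h.
rewrite -linB //; apply: le_lt_trans (hC _) _.
rewrite -(mulfVK (lt0r_neq0 C1) (complex.Re e)) mulrC.
apply: le_lt_trans (_ : _ <= rnorm (x - y) * (C + 1)) _; last by rewrite ltr_pM2r.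
by rewrite ler_wpM2l // lerDl.
Qed.

Lemma bounded_lin_comp A B : bounded_lin A -> bounded_lin B -> bounded_lin (A \o B).
Proof.
move=> [lA [C C0 hA]] [lB [D D0 hB]]; split; first by move=> k x y /=; rewrite lB lA.
exists (C * D) => [|x /=]; first exact: mulr_ge0.
by apply: le_trans (hA _) _; rewrite -mulrA ler_wpM2l.
Qed.

Lemma bounded_lin_id : bounded_lin idfun.
Proof. by split=> //; exists 1 => // x; rewrite mul1r. Qed.

Lemma bounded_lin_tends A f x : bounded_lin A -> tends f x -> tends (A \o f) (A x).
Proof.
move=> [lA [C C0 hC]] fx e e0.
have C1 : 0 < C + 1 by rewrite ltr_wpDl.
have [|N hN] := fx (e / (C + 1)); first exact: divr_gt0.
exists N => n /hN; rewrite ltr_pdivlMr // => h.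
rewrite /= -linB //; apply: le_lt_trans (hC _) _.
by apply: le_lt_trans h; rewrite mulrC ler_wpM2l // lerDl.
Qed.

Lemma le_eps a b : (forall e : R, 0 < e -> a <= b + e) -> a <= b.
Proof. by move=> h; apply/ler_addgt0Pr => e /h. Qed.

(** * Closed subspaces and orthogonal projection *)

Definition subsp M := M 0 /\ forall (c : R[i]) x y, M x -> M y -> M (c *: x + y).

Lemma csubspP M : closed_subspace M <-> closed M /\ subsp M.
Proof. by split=> [[? ? ?]|[? [? ?]]]. Qed.

Lemma subspD M x y : subsp M -> M x -> M y -> M (x + y).
Proof. by move=> [_ h] Mx My; rewrite -[x]scale1r; apply: h. Qed.

Lemma subspZ M (c : R[i]) x : subsp M -> M x -> M (c *: x).
Proof. by move=> [M0 h] Mx; rewrite -[_ *: _]addr0; apply: h. Qed.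

Lemma subspB M x y : subsp M -> M x -> M y -> M (x - y).
Proof. by move=> sM Mx My; rewrite -scaleN1r; apply: subspD => //; apply: subspZ. Qed.

(** Quantifying over complex multiples turns real orthogonality into complex orthogonality, so that
    this is a complex subspace for any set S. *)
Definition orthc (S : set H) : set H :=
  [set x | forall (c : R[i]) y, S y -> '[x, c *: y] = 0].

Lemma rip_cont_eq0 x y : (forall e : R, 0 < e ->
  exists2 z, '[z, y] = 0 & rnorm (x - z) < e) ->
  '[x, y] = 0.
Proof.
move=> h; apply/eqP; rewrite -normr_le0; apply: le_eps => e e0; rewrite add0r.
have y1 : 0 < rnorm y + 1 by rewrite ltr_wpDl.
have [|z zy xz] := h (e / (rnorm y + 1)); first exact: divr_gt0.
rewrite -[x](subrK z) ripDl zy addr0; apply: le_trans (cauchy_schwarz _ _) _.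
move: xz; rewrite ltr_pdivlMr // => /ltW; apply: le_trans.
by rewrite ler_wpM2l // lerDl.
Qed.

Lemma orthc_csub S : closed_subspace (orthc S).
Proof.
split.
- apply/closedHP => x h c y Sy; apply: rip_cont_eq0 => e /h [z Sz xz].
  by exists z => //; apply: Sz.
- by move=> c y _; rewrite rip0l.
- move=> k x y hx hy c z Sz; rewrite ripDl hy // addr0 scale_split ripDl !ripZl hx //
  mulr0 add0r.
  by rewrite ripiNl scalerA hx // oppr0 mulr0.
Qed.
(** At t = - a / (|b| + 1) the linear term would dominate and make the value negative. This is the
    first-order condition behind every extremal argument below. *)
Lemma quad_ge0 a b : (forall t, 0 <= t * a + t ^+ 2 * b) -> a = 0.
Proof.
move=> h; apply/eqP; apply: contraT => a0.
have k0 : 0 < `|b| + 1 by rewrite ltr_wpDl.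
have := h (- a / (`|b| + 1)).
have -> : - a / (`|b| + 1) * a + (- a / (`|b| + 1)) ^+ 2 * b =
    - (a / (`|b| + 1)) ^+ 2 * (`|b| + 1 - b) by field; rewrite gt_eqF.
rewrite mulNr oppr_ge0 leNgt mulr_gt0 // ?exprn_even_gt0 //=.
  by rewrite mulf_neq0 // invr_eq0 gt_eqF.
by rewrite subr_gt0 ltr_pwDr // ler_norm.
Qed.

Lemma inv_small (e : R) : 0 < e -> exists N, forall n, (N <= n)%N -> n.+1%:R^-1 < e.
Proof.
move=> e0; exists (Num.bound e^-1) => n hn.
rewrite -(ltf_pV2 e0) ?invrK ?posrE ?invr_gt0 ?ltr0Sn //.
have := archi_boundP (ltW (_ : 0 < e^-1)); rewrite invr_gt0 => /(_ e0) /lt_le_trans.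
by apply; rewrite ler_nat; apply: leq_trans hn _.
Qed.

Lemma inf_approx (S : set R) b : S !=set0 -> (forall s, S s -> b <= s) ->
  exists2 m : R, (forall s, S s -> m <= s) & forall e, 0 < e ->
    exists2 s, S s & s < m + e.
Proof.
move=> S0 hb; have hS : has_inf S by split=> //; exists b.
by exists (inf S) => [s|e e0]; [move=> Ss; apply: ge_inf => //;
  case: hS | exact: inf_adherent].
Qed.

(** The parallelogram law, applied to midpoints in M, makes a minimizing sequence for the distance
    Cauchy; varying its limit along M gives the orthogonality. *)
Lemma proj_ex M x : closed_subspace M -> exists2 m, M m & orthc M (x - m).
Proof.
move=> /csubspP [cM sM].
have M0 : M 0 by case: sM.
pose S := [set '[x - m, x - m] | m in M].
have [||d hd ha] := @inf_approx S 0.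
- by exists '[x - 0, x - 0], 0.
- by move=> _ [m _ <-]; exact: ripxx_ge0.
have par m p : M m -> M p -> '[m - p, m - p] <=
    2 * ('[x - m, x - m] - d) + 2 * ('[x - p, x - p] - d).
  move=> Mm Mp; have Mmp : M (2^-1 *:r (m + p)) by apply: subspZ sM (subspD sM Mm Mp).
  have /hd : S '[x - 2^-1 *:r (m + p),
    x - 2^-1 *:r (m + p)] by exists (2^-1 *:r (m + p)).
  by rewrite !ripE (ripC p m) (ripC m x) (ripC p x); lra.
have /choice [m hm] n : exists m, M m /\ '[x - m, x - m] < d + n.+1%:R^-1.
  have [|_ [m Mm <-] h] := ha n.+1%:R^-1; first by rewrite invr_gt0.
  by exists m.
have [|l ml] := @completeH m.
  move=> e e0; have [|N hN] := @inv_small (e ^+ 2 / 4);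
    first by rewrite divr_gt0 // exprn_gt0.
  have key k : (N <= k)%N -> '[x - m k, x - m k] - d < e ^+ 2 / 4.
    by move=> /hN h; rewrite ltrBlDl; apply: lt_trans (hm k).2 _; rewrite ltrD2l.
  exists N => p q /key Np /key Nq.
  rewrite -(@ltr_pXn2r _ 2) ?nnegrE // ?(ltW e0) // -ripxx.
  apply: le_lt_trans (par _ _ (hm p).1 (hm q).1) _.
  by lra.
have Ml : M l by apply: closed_tends cM _ ml => n; exact: (hm n).1.
have minl y : M y -> '[x - l, x - l] <= '[x - y, x - y].
  move=> My; apply: le_trans (hd _ _); last by exists y.
  rewrite ripxx -[d]sqr_sqrtr; last first.
    by apply: (@le_eps 0 d) => e e0; have [_ [z _ <-] /ltW] := ha e e0;
      apply: le_trans; exact: ripxx_ge0.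
  rewrite ler_pXn2r ?nnegrE ?sqrtr_ge0 //; apply: le_eps => e e0.
  have e20 : 0 < e / 2 by rewrite divr_gt0.
  have [N1 h1] := ml _ e20.
  have [|N2 h2] := @inv_small ((e / 2) ^+ 2); first by rewrite exprn_gt0.
  pose n := maxn N1 N2.
  have {}h1 := h1 n (leq_maxl _ _); have {}h2 := h2 n (leq_maxr _ _).
  apply: le_trans (rnorm_tri _ (m n) _) _.
  have d0 : 0 <= d.
    by apply: (@le_eps 0 d) => e' e0'; have [_ [z _ <-] /ltW] := ha e' e0';
      apply: le_trans; exact: ripxx_ge0.
  have : rnorm (x - m n) <= Num.sqrt d + e / 2.
    rewrite -(@ler_pXn2r _ 2) ?nnegrE ?addr_ge0 ?sqrtr_ge0 ?(ltW e20) // -ripxx.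
    rewrite sqrrD sqr_sqrtr //.
    have : 0 <= Num.sqrt d * (e / 2) by rewrite mulr_ge0 ?sqrtr_ge0 ?(ltW e20).
    have : '[x - m n, x - m n] < d + (e / 2) ^+ 2.
      by apply: lt_trans (hm n).2 _; rewrite ltrD2l.
    by lra.
  by lra.
exists l => // c y My.
have Mcy : M (c *: y) by exact: subspZ.
suff : - 2 * '[x - l, c *: y] = 0 by lra.
apply: (@quad_ge0 _ '[c *: y, c *: y]) => t.
have := minl (l + t *:r (c *: y)).
move=> /(_ (subspD sM Ml (subspZ _ sM Mcy))).
have -> : x - (l + t *:r (c *: y)) = (x - l) - t *:r (c *: y) by rewrite opprD addrA.
move: (x - l) (c *: y) => u v; rewrite !ripE (ripC v u); lra.
Qed.

Lemma full_of_orth0 M : closed_subspace M -> (forall x, orthc M x -> x = 0) ->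
  forall x, M x.
Proof.
move=> cM h x; have [m Mm /h /eqP] := proj_ex x cM.
by rewrite subr_eq0 => /eqP ->.
Qed.

(** * Finite dimension and finite codimension *)

Definition perp (zs : seq H) u := forall z, z \in zs -> '[u, z] = 0.
(** [perp] is only real-linear, and dimension counts over R are enough for all uses of
    finiteness. *)
Definition rsubsp M := M 0 /\ forall a x y, M x -> M y -> M (a *:r x + y).

Lemma subsp_rsubsp M : subsp M -> rsubsp M.
Proof. by move=> [M0 h]; split=> // a; apply: h. Qed.

Lemma perp_cons z zs u : perp (z :: zs) u <-> '[u, z] = 0 /\ perp zs u.
Proof.
split=> [h|[uz h] y]; first by split=> [|y yzs]; apply: h;
  rewrite inE ?eqxx // yzs orbT.
by rewrite inE => /orP[/eqP ->|/h].
Qed.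

Lemma perp_cat zs1 zs2 u : perp (zs1 ++ zs2) u <-> perp zs1 u /\ perp zs2 u.
Proof.
split=> [h|[h1 h2] y]; first by split=> y yzs; apply: h; rewrite mem_cat yzs ?orbT.
by rewrite mem_cat => /orP[/h1|/h2].
Qed.

(* M `&` perp zs = 0 says that M has dimension at most size zs; passing to the
   orthogonal of y in M lowers the bound. *)
Lemma exchange M zs y : rsubsp M -> (forall x, M x -> perp zs x -> x = 0) ->
  M y -> y != 0 -> exists2 zs', (size zs' < size zs)%N &
    forall w, M w -> '[w, y] = 0 -> perp zs' w -> w = 0.
Proof.
move=> [M0 sM] h My y0.
have [z zzs yz] : exists2 z, z \in zs & '[y, z] != 0.
  apply: contrapT => hn; move/eqP: y0; apply; apply: h => // z zzs.
  by apply/eqP; apply: contraT => yz; case: hn; exists z.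
exists [seq z' - ('[y, z'] / '[y, z]) *:r z | z' <- rem z zs].
  by rewrite size_map size_rem // prednK // -has_predT; apply/hasP; exists z.
move=> w Mw wy hw.
pose t := - '[w, z] / '[y, z].
have vz : '[t *:r y + w, z] = 0 by rewrite !ripE /t mulfVK // addNr.
suff /h v0 : perp zs (t *:r y + w).
  apply/eqP; rewrite -ripxx_eq0; apply/eqP.
  have : '[t *:r y + w, w] = 0 by rewrite v0 ?rip0l //; apply: sM.
  by rewrite !ripE (ripC y w) wy mulr0 add0r.
move=> z' z'zs; have [->//|zz'] := eqVneq z' z.
have z'r : z' \in rem z zs by move: z'zs;
  rewrite (perm_mem (perm_to_rem zzs)) inE (negbTE zz').
have := hw _ (map_f (fun z' => z' - ('[y, z'] / '[y, z]) *:r z) z'r).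
rewrite !ripE => wz'.
have wz'' : '[w, z'] = '[y, z'] / '[y, z] * '[w, z] by lra.
by rewrite wz'' /t; field.
Qed.

Fixpoint orthonormal_list (es : seq H) : Prop :=
  if es is e :: s then [/\ '[e, e] = 1, forall f, f \in s ->
    '[f, e] = 0 & orthonormal_list s] else True.
Definition proj_list (es : seq H) u : H := \sum_(e <- es) '[u, e] *:r e.

Lemma rip_normalize x : x != 0 -> '[(rnorm x)^-1 *:r x, (rnorm x)^-1 *:r x] = 1.
Proof.
move=> x0; rewrite !ripE ripxx; field.
by rewrite rnorm_eq0.
Qed.

(** A unit vector of M is split off and the process repeats on its orthogonal in M; it stops because
    [exchange] shortens the list that bounds the dimension. *)
Lemma finite_basis M zs : rsubsp M -> (forall x, M x -> perp zs x -> x = 0) ->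
  exists es, [/\ orthonormal_list es, forall e, e \in es -> M e & forall x, M x ->
    x = proj_list es x].
Proof.
elim: {zs}(size zs).+1 {-2}zs (ltnSn (size zs)) M => // n ih zs szs M rM h.
have [M0|/existsNP [y /not_implyP [My /eqP y0]]] := pselect (forall x, M x -> x = 0).
  by exists [::]; split=> // x /M0 ->; rewrite /proj_list big_nil.
pose e := (rnorm y)^-1 *:r y.
have ee : '[e, e] = 1 by exact: rip_normalize.
have e0 : e != 0 by rewrite -ripxx_eq0 ee oner_eq0.
have Me : M e by rewrite /e -[_ *:r _]addr0; apply: rM.2 => //; case: rM.
have [zs' szs' h'] := exchange rM h Me e0.
pose M' := [set x | M x /\ '[x, e] = 0].
have rM' : rsubsp M'.
  split; first by split; [case: rM | rewrite rip0l].
  move=> a x z [Mx xe] [Mz ze]; split; first exact: rM.2.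
  by rewrite ripDl ripZl xe ze mulr0 addr0.
have [||es [oes Mes hes]] := ih zs' _ M' rM'.
- exact: leq_trans szs' _.
- by move=> x [Mx xe]; apply: h'.
exists (e :: es); split.
- by split=> // f /Mes [].
- by move=> f; rewrite inE => /orP[/eqP ->//|/Mes []].
- move=> x Mx; rewrite /proj_list big_cons.
  have /hes : M' (x - '[x, e] *:r e).
    split; last by rewrite ripBl ripZl ee mulr1 subrr.
    by rewrite addrC -scaleNr -rmorphN; apply: rM.2.
  move/eqP; rewrite subr_eq addrC => /eqP xE; rewrite {1}xE; congr (_ + _).
  rewrite /proj_list; apply: eq_big_seq => f /Mes [_ fe].
  by rewrite ripBl ripZl (ripC e f) fe mulr0 subr0.
Qed.

Lemma proj_list_rip es u e : orthonormal_list es -> e \in es ->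
  '[proj_list es u, e] = '[u, e].
Proof.
elim: es => //= f s ih [ff fs os]; rewrite /proj_list big_cons ripDl ripZl inE.
case/orP => [/eqP ->|es].
  rewrite ff mulr1 rip_suml big1_seq ?addr0 // => g /andP[_ /fs gf].
  by rewrite ripZl gf mulr0.
by rewrite (ripC f e) (fs e es) mulr0 add0r ih.
Qed.

Lemma proj_list_norm es u : orthonormal_list es ->
  '[proj_list es u, proj_list es u] = \sum_(e <- es) '[u, e] ^+ 2.
Proof.
move=> oes; rewrite {2}/proj_list rip_sumr; apply: eq_big_seq => e ees.
by rewrite ripZr proj_list_rip // expr2.
Qed.

Lemma proj_list_perp es u : orthonormal_list es -> perp es (u - proj_list es u).
Proof. by move=> oes e ees; rewrite ripBl proj_list_rip // subrr. Qed.

Lemma perp_proj_list es u v : perp es u -> '[u, proj_list es v] = 0.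
Proof.
move=> h; rewrite /proj_list rip_sumr big1_seq // => e /andP[_ ees].
by rewrite ripZr h // mulr0.
Qed.

(** [finite_basis] is applied to the double orthogonal M of zs: a vector of M orthogonal to zs is
    orthogonal to itself, hence zero. *)
Lemma gram_schmidt zs : exists2 es, orthonormal_list es & forall u, perp es u ->
  perp zs u.
Proof.
pose M := [set x | forall v, perp zs v -> '[x, v] = 0].
have [||es [oes _ hes]] := @finite_basis M zs.
- split=> [v _|a x y hx hy v hv]; rewrite !ripE //.
  by rewrite hx // hy // mulr0 addr0.
- by move=> x hx /hx /eqP; rewrite ripxx_eq0 => /eqP.
exists es => // u hu z zzs.
have -> : z = proj_list es z by apply: hes => v hv; rewrite ripC hv.
exact: perp_proj_list.
Qed.

(** The coefficients form a nonzero left kernel vector of an (n + 1) by n matrix. Columns beyond the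
    end of zs use the default vector 0 and impose no condition. *)
Lemma lin_comb_perp n (v : 'I_n.+1 -> H) zs : (size zs <= n)%N ->
  exists2 k : 'I_n.+1 -> R, (exists i, k i != 0) & perp zs (\sum_i k i *:r v i).
Proof.
move=> szs; pose C : 'M[R]_(n.+1, n) := \matrix_(i, j) '[v i, zs`_j].
have : kermx C != 0.
  rewrite kermx_eq0 /row_free neq_ltn; apply/orP; left.
  by rewrite ltnS; exact: rank_leq_col.
case/rowV0Pn => k /sub_kermxP kC k0; exists (fun i => k 0 i).
  apply: contrapT => hn; move/eqP: k0; apply; apply/rowP => i; rewrite mxE.
  by apply/eqP; apply: contraT => ki; case: hn; exists i.
move=> z zzs; rewrite rip_suml.
have jn : (index z zs < n)%N by apply: leq_trans szs; rewrite index_mem.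
have := congr1 (fun m : 'rV_n => m 0 (Ordinal jn)) kC; rewrite !mxE => kCz.
rewrite -[RHS]kCz; apply: eq_bigr => i _; rewrite ripZl mxE /= nth_index //.
Qed.
(** * Forms attaining their supremum on closed subspaces *)

Definition symm A := forall x y, '[A x, y] = '[x, A y].

Definition attains_sup A := forall M, closed_subspace M -> nonzero_subspace M ->
  exists x, [/\ M x, '[x, x] = 1 & forall y, M y -> '[A y, y] <= '[A x, x] * '[y, y]].

Lemma symm_i A x : linear A -> symm A -> '[A x, 'i%C *: x] = 0.
Proof.
move=> lA sA; have := ripiNl x (A x).
by rewrite (ripC ('i%C *: x)) -(linZ _ _ lA) -(sA x ('i%C *: x)) => h; lra.
Qed.

(** Along x + t y the gap '[A x, x] '[., .] - '[A ., .] is nonnegative and vanishes at t = 0, so its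
    linear coefficient is zero. *)
Lemma attains_sup_critical A M x : linear A -> symm A -> subsp M -> M x ->
  '[x, x] = 1 ->
  (forall y, M y -> '[A y, y] <= '[A x, x] * '[y, y]) ->
  forall y, M y -> '[A x, y] = '[A x, x] * '[x, y].
Proof.
move=> lA sA sM Mx xx h y My; set k := '[A x, x].
suff : 2 * (k * '[x, y] - '[A x, y]) = 0 by lra.
apply: (@quad_ge0 _ (k * '[y, y] - '[A y, y])) => t.
have := h _ (subspD sM Mx (subspZ t%:C sM My)); rewrite -subr_ge0.
rewrite (linD _ _ lA) (linZ _ _ lA) !ripE xx (ripC y x) (sA y x) (ripC y (A x)) -/k;
  lra.
Qed.

(** Invariance puts A x - '[A x, x] x in M, so the critical equation of a maximizer x can be tested
    against this very vector. *)
Lemma attains_sup_eigenvector A M : linear A -> symm A -> attains_sup A ->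
  closed_subspace M ->
  nonzero_subspace M -> (forall x, M x -> M (A x)) ->
  exists x b, [/\ M x, '[x, x] = 1 & A x = b *:r x].
Proof.
move=> lA sA hA cM nM iM; have [x [Mx xx hx]] := hA M cM nM.
have [_ sM] : closed M /\ subsp M by apply/csubspP.
exists x, '[A x, x]; split=> //; apply/eqP; rewrite -subr_eq0 -ripxx_eq0.
have My : M (A x - '[A x, x] *:r x) by apply: subspB => //; [exact: iM | exact: subspZ].
by rewrite ripBl (attains_sup_critical lA sA sM Mx xx hx My) ripZl subrr.
Qed.

(** Dependent choice with access to all earlier terms, for sequences whose next term must be
    orthogonal or inequivalent to each of them. *)
Lemma choice_with_history (T : Type) (Q : seq T -> T ->
  Prop) : (forall s, exists t, Q s t) ->
  exists f : nat -> T, forall n, Q [seq f i | i <- iota 0 n] (f n).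
Proof.
move=> /choice [F hF]; pose g n := iter n (fun s => rcons s (F s)) [::].
exists (fun n => F (g n)) => n.
suff -> : [seq F (g i) | i <- iota 0 n] = g n by exact: hF.
by elim: n => // n ih; rewrite -addn1 iotaD map_cat ih addn1 cats1.
Qed.

Lemma mem_history (f : nat -> H) n y : y \in [seq f i | i <- iota 0 n] ->
  exists2 i, (i < n)%N & y = f i.
Proof. by case/mapP => i; rewrite mem_iota add0n => /andP[_ ?] ->; exists i. Qed.

(** Among size zs + 1 independent vectors some nontrivial real combination is orthogonal to zs, and
    independence over R[i] keeps it nonzero. *)
Lemma infdim zs : infinite_dimensional H -> exists2 u, u != 0 & perp zs u.
Proof.
move=> /(_ (size zs).+1) [v hv]; have [k [i ki] hk] := @lin_comb_perp _ v zs (leqnn _).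
exists (\sum_i k i *:r v i) => //; apply: contra ki => /eqP /hv /(_ i) [->].
by [].
Qed.

(* For a = max of the essential spectrum of A this says that A is a + K - F with
   K positive compact and F positive of finite rank. *)
Definition essential_form A a :=
  (forall c, a < c -> exists zs, forall u, perp zs u -> '[A u, u] <= c * '[u, u]) /\
  (exists zs, forall u, perp zs u -> a * '[u, u] <= '[A u, u]).

(** The multiples by i upgrade real to complex orthogonality; the images under A make later vectors
    orthogonal to zs for the form of A as well. *)
Definition graph_list A (zs : seq H) :=
  zs ++ [seq 'i%C *: z | z <- zs] ++ [seq A z | z <- zs] ++ [seq 'i%C *: A z | z <- zs].

Lemma graph_listP A zs u (c : R[i]) z : perp (graph_list A zs) u -> z \in zs ->
  '[u, c *: z] = 0 /\ '[u, c *: A z] = 0.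
Proof.
rewrite /graph_list => /perp_cat [h1 /perp_cat [h2 /perp_cat [h3 h4]]] zzs.
split; rewrite scale_split ripDr !ripZr.
  by rewrite h1 // h2 ?map_f // !mulr0 addr0.
by rewrite h3 ?map_f // h4 ?(map_f (fun z => 'i%C *: A z)) // !mulr0 addr0.
Qed.

(* The form would have to attain on the closed span of the u n a value at least
   sup v, at a vector then orthogonal to every u n. *)
Lemma attains_sup_no_increasing A (u : nat -> H) (v : nat -> R) : bounded_lin A ->
  symm A -> attains_sup A ->
  (forall n, u n != 0) -> (forall n, '[A (u n), u n] = v n * '[u n, u n]) ->
  (forall n, v n < v n.+1) ->
  (forall n m (c : R[i]), '[A (u n) - v n *:r u n, c *: u m] = 0) -> False.
Proof.
move=> bA sA hA u0 hv vinc hw; have lA : linear A by case: bA.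
pose M := orthc (orthc (range u)).
have cM : closed_subspace M by exact: orthc_csub.
have Mu n : M (u n).
  move=> c y hy; have cc : c^*%C^*%C = c by rewrite conjcK.
  have /hy : range u (u n) by exists n.
  move=> h; apply: (_ : complex.Re (ip (u n) (c *: y)) = 0).
  have : ip y (u n) = 0.
    by rewrite ip_rip h; have := h 1; rewrite scale1r => ->.
  by move=> yu; rewrite ipZr ipC yu conjc0 mulr0.
have [|x [Mx xx hx]] := hA M cM; first by exists (u 0%N).
have [clM sM] : closed M /\ subsp M by apply/csubspP.
have crit := attains_sup_critical lA sA sM Mx xx hx.
suff hor : orthc (range u) x.
  by have := Mx 1 _ hor; rewrite scale1r xx => /eqP; rewrite oner_eq0.
move=> c _ [n _ <-].
have Mcu : M (c *: u n) := subspZ c sM (Mu n).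
have w0 : '[x, c *: (A (u n) - v n *:r u n)] = 0.
  by apply: Mx => d _ [m _ <-]; exact: hw.
have := crit _ Mcu; rewrite sA linZ //.
move: w0; rewrite scalerBr ripBr scalerA mulrC -scalerA ripZr => /eqP.
rewrite subr_eq0 => /eqP -> /eqP; rewrite -subr_eq0 -mulrBl mulf_eq0.
case/orP => [|/eqP //]; rewrite subr_eq0 => /eqP vE.
have := hx _ (Mu n.+1); rewrite hv -vE ler_pM2r ?ripxx_gt0 // => /le_lt_trans /(_
  (vinc n)).
by rewrite ltxx.
Qed.

(* If e has value at most t and f at least a, a combination of e and f has any
   prescribed value in between. *)
Lemma essential_step A a zs t : bounded_lin A -> symm A ->
  (forall c, c < a -> forall zs, exists u, [/\ u != 0, perp zs u & c * '[u,
    u] <= '[A u, u]]) ->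
  (forall zs, exists u, perp zs u /\ '[A u, u] < a * '[u, u]) ->
  t < a -> exists u, [/\ u != 0, perp zs u, t * '[u, u] < '[A u, u] & '[A u,
    u] < a * '[u, u]].
Proof.
move=> [lA _] sA hP hN ta.
have [e [ze ea]] := hN zs.
have e0 : e != 0 by apply: contraTneq ea => ->; rewrite lin0 // rip0l mulr0 ltxx.
have E0 : 0 < '[e, e] by rewrite ripxx_gt0.
have [te|et] := ltP (t * '[e, e]) '[A e, e]; first by exists e.
pose c := (t + a) / 2; have tc : t < c by rewrite /c; lra.
have ca : c < a by rewrite /c; lra.
have [f [f0 /perp_cons [fe /perp_cons [fAe zf]] cf]] := hP c ca (e :: A e :: zs).
have F0 : 0 < '[f, f] by rewrite ripxx_gt0.
have [fa|af] := ltP '[A f, f] (a * '[f, f]).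
  by exists f; split=> //; apply: lt_le_trans cf; rewrite ltr_pM2r.
set E := '[e, e] in E0 et ea; set F := '[f, f] in F0 cf af.
set p := '[A e, e] in et ea; set q := '[A f, f] in cf af.
have q1 : 0 < q - c * F by rewrite subr_gt0; apply: lt_le_trans af; rewrite ltr_pM2r.
have p1 : 0 < c * E - p by rewrite subr_gt0; apply: le_lt_trans et _; rewrite ltr_pM2r.
(* The combination has value exactly c iff s^2 (c E - p) = k^2 (q - c F), and these weights solve
   it. Cross terms vanish because f is orthogonal to e and to A e. *)
pose s := Num.sqrt (q - c * F); pose k := Num.sqrt (c * E - p).
have s2 : s ^+ 2 = q - c * F by rewrite sqr_sqrtr // ltW.
have k2 : k ^+ 2 = c * E - p by rewrite sqr_sqrtr // ltW.
have uu : '[s *:r e + k *:r f, s *:r e + k *:r f] = s ^+ 2 * E + k ^+ 2 * F.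
  by rewrite !ripE (ripC e f) fe -/E -/F; ring.
have Au : '[A (s *:r e + k *:r f), s *:r e + k *:r f] = c * (s ^+ 2 * E + k ^+ 2 * F).
  rewrite (linD _ _ lA) !(linZ _ _ lA) !ripE (sA f e) (ripC (A e) f) fAe -/p -/q.
  rewrite !mulr0 add0r addr0 !mulrA -!expr2 s2 k2; ring.
have n0 : 0 < s ^+ 2 * E + k ^+ 2 * F.
  by rewrite s2 k2 addr_gt0 // mulr_gt0.
exists (s *:r e + k *:r f); split.
- by rewrite -ripxx_gt0 uu.
- by move=> z zzs; rewrite !ripE ze // zf // !mulr0 addr0.
- by rewrite uu Au ltr_pM2r.
- by rewrite uu Au ltr_pM2r.
Qed.

Lemma list_max (s : seq H) (v : H -> R) a : (forall y, y \in s -> v y < a) ->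
  exists2 t, t < a & forall y, y \in s -> v y <= t.
Proof.
elim: s => [_|x s ih h]; first by exists (a - 1) => //; lra.
have [|t ta ht] := ih; first by move=> y ys; apply: h; rewrite inE ys orbT.
exists (Num.max t (v x)); first by rewrite gt_max ta h ?mem_head.
by move=> y; rewrite inE le_max => /orP[/eqP -> |/ht ->//]; rewrite lexx orbT.
Qed.

(** Here a is the supremum of the values reached in every finite codimension, so the upper bounds
    hold by maximality. If the lower bound failed, [essential_step] would build orthogonal vectors
    with strictly increasing values below a, against [attains_sup_no_increasing]. *)
Lemma attains_sup_essential A : infinite_dimensional H -> bounded_lin A -> symm A ->
  attains_sup A -> exists a, essential_form A a.
Proof.
move=> hdim bA sA hA; have [lA [C C0 hC]] := bA.
have Ab u : `|'[A u, u]| <= C * '[u, u].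
  apply: le_trans (cauchy_schwarz _ _) _; rewrite ripxx expr2 mulrA.
  by rewrite ler_wpM2r.
pose S := [set c | forall zs, exists u, [/\ u != 0, perp zs u & c * '[u, u] <= '[A u,
  u]]].
have hS : has_sup S.
  split.
    exists (- C) => zs; have [u u0 zu] := infdim zs hdim.
    by exists u; split=> //; rewrite mulNr lerNl; apply: le_trans (Ab u);
      rewrite -normrN ler_norm.
  exists C => c /(_ [::]) [u [u0 _ cu]].
  rewrite -(@ler_pM2r _ '[u, u]) ?ripxx_gt0 //; apply: le_trans cu _.
  by apply: le_trans (Ab u); rewrite ler_norm.
have hlt c : c < sup S -> forall zs, exists u, [/\ u != 0, perp zs u & c * '[u,
  u] <= '[A u, u]].
  move=> cS zs; have [|c' Sc' cc'] := sup_adherent (_ : 0 < sup S - c) hS;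
    first by rewrite subr_gt0.
  have [u [u0 zu cu]] := Sc' zs; exists u; split=> //; apply: le_trans cu.
  by rewrite ler_pM2r ?ripxx_gt0 //; apply: ltW; apply: le_lt_trans cc'; lra.
exists (sup S); split.
  move=> c Sc; apply: contrapT => hn.
  have : S c.
    move=> zs; apply: contrapT => hn2; apply: hn; exists zs => u zu.
    have [->|u0] := eqVneq u 0; first by rewrite lin0 // rip0l mulr0.
    rewrite leNgt; apply/negP => cu; apply: hn2; exists u; split=> //; exact: ltW.
  by move=> /(sup_upper_bound hS) /(lt_le_trans Sc); rewrite ltxx.
apply: contrapT => hn.
have hN zs : exists u, perp zs u /\ '[A u, u] < sup S * '[u, u].
  apply: contrapT => hn2; apply: hn; exists zs => u zu.
  by rewrite leNgt; apply/negP => cu; apply: hn2; exists u.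
pose v u := '[A u, u] / '[u, u].
(* The guard makes [Q] satisfiable for every list, as [choice_with_history] requires; [vS] shows
   that it holds along the chosen sequence. *)
pose Q (s : seq H) u := (forall y, y \in s -> v y < sup S) ->
  [/\ u != 0, v u < sup S, perp (graph_list A s) u & forall y, y \in s -> v y < v u].
have [s|u hu] := @choice_with_history H Q.
  have [hs|hs] := pselect (forall y, y \in s -> v y < sup S); last by exists 0.
  have [t tS ht] := list_max hs.
  have [u [u0 zu tu uS]] := essential_step (graph_list A s) bA sA hlt hN tS.
  have uu : 0 < '[u, u] by rewrite ripxx_gt0.
  exists u => _; split=> //; first by rewrite ltr_pdivrMr.
  by move=> y /ht /le_lt_trans; apply; rewrite ltr_pdivlMr.
have vS n : forall m, (m < n)%N -> v (u m) < sup S.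
  elim: n => // n ih m; rewrite ltnS leq_eqVlt => /orP[/eqP ->|/ih //].
  by have [] := hu n; first by move=> y /mem_history [i /ih ? ->].
have hun n : [/\ u n != 0, v (u n) < sup S,
  perp (graph_list A [seq u i | i <- iota 0 n]) (u n) &
    forall m, (m < n)%N -> v (u m) < v (u n)].
  have [|h1 h2 h3 h4] := hu n.
    by move=> y /mem_history [i /(vS n) ? ->].
  by split=> // m mn; apply: h4; rewrite map_f // mem_iota.
have hv n : '[A (u n), u n] = v (u n) * '[u n, u n].
  by rewrite /v mulfVK // ripxx_eq0; case: (hun n).
have lt_orth m n (c : R[i]) : (m < n)%N ->
  '[u n, c *: u m] = 0 /\ '[u n, c *: A (u m)] = 0.
  by move=> mn; have [_ _ hp _] := hun n; apply: graph_listP hp _;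
    rewrite map_f // mem_iota.
apply: (@attains_sup_no_increasing A u (v \o u)) => //=.
- by move=> n; case: (hun n).
- by move=> n; have [_ _ _ h] := hun n.+1; apply: h.
- suff hr n m (c : R[i]) : m != n -> '[u n, c *: u m] = 0 /\ '[A (u n), c *: u m] = 0.
    move=> n m c; rewrite ripBl ripZl; have [->|mn] := eqVneq m n; last first.
      by have [-> ->] := hr n m c mn; rewrite mulr0 subrr.
    rewrite scale_split !ripDr !ripZr hv.
    have -> : '[u n, 'i%C *: u n] = 0 by rewrite ripC ripix.
    have -> : '[A (u n), 'i%C *: u n] = 0.
      exact: symm_i.
    by ring.
  case: ltngtP => // [mn|nm] _.
    have [h1 h2] := lt_orth _ _ c mn; split=> //.
    by rewrite sA linZ.
  have h0 := lt_orth _ _ _ nm.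
  have flip y z : (forall d : R[i], '[z, d *: y] = 0) -> '[y, c *: z] = 0.
    move=> h; have : ip z y = 0 by rewrite ip_rip h; have := h 1; rewrite scale1r => ->.
    by move=> zy; rewrite /rip ipZr ipC zy conjc0 mulr0.
  by split; apply: flip => d; have [] := h0 d.
Qed.

(** Bolzano-Weierstrass for one coordinate at a time, each time passing to a further subsequence. *)
Lemma bounded_subseq (zs : seq H) (y : nat -> H) : (forall n, '[y n, y n] = 1) ->
  exists2 s : nat -> nat, (forall n, (n <= s n)%N) &
    forall e : R, 0 < e -> exists N, forall m n, (N <= m)%N -> (N <= n)%N ->
      \sum_(z <- zs) ('[y (s m), z] - '[y (s n), z]) ^+ 2 < e.
Proof.
move=> y1; elim: zs => [|z zs [s hs ih]].
  by exists id => // e e0; exists 0%N => m n _ _; rewrite big_nil.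
have [|f finc /cvg_ex [l hl]] := @bolzano_weierstrass R (fun n => '[y (s n), z]).
  exists (rnorm z); split; first exact: num_real.
  move=> K zK n _ /=; apply: le_trans (ltW zK); apply: le_trans (cauchy_schwarz _ _) _.
  suff -> : rnorm (y (s n)) = 1 by rewrite mul1r.
  by apply/eqP; rewrite -(@eqrXn2 _ 2) // -ripxx y1 expr1n.
have fn n : (n <= f n)%N.
  elim: n => // n ihn; apply: leq_ltn_trans ihn _.
  by have := finc n.+1 n; rewrite !leEnat ltnn leqNgt => /negbFE.
exists (s \o f) => [n|e e0]; first exact: leq_trans (fn n) (hs _).
have e20 : 0 < e / 2 by rewrite divr_gt0.
have [N1 h1] := ih _ e20.
pose d := Num.sqrt (e / 2) / 2.
have d0 : 0 < d by rewrite divr_gt0 // sqrtr_gt0.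
have /cvgrPdist_lt /(_ d d0) [N2 _ h2] := hl.
exists (maxn N1 N2) => m n; rewrite !geq_max => /andP[m1 m2] /andP[n1 n2].
rewrite big_cons.
have := h1 _ _ (leq_trans m1 (fn m)) (leq_trans n1 (fn n)).
have hmm := h2 _ m2; have hnn := h2 _ n2; rewrite /= in hmm hnn.
have : ('[y (s (f m)), z] - '[y (s (f n)), z]) ^+ 2 <= e / 2.
  rewrite -[e / 2]sqr_sqrtr ?(ltW e20) // -real_normK ?num_real // ler_pXn2r ?nnegrE
    ?sqrtr_ge0 //.
  have -> : Num.sqrt (e / 2) = d + d by rewrite /d; lra.
  apply: le_trans (ler_distD l _ _) _; apply: lerD; apply: ltW => //.
  by rewrite distrC.
move=> /= ha hb; lra.
Qed.

Definition gap_form A b y := b * '[y, y] - '[A y, y].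

Lemma gap_form_parallelogram A b x y : linear A ->
  gap_form A b (x - y) + gap_form A b (x + y) = 2 * gap_form A b x + 2 * gap_form A b y.
Proof.
move=> lA; rewrite /gap_form (linD x y lA) (linB x y lA) !ripE; ring.
Qed.

(* By the parallelogram identity for the gap form, a maximizing sequence is
   Cauchy as soon as its finitely many coordinates along zs are. *)
Lemma coercive_attains A M zs b K d : bounded_lin A -> symm A -> closed_subspace M ->
  (forall y, M y -> 0 <= gap_form A b y) ->
  (forall e, 0 < e -> exists y, [/\ M y, '[y, y] = 1 & gap_form A b y < e]) ->
  0 < d -> 0 <= K ->
  (forall y, M y -> d * '[y, y] <= gap_form A b y + K * \sum_(z <- zs) '[y, z] ^+ 2) ->
  exists x, [/\ M x, '[x, x] = 1 & gap_form A b x <= 0].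
Proof.
move=> bA sA cM q0 hinf d0 K0 hco; have [lA [C C0 hC]] := bA.
have [clM sM] : closed M /\ subsp M by apply/csubspP.
have /choice [y hy] n : exists y, [/\ M y, '[y, y] = 1 & gap_form A b y < n.+1%:R^-1].
  by apply: hinf; rewrite invr_gt0.
have [|s hs hcau] := @bounded_subseq zs y; first by move=> n; case: (hy n).
have K1 : 0 < K + 1 by rewrite ltr_wpDl.
have [|x xl] := @completeH (y \o s).
  (* The bound d e^2 is split in halves: four gaps of at most d e^2 / 8 from the parallelogram
     identity, and K times the coordinate sum. *)
  move=> e e0; have e1 : 0 < d * e ^+ 2 / 8 by rewrite divr_gt0 // mulr_gt0 //
    exprn_gt0.
  have e2 : 0 < d * e ^+ 2 / (2 * (K + 1)).
    by rewrite divr_gt0 // mulr_gt0 // exprn_gt0.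
  have [N1 h1] := inv_small e1; have [N2 h2] := hcau _ e2.
  have small n : (N1 <= n)%N -> gap_form A b (y (s n)) < d * e ^+ 2 / 8.
    move=> Nn; have [_ _ /lt_trans] := hy (s n); apply.
    by apply: h1; apply: leq_trans Nn (hs n).
  exists (maxn N1 N2) => m n; rewrite !geq_max => /andP[m1 m2] /andP[n1 n2] /=.
  rewrite -(@ltr_pXn2r _ 2) ?nnegrE ?(ltW e0) // -ripxx -(ltr_pM2l d0).
  have [Mm _ _] := hy (s m); have [Mn _ _] := hy (s n).
  apply: le_lt_trans (hco _ (subspB sM Mm Mn)) _.
  have := gap_form_parallelogram b (y (s m)) (y (s n)) lA;
    have := q0 _ (subspD sM Mm Mn).
  have := small _ m1; have := small _ n1.
  have := h2 _ _ m2 n2; rewrite ltr_pdivlMr ?mulr_gt0 //.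
  under [in X in _ -> _ -> _ -> _ -> _ -> X]eq_bigr do rewrite ripBl.
  set S := \sum_(_ <- _) _; have S0 : 0 <= S by apply: sumr_ge0 => z _; exact: sqr_ge0.
  lra.
have Mx : M x by apply: closed_tends clM _ xl => n; have [] := hy (s n).
have xlim (u : H) B : bounded_lin B -> forall e : R, 0 < e ->
  exists N, forall n, (N <= n)%N -> rnorm (B (y (s n)) - B x) < e.
  by move=> bB; exact: (bounded_lin_tends bB xl).
have nx : rnorm x = 1.
  have ny n : rnorm (y (s n)) = 1.
    by apply/eqP; rewrite -(@eqrXn2 _ 2) // -ripxx expr1n; case: (hy (s n)) => _ ->.
  apply/eqP; rewrite eq_le; apply/andP; split;
    apply: le_eps => e /xl [N /(_ _ (leqnn _)) /ltW /= h].
    have := rnorm_tri x (y (s N)) 0; rewrite !subr0 ny rnormB => /le_trans; apply; lra.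
  by rewrite -(ny N); have := rnorm_tri (y (s N)) x 0; rewrite !subr0 => /le_trans;
    apply; lra.
have xx : '[x, x] = 1 by rewrite ripxx nx expr1n.
exists x; split=> //; apply: le_eps => e e0; rewrite add0r.
have C1 : 0 < 4 * (C + 1) by rewrite mulr_gt0 // ltr_wpDl.
have ec : 0 < e / (4 * (C + 1)) by rewrite divr_gt0.
have e2 : 0 < e / 2 by rewrite divr_gt0.
have [N1 h1] := xl _ ec; have [N2 h2] := inv_small e2.
pose n := maxn N1 N2; have {}h1 := h1 n (leq_maxl _ _);
  have {}h2 := h2 n (leq_maxr _ _).
have [_ yy qy] := hy (s n).
have {}qy : gap_form A b (y (s n)) < e / 2.
  by apply: lt_trans qy _; apply: le_lt_trans h2;
    rewrite lef_pV2 ?posrE // ler_nat ltnS.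
rewrite /gap_form yy in qy; rewrite /gap_form xx; rewrite /= in h1.
set v := y (s n) in yy qy h1.
have nv : rnorm v = 1 by apply/eqP; rewrite -(@eqrXn2 _ 2) // -ripxx expr1n yy.
have E : '[A v, v] - '[A x, x] = '[A (v - x), v] + '[A x, v - x].
  by rewrite (linB _ _ lA) !ripE; ring.
have b1 : '[A (v - x), v] <= C * rnorm (v - x).
  by apply: le_trans (rip_le _ _) _; rewrite nv mulr1.
have b2 : '[A x, v - x] <= C * rnorm (v - x).
  by apply: le_trans (rip_le _ _) _; rewrite ler_wpM2r //; have := hC x;
    rewrite nx mulr1.
have : C * rnorm (v - x) <= e / 4.
  apply: (@le_trans _ _ ((C + 1) * (e / (4 * (C + 1))))).
    by rewrite ler_pM // ?lerDl // ltW.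
  by rewrite le_eqVlt; apply/orP; left; apply/eqP; field; rewrite gt_eqF // ltr_wpDl.
lra.
Qed.

(** Let b be the supremum on M. If b > a, the form stays below (a + b) / 2 in finite codimension, so
    the gap is coercive up to finitely many coordinates. If b <= a, either M contains a vector where
    the form is at least a, which attains b, or M is finite-dimensional. *)
Lemma essential_attains_sup A a : bounded_lin A -> symm A -> essential_form A a ->
  attains_sup A.
Proof.
move=> bA sA [ha [zm hm]] M cM [x0 Mx0 x00]; have [lA [C C0 hC]] := bA.
have [clM sM] : closed M /\ subsp M by apply/csubspP.
have Ab u : '[A u, u] <= C * '[u, u].
  apply: le_trans (rip_le _ _) _; rewrite ripxx expr2 mulrA.
  by rewrite ler_wpM2r.
have Mn y : M y -> M ((rnorm y)^-1 *:r y) by exact: subspZ.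
pose S := [set s | exists2 y, M y & '[y, y] = 1 /\ s = '[A y, y]].
have hS : has_sup S.
  split; first by exists '[A ((rnorm x0)^-1 *:r x0), (rnorm x0)^-1 *:r x0],
    ((rnorm x0)^-1 *:r x0); rewrite ?rip_normalize //; exact: Mn.
  by exists C => _ [y My [yy ->]]; apply: le_trans (Ab y) _; rewrite yy mulr1.
set b := sup S.
have q0 y : M y -> 0 <= gap_form A b y.
  move=> My; have [->|y0] := eqVneq y 0;
    first by rewrite /gap_form rip0r (lin0 lA) rip0l mulr0 subrr.
  have : S '[A ((rnorm y)^-1 *:r y), (rnorm y)^-1 *:r y].
    by exists ((rnorm y)^-1 *:r y); [exact: Mn | rewrite rip_normalize].
  move/(sup_upper_bound hS); rewrite -/b (linZ _ _ lA) !ripE mulrA -expr2.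
  rewrite mulrC exprVn ler_pdivrMr -ripxx ?ripxx_gt0 //.
  by rewrite /gap_form subr_ge0.
suff [x [Mx xx qx]] : exists x, [/\ M x, '[x, x] = 1 & gap_form A b x <= 0].
  exists x; split=> // y My; have := q0 y My;
    rewrite /gap_form subr_ge0 => /le_trans; apply.
  by rewrite ler_wpM2r ?ripxx_ge0 //; move: qx; rewrite /gap_form xx mulr1 subr_le0.
have hinf e : 0 < e -> exists y, [/\ M y, '[y, y] = 1 & gap_form A b y < e].
  move=> /sup_adherent /(_ hS) [_ [y My [yy ->]] h].
  by exists y; split=> //; rewrite /gap_form yy mulr1; move: h; rewrite -/b; lra.
have [ab|ba] := ltP a b.
  have [|zs hzs] := ha ((a + b) / 2); first by lra.
  have [es oes hes] := gram_schmidt zs.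
  pose d := (b - a) / 2; have d0 : 0 < d by rewrite /d; lra.
  (* With U and P the norms of the parts orthogonal to and along es, the cross term 2 C U P is
     absorbed by d / 2 U^2 at the cost 2 C^2 / d P^2. The other summands pay for the P^2 terms of
     the left side, of b and of A. *)
  pose K := d / 2 + `|b| + C + 2 * C ^+ 2 / d.
  apply: (@coercive_attains A M es b K (d / 2)) => //.
  - by rewrite divr_gt0.
  - have dge : 0 <= d by exact: ltW.
    rewrite /K; apply: addr_ge0; last by rewrite divr_ge0 // mulr_ge0 // exprn_ge0.
    by apply: addr_ge0 => //; apply: addr_ge0 => //; exact: divr_ge0.
  move=> y My; rewrite -proj_list_norm //.
  have [u [p [uE pu pE]]] : exists u p, [/\ y = u + p, perp es u & p = proj_list es y].
    by exists (y - proj_list es y), (proj_list es y); rewrite subrK; split=> //;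
      exact: proj_list_perp.
  have up : '[u, p] = 0 by rewrite pE; exact: perp_proj_list.
  have hu := hzs _ (hes _ pu).
  rewrite /gap_form -pE uE (linD _ _ lA) !ripE (ripC p u) up.
  have Aup : '[A u, p] + '[A p, u] <= 2 * (C * rnorm u * rnorm p).
    rewrite (sA p u) (ripC p) mulr_natl mulr2n lerD //;
    by apply: le_trans (rip_le _ _) _; rewrite ler_wpM2r.
  have hp := Ab p.
  rewrite /K; have := rnorm_ge0 u; have := rnorm_ge0 p.
  move: hu hp Aup; rewrite !ripxx.
  move: (rnorm u) (rnorm p) ('[A u, u]) ('[A u, p]) ('[A p, u]) ('[A p,
    p]) => U P x1 x2 x3 x4.
  move=> h1 h2 h3 P0 U0.
  have amgm : 2 * (C * U * P) <= d / 2 * U ^+ 2 + 2 * C ^+ 2 / d * P ^+ 2.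
    have -> : 2 * (C * U * P) = d / 2 * U ^+ 2 + 2 * C ^+ 2 / d * P ^+ 2 - (d * U - 2
      * C * P) ^+ 2 / (2 * d).
      by field; rewrite gt_eqF.
    by rewrite gerBl divr_ge0 ?sqr_ge0 // mulr_ge0 // ltW.
  have hb : - b * P ^+ 2 <= `|b| * P ^+ 2.
    by rewrite ler_wpM2r ?sqr_ge0 // -normrN ler_norm.
  have hba : b = (a + b) / 2 + d by rewrite /d; lra.
  have hbU : b * U ^+ 2 = (a + b) / 2 * U ^+ 2 + d * U ^+ 2 by rewrite -mulrDl -hba.
  lra.
(* Case b <= a: a vector of M orthogonal to [es] has value at least a, hence attains b; without such
   a vector, [es] bounds the dimension of M. *)
have [es oes hes] := gram_schmidt zm.
have [[y My [y0 py]]|hn] := pselect (exists2 y, M y & y != 0 /\ perp es y).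
  exists ((rnorm y)^-1 *:r y); split; [exact: Mn | exact: rip_normalize |].
  rewrite /gap_form rip_normalize // mulr1 (linZ _ _ lA) !ripE mulrA -expr2 exprVn
    -ripxx subr_le0.
  rewrite mulrC ler_pdivlMr ?ripxx_gt0 //.
  by apply: le_trans (hm _ (hes _ py)); rewrite ler_wpM2r ?ripxx_ge0.
have [||fs [ofs Mfs hfs]] := @finite_basis M es.
- exact: subsp_rsubsp.
- by move=> x Mx px; apply/eqP; apply: contraT => xn0; case: hn; exists x.
apply: (@coercive_attains A M fs b 1 1) => // y My.
by rewrite -proj_list_norm // -hfs // !mul1r lerDr q0.
Qed.

(** * Eigenspaces, square roots and conjugation *)

Lemma bounded_lin_sub A B : bounded_lin A -> bounded_lin B ->
  bounded_lin (fun x => A x - B x).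
Proof.
move=> [lA [C C0 hC]] [lB [D D0 hD]]; split.
  by move=> k x y; rewrite lA lB scalerBr opprD !addrA; congr (_ - _); rewrite addrAC.
exists (C + D) => [|x]; first exact: addr_ge0.
by apply: le_trans (rnormD _ _) _; rewrite rnormN mulrDl lerD.
Qed.

Lemma bounded_lin_scale (c : R[i]) A : bounded_lin A -> bounded_lin (fun x => c *: A x).
Proof.
move=> [lA [C C0 hC]]; split.
  by move=> k x y; rewrite lA scalerDr !scalerA mulrC.
have cp : 0 <= complex.Re `|c|.
  by have := normr_ge0 c; case: `|c| => p q; rewrite lecE => /andP[].
exists (complex.Re `|c| * C) => [|x]; first exact: mulr_ge0.
by rewrite rnormZ -mulrA ler_wpM2l.
Qed.

Lemma csub_preim W M : bounded_lin W -> closed_subspace M ->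
  closed_subspace [set x | M (W x)].
Proof.
move=> bW /csubspP [cM [M0 sM]]; have [lW [C C0 hC]] := bW; split.
- apply/closedHP => x h; move/closedHP: cM; apply => e e0.
  have C1 : 0 < C + 1 by rewrite ltr_wpDl.
  have [|y My xy] := h (e / (C + 1)); first exact: divr_gt0.
  exists (W y) => //; rewrite -(linB _ _ lW); apply: le_lt_trans (hC _) _.
  move: xy; rewrite ltr_pdivlMr //; apply: le_lt_trans.
  by rewrite mulrC ler_wpM2l // lerDl.
- by rewrite /= (lin0 lW).
- by move=> c x y /= Mx My; rewrite lW; apply: sM.
Qed.

Lemma csub0 : closed_subspace [set x : H | x = 0].
Proof.
split=> //; last by move=> c x y /= -> ->; rewrite scaler0 addr0.
apply/closedHP => x h; apply/eqP; rewrite -rnorm_eq0 eq_le rnorm_ge0 andbT.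
by apply: le_eps => e /h [_ -> /ltW]; rewrite subr0 add0r.
Qed.

Lemma csubI M N : closed_subspace M -> closed_subspace N -> closed_subspace (M `&` N).
Proof.
move=> [cM M0 sM] [cN N0 sN]; split=> //; first exact: closedI.
by move=> c x y [Mx Nx] [My Ny]; split; [apply: sM | apply: sN].
Qed.

Lemma csub_eig A b : bounded_lin A -> closed_subspace [set x | A x = b *:r x].
Proof.
move=> bA; have := csub_preim (bounded_lin_sub bA (bounded_lin_scale b%:C
  bounded_lin_id)) csub0.
congr closed_subspace; apply/seteqP; split=> x /=; first by move/eqP;
  rewrite subr_eq0 => /eqP.
by move=> ->; rewrite subrr.
Qed.

(** For k = sqrt m > 0 the vector B x - k x is an eigenvector for - k, which positivity excludes
    unless it is zero. For m <= 0 the square root is 0 and '[B x, B x] = m '[x, x] forces B x =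
    0. *)
Lemma pos_sqrt B x m : linear B -> symm B -> (forall x, 0 <= '[B x, x]) ->
  B (B x) = m *:r x -> B x = Num.sqrt m *:r x.
Proof.
move=> lB sB pB BB; have [m0|m0] := leP m 0.
  rewrite ler0_sqrtr // scale0r; apply/eqP; rewrite -ripxx_eq0 eq_le ripxx_ge0 andbT.
  by rewrite -sB BB ripZl mulr_le0_ge0 // ripxx_ge0.
set k := Num.sqrt m; have k0 : 0 < k by rewrite sqrtr_gt0.
have kk : m = k * k by rewrite -expr2 sqr_sqrtr // ltW.
apply/eqP; rewrite -subr_eq0 -ripxx_eq0 eq_le ripxx_ge0 andbT.
have By : B (B x - k *:r x) = (- k) *:r (B x - k *:r x).
  rewrite (linB _ _ lB) (linZ _ _ lB) BB kk scalerBr !scalerA -!rmorphM /=.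
  by rewrite mulNr [(- (k * k))%:C]rmorphN !scaleNr rmorphN scaleNr opprK addrC.
by have := pB (B x - k *:r x); rewrite By ripZl mulNr oppr_ge0 pmulr_rle0.
Qed.

Lemma attains_sup_conj A W W' : bounded_lin W -> bounded_lin W' ->
  (forall x, W (W' x) = x) ->
  (forall x, W' (W x) = x) -> (forall x y, '[W x, y] = '[x, W' y]) ->
  attains_sup A -> attains_sup (W' \o A \o W).
Proof.
move=> bW bW' WW' W'W adj hA M cM [x0 Mx0 x00].
have adj' x y : '[W' x, y] = '[x, W y] by rewrite ripC -adj ripC.
have [||y [My yy hy]] := hA [set y | M (W' y)]; first exact: csub_preim.
  exists (W x0); first by rewrite /= W'W.
  by apply: contra_neq x00 => W0; rewrite -[x0]W'W W0 lin0 //; case: bW'.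
exists (W' y); split=> //; first by rewrite adj' WW'.
move=> z Mz; have := hy (W z); rewrite /= W'W => /(_ Mz).
have -> : '[W z, W z] = '[z, z] by rewrite adj W'W.
by rewrite !adj' !WW'.
Qed.

(** * Adjoints and positive operators *)

Lemma adj_unique T S : adjoint_of ip T S -> adj ip T = S.
Proof.
move=> hS; apply: xget_unique => // S' [_ hS']; have [_ {}hS] := hS.
apply/funext => y; apply/eqP; rewrite -subr_eq0; apply/eqP/rip_eq0 => x.
by rewrite ripC ripBr /rip -hS -hS' subrr.
Qed.

Lemma adjointP T S : bounded_lin S -> linear T ->
  (forall x y, '[T x, y] = '[x, S y]) -> adjoint_of ip T S.
Proof.
move=> bS lT h; split; first exact/bounded_linP.
by move=> x y; apply: ip_ext => c; rewrite h (linZ _ _ bS.1).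
Qed.

(** Symmetry comes from complex polarization: the form is real, so its imaginary part vanishes at u
    + v, and every y is i times another vector. *)
Lemma positive_facts A : positive_op ip A ->
  [/\ bounded_lin A, symm A & forall x, 0 <= '[A x, x]].
Proof.
move=> [/bounded_linP bA pA]; have [lA _] := bA; split=> // [x y|x]; last first.
  by have := pA x; rewrite ip_rip lecE /= => /andP[].
have im x' : '[A x', 'i%C *: x'] = 0.
  by have := pA x'; rewrite ip_rip lecE /= => /andP[/eqP].
have pol u v : '[A (('i%C : R[i]) *: v), u] = '[A u, 'i%C *: v].
  have := im (u + v); rewrite (linD _ _ lA) scalerDr !ripE !im add0r addr0 => h.
  have : '[A v, 'i%C *: u] = - '[A ('i%C *: v), u].
    by rewrite (linZ _ _ lA) ripiNl opprK.
  lra.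
have yE : y = 'i%C *: (- 'i%C *: y) :> H.
  by rewrite scalerA mulrN -expr2 sqr_i opprK scale1r.
by rewrite yE -pol -yE ripC.
Qed.

Lemma symm_positive A : bounded_lin A -> symm A -> (forall x, 0 <= '[A x, x]) ->
  positive_op ip A.
Proof.
move=> bA sA pA; split; first exact/bounded_linP.
by move=> x; rewrite ip_rip (symm_i _ bA.1 sA) lecE /= eqxx pA.
Qed.

(** * Right limits, tagged partitions and Stieltjes sums *)

Lemma cvg_right_rnorm (E : R -> H) a l : E t @[t --> a^'+] --> l <->
  forall e : R, 0 < e -> exists2 d : R, 0 < d & forall t, a < t -> t < a + d ->
    rnorm (l - E t) < e.
Proof.
split.
  move=> /cvgrPdist_lt h e e0.
  have /h : 0 < e%:C by rewrite -[0]/(0%:C) ltcR.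
  rewrite near_withinE => /nbhs_ballP [d /= d0 hd]; exists d => // t at_ td.
  have := hd t; rewrite normHE ltcR; apply => //.
  by rewrite /ball /= ltr_distlC; apply/andP; split; lra.
move=> h; apply/cvgrPdist_lt => e /gt0_complexE [-> /h [d d0 hd]].
rewrite near_withinE; apply/nbhs_ballP; exists d => //= t.
rewrite /ball /= ltr_distlC => /andP[_ td] at_.
by rewrite normHE ltcR; exact: hd.
Qed.

(** Cells are open on the left and closed on the right to match increments of a right-continuous
    spectral family. The index comes from the least k with v <= x k, and empty cells do no harm. *)
Lemma partition_index a b d n (x xi : nat -> R) (v : R) : tagged_partition a b d n x
  xi ->
  a < v <= b -> exists i : 'I_n, [/\ x i < v <= x i.+1, `|xi i - v| <= d,
    a <= xi i <= b &
    forall j : 'I_n, j != i -> ~~ (x j < v <= x j.+1)].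
Proof.
move=> [x0 xn hx] /andP[av vb].
have mono i j : (i <= j)%N -> (j <= n)%N -> x i <= x j.
  elim: j => [|j ih]; first by rewrite leqn0 => /eqP ->.
  rewrite leq_eqVlt => /orP[/eqP -> //|ij jn].
  have [h1 h2 _] := hx j jn; apply: le_trans (le_trans h1 h2); apply: ih => //;
    exact: ltnW.
have [i [iN hi]] : exists i : nat, (i < n)%N /\ x i < v <= x i.+1.
  have : exists k, (k <= n)%N && (v <= x k) by exists n; rewrite leqnn xn.
  move=> /[dup] hex _; case: (ex_minnP hex) => [[|k]].
    by rewrite x0 leNgt av.
  move=> /andP[kn vk] mink; exists k; split=> //; rewrite vk andbT ltNge.
  by apply/negP => vk'; have := mink k; rewrite (ltnW kn) vk' ltnn => /(_ isT).
have /andP[xv vx] := hi; have [h1 h2 h3] := hx i iN.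
exists (Ordinal iN); split=> //=.
- by rewrite ler_norml; apply/andP; split; lra.
- apply/andP; split; first by apply: le_trans h1; rewrite -x0; apply: mono => //;
  exact: ltnW.
  by apply: le_trans h2 _; rewrite -xn; apply: mono.
- move=> j; rewrite -val_eqE /= neq_ltn => /orP[ji|ij].
    by rewrite negb_and; apply/orP; right; rewrite -ltNge; apply: le_lt_trans xv;
      apply: mono ji (ltnW iN).
  rewrite negb_and; apply/orP; left; rewrite -leNgt; apply: le_trans vx _.
  by apply: mono ij (ltnW (ltn_ord j)).
Qed.

Lemma partition_ex (a b d : R) : a <= b -> 0 < d ->
  exists n (x : nat -> R), tagged_partition a b d n x x.
Proof.
move=> ab d0; pose n := (Num.bound ((b - a) / d)).+1.
have n0 : (n%:R : R) != 0 by rewrite pnatr_eq0.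
exists n, (fun i => a + i%:R * ((b - a) / n%:R)); split.
- by rewrite mul0r addr0.
- by rewrite mulrC mulfVK // addrC subrK.
- move=> i iN; have st : 0 <= (b - a) / n%:R by rewrite divr_ge0 // subr_ge0.
  split=> //; first by rewrite lerD2l ler_wpM2r // ler_nat.
  have -> : a + i.+1%:R * ((b - a) / n%:R) - (a + i%:R * ((b - a) / n%:R)) = (b - a)
    / n%:R.
    by rewrite -natr1; ring.
  rewrite ltr_pdivrMr ?ltr0n // mulrC -ltr_pdivrMr //.
  apply: lt_le_trans (archi_boundP _) _; first by rewrite divr_ge0 ?subr_ge0 // ltW.
  by rewrite ler_nat.
Qed.

(** Only cells that start before c carry mass, and their tags are at most c + d. *)
Lemma stieltjes_le a b d n (x xi : nat -> R) (W : R -> R) c : tagged_partition a b d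
  n x xi ->
  (forall t t', t <= t' -> W t <= W t') -> (forall t t', c <= t -> c <= t' ->
    W t = W t') ->
  \sum_(i < n) xi i * (W (x i.+1) - W (x i)) <= (c + d) * (W b - W a).
Proof.
move=> hp Wm Wc; have [x0 xn hx] := hp.
have -> : W b - W a = \sum_(i < n) (W (x i.+1) - W (x i)).
  by rewrite -x0 -xn -(telescope_sumr (fun i => W (x i))) // big_mkord.
rewrite mulr_sumr; apply: ler_sum => i _; have [h1 h2 h3] := hx i (ltn_ord i).
have [ci|ic] := leP c (x i); last first.
  by rewrite ler_wpM2r ?subr_ge0 ?Wm //; lra.
by rewrite (Wc (x i.+1) (x i)) //; [rewrite subrr !mulr0 | lra].
Qed.

Lemma stieltjes_ge a b d n (x xi : nat -> R) (W : R -> R) c : tagged_partition a b d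
  n x xi ->
  (forall t t', t <= t' -> W t <= W t') -> (forall t t', t <= c -> t' <= c ->
    W t = W t') ->
  (c - d) * (W b - W a) <= \sum_(i < n) xi i * (W (x i.+1) - W (x i)).
Proof.
move=> hp Wm Wc; have [x0 xn hx] := hp.
have -> : W b - W a = \sum_(i < n) (W (x i.+1) - W (x i)).
  by rewrite -x0 -xn -(telescope_sumr (fun i => W (x i))) // big_mkord.
rewrite mulr_sumr; apply: ler_sum => i _; have [h1 h2 h3] := hx i (ltn_ord i).
have [ci|ic] := leP (x i.+1) c; last first.
  by rewrite ler_wpM2r ?subr_ge0 ?Wm //; lra.
by rewrite (Wc (x i.+1) (x i)) //; [rewrite subrr !mulr0 | lra].
Qed.

Lemma increment_bounded_lin (E : R -> H -> H) (x : nat -> R) i : (forall c,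
  bounded_lin (E c)) -> bounded_lin (increment E x i).
Proof. by move=> bE; exact: bounded_lin_sub. Qed.

Lemma bounded_lin_sum (I : Type) (r : seq I) (A : I -> H -> H) : (forall i,
  bounded_lin (A i)) ->
  bounded_lin (fun h => \sum_(i <- r) A i h).
Proof.
move=> bA; elim: r => [|i r [lr [C C0 hC]]].
  split; first by move=> k x y; rewrite !big_nil scaler0 addr0.
  by exists 0 => // x; rewrite big_nil rnorm0 mul0r.
have [lA [D D0 hD]] := bA i; split.
  by move=> k x y; rewrite !big_cons lr lA scalerDr !addrA; congr (_ + _);
    rewrite addrAC.
exists (D + C) => [|x]; first exact: addr_ge0.
by rewrite big_cons; apply: le_trans (rnormD _ _) _; rewrite mulrDl lerD.
Qed.

Lemma orthproj_facts A : orthogonal_projection ip A ->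
  [/\ bounded_lin A, symm A & forall x, A (A x) = A x].
Proof.
move=> [/bounded_linP bA AA sA]; split=> //; last by move=> x; rewrite -[in RHS]AA.
by move=> x y; rewrite /rip sA.
Qed.

Lemma proj_contr A x : symm A -> (forall x, A (A x) = A x) -> '[A x, A x] <= '[x, x].
Proof.
move=> sA AA; have := ripxx_ge0 (x - A x).
have AAx : '[A x, A x] = '[A x, x] by rewrite sA AA ripC.
by rewrite !ripE (ripC x) AAx; lra.
Qed.

(** * Joint eigenvectors of a centered operator *)

Section Centered.
Context (U V P : H -> H) (bU : bounded_lin U) (bV : bounded_lin V).
Context (UV : forall x, U (V x) = x) (VU : forall x, V (U x) = x).
Context (adjUV : forall x y, '[U x, y] = '[x, V y]).
Context (bP : bounded_lin P) (sP : symm P) (pP : forall x, 0 <= '[P x, x]).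

Definition conjugates : set (H -> H) := [set B | exists k,
  B = iter k V \o P \o iter k U \/ B = iter k U \o P \o iter k V].

Context (conjugatesC : forall B C x, conjugates B -> conjugates C -> B (C x) = C (B x)).
Context (s : R) (ss : s * s = 1) (hSA : attains_sup (fun x => s *:r P (P x))).
Context (hdim : infinite_dimensional H).

Lemma adjVU x y : '[V x, y] = '[x, U y].
Proof. by rewrite ripC -adjUV ripC. Qed.

Lemma ripUU x y : '[U x, U y] = '[x, y].
Proof. by rewrite adjUV VU. Qed.

Lemma ripVV x y : '[V x, V y] = '[x, y].
Proof. by rewrite adjVU UV. Qed.

Lemma conjugates_ind (Q : (H -> H) -> Prop) : Q P ->
  (forall B, conjugates B -> Q B -> Q (V \o B \o U)) ->
  (forall B, conjugates B -> Q B -> Q (U \o B \o V)) -> forall B, conjugates B -> Q B.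
Proof.
move=> Q0 QV QU B [k [->|->]].
  elim: k => // k ih.
  have -> : iter k.+1 V \o P \o iter k.+1 U = V \o (iter k V \o P \o iter k U) \o U.
    by apply/funext => x /=; rewrite -iterSr.
  by apply: QV => //; exists k; left.
elim: k => // k ih.
have -> : iter k.+1 U \o P \o iter k.+1 V = U \o (iter k U \o P \o iter k V) \o V.
  by apply/funext => x /=; rewrite -iterSr.
by apply: QU => //; exists k; right.
Qed.

Lemma conjugates_self : conjugates P.
Proof. by exists 0%N; left. Qed.

Lemma conjugates_VBU B : conjugates B -> conjugates (V \o B \o U).
Proof.
move=> [k [->|->]].
  by exists k.+1; left; apply/funext => x /=; rewrite -iterSr.
case: k => [|k]; first by exists 1%N; left.
by exists k; right; apply/funext => x /=; rewrite VU -iterS iterSr VU.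
Qed.

Lemma conjugates_UBV B : conjugates B -> conjugates (U \o B \o V).
Proof.
move=> [k [->|->]]; last first.
  by exists k.+1; right; apply/funext => x /=; rewrite -iterSr.
case: k => [|k]; first by exists 1%N; right.
by exists k; left; apply/funext => x /=; rewrite UV -iterS iterSr UV.
Qed.

Lemma conjugates_bounded_lin B : conjugates B -> bounded_lin B.
Proof.
move: B; apply: conjugates_ind => // B _ bB.
  exact: bounded_lin_comp (bounded_lin_comp bV bB) bU.
exact: bounded_lin_comp (bounded_lin_comp bU bB) bV.
Qed.

Lemma conjugates_lin B : conjugates B -> linear B.
Proof. by case/conjugates_bounded_lin. Qed.

Lemma conjugates_symm B : conjugates B -> symm B.
Proof.
move: B; apply: conjugates_ind => // B _ sB x y /=.
  by rewrite adjVU sB adjUV.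
by rewrite adjUV sB adjVU.
Qed.

Lemma conjugates_pos B : conjugates B -> forall x, 0 <= '[B x, x].
Proof.
move: B; apply: conjugates_ind => // B _ pB x /=; first by rewrite adjVU.
by rewrite adjUV.
Qed.

Definition signed_sq B x := s *:r B (B x).

Lemma conjugates_attains_sup B : conjugates B -> attains_sup (signed_sq B).
Proof.
move: B; apply: conjugates_ind => // B _ hB.
  have := attains_sup_conj bU bV UV VU adjUV hB; congr attains_sup.
  by apply/funext => x /=; rewrite /signed_sq /= UV (linZ _ _ bV.1).
have := attains_sup_conj bV bU VU UV adjVU hB; congr attains_sup.
by apply/funext => x /=; rewrite /signed_sq /= VU (linZ _ _ bU.1).
Qed.

Lemma signed_sq_bounded_lin B : conjugates B -> bounded_lin (signed_sq B).
Proof. by move=> /conjugates_bounded_lin bB; apply: bounded_lin_scale;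
  exact: (bounded_lin_comp bB bB). Qed.

Lemma signed_sq_symm B : conjugates B -> symm (signed_sq B).
Proof. by move=> fB x y; rewrite /signed_sq !ripE !(conjugates_symm fB). Qed.

(** As s is a sign, s b is the eigenvalue of B^2, and positivity of B selects its square root. *)
Lemma signed_sq_eig B b x : conjugates B -> signed_sq B x = b *:r x ->
  B x = Num.sqrt (s * b) *:r x.
Proof.
move=> fB h; apply: pos_sqrt (conjugates_lin fB) (conjugates_symm fB) (conjugates_pos
  fB) _.
have : s *:r signed_sq B x = s *:r (b *:r x) by rewrite h.
by rewrite /signed_sq !scalerA -!rmorphM /= ss scale1r.
Qed.

Definition joint_eig : set H := [set x | x != 0 /\ forall B, conjugates B ->
  exists c : R, B x = c *:r x].

Definition conjugates_inv M := forall B x, conjugates B -> M x -> M (B x).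

Lemma signed_sq_inv B M : subsp M -> conjugates_inv M -> conjugates B ->
  forall x, M x -> M (signed_sq B x).
Proof. by move=> sM iM fB x Mx; apply: subspZ => //; apply: (iM) => //; apply: iM. Qed.

Lemma signed_sq_comm B C x : conjugates B -> conjugates C ->
  signed_sq B (C x) = C (signed_sq B x).
Proof. by move=> fB fC; rewrite /signed_sq (linZ _ _ (conjugates_lin fC))
  !(conjugatesC _ fB fC). Qed.

(* Induction on the dimension bound: unless all conjugates are scalar on M, an
   eigenspace of one of them is a proper invariant subspace. *)
Lemma joint_eig_in_finite M zs : closed_subspace M -> nonzero_subspace M ->
  conjugates_inv M ->
  (forall x, M x -> perp zs x -> x = 0) -> exists2 x, M x & joint_eig x.
Proof.
elim: {zs}(size zs).+1 {-2}zs (ltnSn (size zs)) M => // n ih zs szs M cM nM iM h.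
have [_ sM] : closed M /\ subsp M by apply/csubspP.
have [hsc|] := pselect (forall B, conjugates B -> exists c : R, forall x, M x ->
  B x = c *:r x).
  have [x Mx x0] := nM; exists x => //; split=> // B /hsc [c hc].
  by exists c; apply: hc.
move/existsNP => [B /not_implyP [fB hB]].
have [x [b [Mx xx xb]]] := attains_sup_eigenvector (signed_sq_bounded_lin fB).1
  (signed_sq_symm fB) (conjugates_attains_sup fB) cM nM (signed_sq_inv sM iM fB).
have [y My yb] : exists2 y, M y & signed_sq B y != b *:r y.
  apply: contrapT => hn; apply: hB; exists (Num.sqrt (s * b)) => y My.
  apply: signed_sq_eig => //; apply/eqP; apply: contraT => yb; case: hn; by exists y.
have Mz : M (signed_sq B y - b *:r y) by apply: subspB => //;
  [exact: signed_sq_inv | exact: subspZ].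
have z0 : signed_sq B y - b *:r y != 0 by rewrite subr_eq0.
have [zs' szs' h'] := exchange (subsp_rsubsp sM) h Mz z0.
have [|||||w [Mw _] Jw] := ih zs' _ (M `&` [set x | signed_sq B x = b *:r x]).
- exact: leq_trans szs' _.
- by apply: csubI => //; apply: csub_eig; exact: signed_sq_bounded_lin.
- by exists x => //; rewrite -ripxx_eq0 xx oner_eq0.
- move=> C w fC [Mw /= hw]; split; first exact: iM.
  by rewrite /= signed_sq_comm // hw (linZ _ _ (conjugates_lin fC)).
- move=> w [Mw /= hw]; apply: h' => //.
  by rewrite ripBr -(signed_sq_symm fB) hw !ripE subrr.
- by exists w.
Qed.

(** On the orthogonal N of all joint eigenvectors some conjugate B is not scalar. Let a be its
    essential value; N is not contained in that eigenspace, so attainment on the complement gives an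
    eigenvalue b different from a. Its eigenspace is finite-dimensional, and [joint_eig_in_finite]
    finds a joint eigenvector inside N. *)
Lemma joint_eig_total x : orthc joint_eig x -> x = 0.
Proof.
move=> Nx; apply/eqP; apply: contraT => x0.
pose N := orthc joint_eig; have cN : closed_subspace N by exact: orthc_csub.
have [_ sN] : closed N /\ subsp N by apply/csubspP.
have iN : conjugates_inv N.
  move=> B y fB Ny c z Jz; rewrite (conjugates_symm fB) (linZ _ _ (conjugates_lin fB)).
  have [_ /(_ B fB) [k ->]] := Jz.
  by rewrite scalerA Ny.
have NJ y : N y -> ~ joint_eig y.
  move=> Ny Jy; have := Ny 1 _ Jy; rewrite scale1r => /eqP; rewrite ripxx_eq0.
  by case: Jy => /negbTE ->.
have [hsc|] := pselect (forall B, conjugates B -> exists c : R, forall x, N x ->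
  B x = c *:r x).
  by case: (NJ _ Nx); split=> // B /hsc [c hc]; exists c; apply: hc.
move/existsNP => [B /not_implyP [fB hB]].
have bB := signed_sq_bounded_lin fB; have sB := signed_sq_symm fB.
have [a [ha1 [zm ha2]]] := attains_sup_essential hdim bB sB (conjugates_attains_sup fB).
have [y Ny ya] : exists2 y, N y & signed_sq B y != a *:r y.
  apply: contrapT => hn; apply: hB; exists (Num.sqrt (s * a)) => y My.
  apply: signed_sq_eig => //; apply/eqP; apply: contraT => ya; case: hn; by exists y.
pose E := [set x | signed_sq B x = a *:r x].
have [||z [b [[Nz Ez] zz zb]]] :=
  attains_sup_eigenvector bB.1 sB (conjugates_attains_sup fB) (csubI cN (orthc_csub E)).
- exists (signed_sq B y - a *:r y); last by rewrite subr_eq0.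
  split; first exact: (subspB sN (signed_sq_inv sN iN fB Ny) (subspZ _ sN Ny)).
  move=> c w /= hw; rewrite ripBl sB (linZ _ _ bB.1) hw scalerA mulrC -scalerA.
  by rewrite ripZr ripZl subrr.
- move=> w [Nw Ew]; split; first exact: (signed_sq_inv sN iN fB Nw).
  move=> c v /= hv; rewrite sB (linZ _ _ bB.1) hv scalerA; exact: Ew.
have ab : b != a.
  apply/eqP => ba; have Ezz : E z by rewrite /E /= zb ba.
  by have := Ez 1 z Ezz; rewrite scale1r zz => /eqP; rewrite oner_eq0.
(* An eigenvalue b > a violates the upper bound with constant (a + b) / 2 in finite codimension, and
   b < a violates the lower bound with constant a. *)
have [zs hzs] : exists zs, forall u, signed_sq B u = b *:r u -> perp zs u -> u = 0.
  have [lab|] := ltP a b.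
    have [|zs hzs] := ha1 ((a + b) / 2); first by lra.
    exists zs => u ub /hzs; rewrite ub ripZl => h; apply/eqP; apply: contraT => u0.
    by move: h; rewrite ler_pM2r ?ripxx_gt0 //; lra.
  rewrite le_eqVlt (negbTE ab) /= => lba.
  exists zm => u ub /ha2; rewrite ub ripZl => h; apply/eqP; apply: contraT => u0.
  by move: h; rewrite ler_pM2r ?ripxx_gt0 //; lra.
have [||||w [Nw _] Jw] := @joint_eig_in_finite (N `&` [set x | signed_sq B x = b *:r
  x]) zs.
- by apply: csubI => //; exact: csub_eig.
- by exists z => //; rewrite -ripxx_eq0 zz oner_eq0.
- move=> C w fC [Nw /= hw]; split; first exact: iN.
  by rewrite /= signed_sq_comm // hw (linZ _ _ (conjugates_lin fC)).
- by move=> w [_ /= hw]; apply: hzs.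
- by case: (NJ w).
Qed.

(** On a joint eigenvector this is the eigenvalue of B; the quotient names it without a choice. *)
Definition rayleigh B x : R := '[B x, x] / '[x, x].
Definition same_eig x y := forall B, conjugates B -> rayleigh B x = rayleigh B y.

Lemma joint_eig_neq0 x : joint_eig x -> x != 0. Proof. by case. Qed.

Lemma joint_eig_pos x : joint_eig x -> 0 < '[x, x]. Proof. by move=> /joint_eig_neq0;
  rewrite ripxx_gt0. Qed.

Lemma rayleighE B x c : x != 0 -> B x = c *:r x -> rayleigh B x = c.
Proof. by move=> x0 h; rewrite /rayleigh h ripZl mulfK // ripxx_eq0. Qed.

Lemma joint_eig_rayleigh B x : conjugates B -> joint_eig x -> B x = rayleigh B x *:r x.
Proof. by move=> fB [x0 /(_ B fB) [c h]]; rewrite (rayleighE x0 h). Qed.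

Lemma joint_eig_same x y : joint_eig x -> joint_eig y -> '[x, y] != 0 -> same_eig x y.
Proof.
move=> Jx Jy xy B fB; have := conjugates_symm fB x y.
rewrite (joint_eig_rayleigh fB Jx) (joint_eig_rayleigh fB Jy) ripZl ripZr => /eqP.
by rewrite -subr_eq0 -mulrBl mulf_eq0 (negbTE xy) orbF subr_eq0 => /eqP.
Qed.

Lemma same_eig_sym x y : same_eig x y -> same_eig y x.
Proof. by move=> h B fB; rewrite h. Qed.

Lemma same_eig_trans x y z : same_eig x y -> same_eig y z -> same_eig x z.
Proof. by move=> h1 h2 B fB; rewrite h1 // h2. Qed.

(** B U = U (V B U), and V B U is again a conjugate. *)
Lemma joint_eigU x : joint_eig x -> joint_eig (U x).
Proof.
move=> [x0 h]; split; first by rewrite -ripxx_eq0 ripUU ripxx_eq0.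
move=> B fB; have [c hc] := h _ (conjugates_VBU fB); exists c.
by rewrite -[LHS]UV [V _]hc (linZ _ _ bU.1).
Qed.

Lemma joint_eigZ (c : R[i]) x : c != 0 -> joint_eig x -> joint_eig (c *: x).
Proof.
move=> c0 [x0 h]; split; first by rewrite scaler_eq0 negb_or c0.
move=> B fB; have [k hk] := h _ fB; exists k.
by rewrite (linZ _ _ (conjugates_lin fB)) hk !scalerA mulrC.
Qed.

Lemma rayleighZ B (c : R[i]) x : conjugates B -> c != 0 -> joint_eig x ->
  rayleigh B (c *: x) = rayleigh B x.
Proof.
move=> fB c0 Jx; have [cx0 _] := joint_eigZ c0 Jx; apply: (rayleighE cx0).
by rewrite (linZ _ _ (conjugates_lin fB)) (joint_eig_rayleigh fB Jx) !scalerA mulrC.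
Qed.

Lemma same_eigZ (c : R[i]) x : c != 0 -> joint_eig x -> same_eig (c *: x) x.
Proof. by move=> c0 Jx B fB; rewrite rayleighZ. Qed.

Lemma rayleigh_U B x : rayleigh B (U x) = rayleigh (V \o B \o U) x.
Proof. by rewrite /rayleigh ripUU /= adjVU. Qed.

Lemma rayleigh_V B x : rayleigh B (V x) = rayleigh (U \o B \o V) x.
Proof. by rewrite /rayleigh ripVV /= adjUV. Qed.

Lemma same_eig_U x y : same_eig x y -> same_eig (U x) (U y).
Proof. by move=> h B fB; rewrite !rayleigh_U; apply/h/conjugates_VBU. Qed.

Lemma same_eig_V x y : same_eig x y -> same_eig (V x) (V y).
Proof. by move=> h B fB; rewrite !rayleigh_V; apply/h/conjugates_UBV. Qed.

Lemma joint_eig_iter k x : joint_eig x -> joint_eig (iter k U x).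
Proof. by move=> Jx; elim: k => //= k; exact: joint_eigU. Qed.

Lemma same_eig_iter k x y : same_eig x y -> same_eig (iter k U x) (iter k U y).
Proof. by move=> xy; elim: k => //= k; exact: same_eig_U. Qed.

Lemma same_eig_iterV k x y : same_eig x y -> same_eig (iter k V x) (iter k V y).
Proof. by move=> xy; elim: k => //= k; exact: same_eig_V. Qed.

(** * Diagonal operators *)

Definition all_joint_eig (F : seq H) := forall x, x \in F -> joint_eig x.
Definition comb (F : seq H) : H := \sum_(x <- F) x.
Definition gcomb (g : H -> R) (F : seq H) : H := \sum_(x <- F) g x *:r x.
(** These are the symbols of bounded diagonal operators. Dependence on the joint eigenvalues alone
    keeps g consistent on joint eigenvectors that are not orthogonal. *)
Definition admissible (g : H -> R) (K : R) := [/\ 0 <= K, forall x, joint_eig x ->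
  `|g x| <= K &
  forall x y, joint_eig x -> joint_eig y -> same_eig x y -> g x = g y].

(* Joint eigenvectors with different values of g are orthogonal, hence
   K^2 |\sum x|^2 - |\sum g(x) x|^2 = |\sum h(x) x|^2 for h = sqrt (K^2 - g^2). *)
Lemma gcomb_bound g K F : admissible g K -> all_joint_eig F ->
  rnorm (gcomb g F) <= K * rnorm (comb F).
Proof.
move=> [K0 gK gs] JF; pose h x := Num.sqrt (K ^+ 2 - g x ^+ 2).
have h2 x : joint_eig x -> h x ^+ 2 = K ^+ 2 - g x ^+ 2.
  move=> Jx; rewrite sqr_sqrtr // subr_ge0 -[g x ^+ 2]real_normK ?num_real //.
  by rewrite ler_pXn2r ?nnegrE ?gK.
have hs x y : joint_eig x -> joint_eig y -> same_eig x y ->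
  h x = h y by move=> Jx Jy xy; rewrite /h (gs x y).
have dbl k : (forall x y, joint_eig x -> joint_eig y -> same_eig x y -> k x = k y) ->
    '[gcomb k F, gcomb k F] = \sum_(x <- F) \sum_(y <- F) k x ^+ 2 * '[x, y].
  move=> ks; rewrite rip_suml; apply: eq_big_seq => x xF.
  rewrite rip_sumr; apply: eq_big_seq => y yF; rewrite ripZl ripZr mulrA.
  have [->|xy] := eqVneq '[x, y] 0; first by rewrite !mulr0.
  by rewrite (ks y x) ?expr2 //; [exact: JF | exact: JF |
    apply/same_eig_sym/joint_eig_same => //; exact: JF].
rewrite -(@ler_pXn2r _ 2) ?nnegrE ?mulr_ge0 // exprMn -!ripxx -subr_ge0.
have -> : K ^+ 2 * '[comb F, comb F] - '[gcomb g F, gcomb g F] = '[gcomb h F,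
  gcomb h F].
  rewrite !dbl // rip_suml mulr_sumr -sumrB; apply: eq_big_seq => x xF.
  rewrite rip_sumr mulr_sumr -sumrB; apply: eq_bigr => y _.
  by rewrite h2 ?mulrBl //; exact: JF.
exact: ripxx_ge0.
Qed.

Lemma comb_cat F G : comb (F ++ G) = comb F + comb G.
Proof. by rewrite /comb big_cat. Qed.

Lemma gcomb_cat g F G : gcomb g (F ++ G) = gcomb g F + gcomb g G.
Proof. by rewrite /gcomb big_cat. Qed.

Lemma comb_Z (c : R[i]) F : comb [seq c *: x | x <- F] = c *: comb F.
Proof. by rewrite /comb big_map scaler_sumr. Qed.

Lemma gcomb_Z g K (c : R[i]) F : admissible g K -> all_joint_eig F -> c != 0 ->
  gcomb g [seq c *: x | x <- F] = c *: gcomb g F.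
Proof.
move=> [_ _ gs] JF c0; rewrite /gcomb big_map scaler_sumr; apply: eq_big_seq => x xF.
have Jx := JF x xF.
by rewrite (gs (c *: x) x) ?scalerA 1?mulrC //; [exact: joint_eigZ | exact: same_eigZ].
Qed.

Lemma all_joint_eig_cat F G : all_joint_eig F -> all_joint_eig G ->
  all_joint_eig (F ++ G).
Proof. by move=> hF hG x; rewrite mem_cat => /orP[/hF|/hG]. Qed.

Lemma all_joint_eigZ (c : R[i]) F : c != 0 -> all_joint_eig F ->
  all_joint_eig [seq c *: x | x <- F].
Proof. by move=> c0 hF x /mapP [y /hF Jy ->]; exact: joint_eigZ. Qed.

(** Appending the negatives of G to F turns the norm bound into a Lipschitz estimate, which makes
    the value independent of how a vector is decomposed. *)
Lemma gcomb_diff g K F G : admissible g K -> all_joint_eig F -> all_joint_eig G ->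
  rnorm (gcomb g F - gcomb g G) <= K * rnorm (comb F - comb G).
Proof.
move=> ag JF JG.
have m1 : (-1 : R[i]) != 0 by rewrite oppr_eq0 oner_eq0.
have := gcomb_bound ag (all_joint_eig_cat JF (all_joint_eigZ m1 JG)).
by rewrite gcomb_cat comb_cat comb_Z (gcomb_Z ag JG m1) !scaleN1r.
Qed.

(** The limits of finite sums form a closed complex subspace, because multiples of joint
    eigenvectors are joint eigenvectors; its orthogonal is zero by totality. *)
Lemma joint_eig_dense x (e : R) : 0 < e ->
  exists2 F, all_joint_eig F & rnorm (x - comb F) < e.
Proof.
pose K := [set x | forall e : R, 0 < e ->
  exists2 F, all_joint_eig F & rnorm (x - comb F) < e].
suff : K x by apply.
have K0 : K 0.
  by move=> d d0; exists [::] => //; rewrite /comb big_nil subrr rnorm0.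
have JK y : joint_eig y -> K y.
  move=> Jy d d0; exists [:: y]; first by move=> z; rewrite inE => /eqP ->.
  by rewrite /comb big_seq1 subrr rnorm0.
apply: full_of_orth0 x; last by move=> x hx; apply: joint_eig_total => c y /JK;
  exact: hx.
split=> //.
  apply/closedHP => x h d d0; have d2 : 0 < d / 2 by rewrite divr_gt0.
  have [y Ky xy] := h _ d2; have [F JF yF] := Ky _ d2; exists F => //.
  by apply: le_lt_trans (rnorm_tri x y _) _; lra.
move=> c x y Kx Ky d d0.
have [->|c0] := eqVneq c 0; first by rewrite scale0r add0r; exact: Ky.
have cp : 0 <= complex.Re `|c|.
  by have := normr_ge0 c; case: `|c| => p q; rewrite lecE => /andP[].
have c1 : 0 < complex.Re `|c| + 1 by rewrite ltr_wpDl.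
have [|F JF xF] := Kx (d / 2 / (complex.Re `|c| + 1)); first by rewrite !divr_gt0.
have [|G JG yG] := Ky (d / 2); first by rewrite divr_gt0.
exists ([seq c *: x | x <- F] ++ G);
  first exact: all_joint_eig_cat (all_joint_eigZ c0 JF) JG.
rewrite comb_cat comb_Z opprD addrACA -scalerBr.
apply: le_lt_trans (rnormD _ _) _; rewrite rnormZ.
have : complex.Re `|c| * rnorm (x - comb F) <= d / 2.
  move: xF; rewrite ltr_pdivlMr // => /ltW; apply: le_trans.
  by rewrite mulrC ler_wpM2l // lerDl.
lra.
Qed.

Lemma joint_eig_ext A B : bounded_lin A -> bounded_lin B -> (forall x, joint_eig x ->
  A x = B x) -> forall x, A x = B x.
Proof.
move=> bA bB h x; apply/eqP; rewrite -subr_eq0; apply/eqP.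
apply: (full_of_orth0 (csub_preim (bounded_lin_sub bA bB) csub0) _ x) => y hy.
by apply: joint_eig_total => c z /h Jz; apply: hy; rewrite /= Jz subrr.
Qed.

Lemma rip_approx A x y w : bounded_lin A ->
  (forall e : R, 0 < e -> exists2 z, '[A z, y] = '[z, w] & rnorm (x - z) < e) ->
  '[A x, y] = '[x, w].
Proof.
move=> [lA [C C0 hC]] h; apply/eqP; rewrite -subr_eq0 -normr_le0; apply: le_eps => e e0.
have K0 : 0 < C * rnorm y + rnorm w + 1 by rewrite ltr_wpDl // addr_ge0 // mulr_ge0.
have [|z hz xz] := h (e / (C * rnorm y + rnorm w + 1)); first exact: divr_gt0.
have -> : '[A x, y] - '[x, w] = '[A (x - z), y] - '[x - z, w].
  by rewrite (linB _ _ lA) !ripBl hz opprB addrA subrK.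
rewrite add0r; apply: le_trans (ler_normB _ _) _.
move: xz; rewrite ltr_pdivlMr // => /ltW; apply: le_trans.
have := cauchy_schwarz (A (x - z)) y; have := cauchy_schwarz (x - z) w.
have : rnorm (A (x - z)) * rnorm y <= C * rnorm (x - z) * rnorm y by rewrite ler_wpM2r.
have := rnorm_ge0 (x - z); lra.
Qed.

Lemma symm_ext A B : bounded_lin A -> bounded_lin B ->
  (forall x y, joint_eig x -> joint_eig y -> '[A x, y] = '[x, B y]) ->
    forall x y, '[A x, y] = '[x, B y].
Proof.
move=> bA bB h.
have h1 x y : joint_eig y -> '[A x, y] = '[x, B y].
  move=> Jy; apply: rip_approx => // e /(joint_eig_dense x) [F JF xF];
    exists (comb F) => //.
  rewrite /comb (lin_sum _ _ bA.1) !rip_suml; apply: eq_big_seq => z zF.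
  by apply: h => //; exact: JF.
move=> x y; rewrite ripC [RHS]ripC; apply/esym;
  apply: rip_approx => // e /(joint_eig_dense y) [F JF yF].
exists (comb F) => //; rewrite /comb (lin_sum _ _ bB.1) !rip_suml;
  apply: eq_big_seq => z zF.
by rewrite ripC -h1 1?ripC //; exact: JF.
Qed.

(** The closure of the graph of comb F |-> gcomb g F. A relation is used because a vector has many
    decompositions F. *)
Definition diag_graph g x y := forall e : R, 0 < e ->
  exists F, [/\ all_joint_eig F, rnorm (x - comb F) < e &
  rnorm (y - gcomb g F) < e].

Lemma diag_graph_ex g K x : admissible g K -> exists y, diag_graph g x y.
Proof.
move=> ag; have [K0 _ _] := ag.
have K1 : 0 < K + 1 by rewrite ltr_wpDl.
have /choice [F hF] n : exists F, all_joint_eig F /\ rnorm (x - comb F) < n.+1%:R^-1.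
  by have [|F JF xF] := @joint_eig_dense x n.+1%:R^-1; [rewrite invr_gt0 | exists F].
have small e : 0 < e -> exists N, forall n, (N <= n)%N -> rnorm (x - comb (F n)) < e.
  by move=> /inv_small [N hN]; exists N => n /hN; apply: lt_trans; case: (hF n).
have [|y hy] := @completeH (fun n => gcomb g (F n)).
  move=> e e0; have [|N hN] := small (e / 2 / (K + 1)); first by rewrite !divr_gt0.
  exists N => m n Nm Nn; apply: le_lt_trans (gcomb_diff ag (hF m).1 (hF n).1) _.
  have := rnorm_tri (comb (F m)) x (comb (F n)); rewrite (rnormB _ x).
  move: (hN _ Nm) (hN _ Nn); rewrite !ltr_pdivlMr //.
  set p := rnorm _; set q := rnorm _; set r := rnorm _ => hp hq hr.
  have : K * r <= K * (p + q) by rewrite ler_wpM2l.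
  have := rnorm_ge0 (x - comb (F m)); have := rnorm_ge0 (x - comb (F n));
    rewrite -/p -/q; lra.
exists y => e e0; have [N1 h1] := small _ e0; have [N2 h2] := hy _ e0.
exists (F (maxn N1 N2)); split; first by case: (hF (maxn N1 N2)).
  by apply: h1; exact: leq_maxl.
by rewrite rnormB; apply: h2; exact: leq_maxr.
Qed.

Lemma diag_graph_bound g K x y : admissible g K -> diag_graph g x y ->
  rnorm y <= K * rnorm x.
Proof.
move=> ag h; have [K0 _ _] := ag; apply: le_eps => e e0.
have K1 : 0 < K + 1 by rewrite ltr_wpDl.
have e1 : (K + 1) * (e / (K + 1)) = e by rewrite mulrC mulfVK // gt_eqF.
have [|F [JF xF yF]] := h (e / (K + 1)); first exact: divr_gt0.
have := rnorm_tri y (gcomb g F) 0; rewrite !subr0 => h1; apply: le_trans h1 _.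
have := gcomb_bound ag JF; have := rnorm_tri (comb F) x 0; rewrite !subr0 rnormB.
move: xF yF e1; move: (e / (K + 1)) => d xF yF e1 h2 h3.
have h4 : K * rnorm (comb F) <= K * (d + rnorm x) by rewrite ler_wpM2l //; lra.
lra.
Qed.

Lemma diag_graph_lin g K (c : R[i]) x y x' y' : admissible g K -> diag_graph g x y ->
  diag_graph g x' y' ->
  diag_graph g (c *: x + x') (c *: y + y').
Proof.
move=> ag hx hy; have [->|c0] := eqVneq c 0; first by rewrite !scale0r !add0r.
move=> e e0.
have cp : 0 <= complex.Re `|c|.
  by have := normr_ge0 c; case: `|c| => p q; rewrite lecE => /andP[].
have c1 : 0 < complex.Re `|c| + 1 by rewrite ltr_wpDl.
have [|F [JF xF yF]] := hx (e / 2 / (complex.Re `|c| + 1)); first by rewrite !divr_gt0.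
have [|G [JG xG yG]] := hy (e / 2); first by rewrite divr_gt0.
have key u : rnorm u < e / 2 / (complex.Re `|c| + 1) -> rnorm (c *: u) <= e / 2.
  rewrite rnormZ ltr_pdivlMr // => /ltW; apply: le_trans.
  by rewrite mulrC ler_wpM2l // lerDl.
exists ([seq c *: x | x <- F] ++ G); split;
  first exact: all_joint_eig_cat (all_joint_eigZ c0 JF) JG.
  rewrite comb_cat comb_Z opprD addrACA -scalerBr.
  by apply: le_lt_trans (rnormD _ _) _; have := key _ xF; lra.
rewrite gcomb_cat (gcomb_Z ag JF c0) opprD addrACA -scalerBr.
by apply: le_lt_trans (rnormD _ _) _; have := key _ yF; lra.
Qed.

Lemma diag_graph_uniq g K x y y' : admissible g K -> diag_graph g x y ->
  diag_graph g x y' -> y = y'.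
Proof.
move=> ag hy hy'; have := diag_graph_lin (-1) ag hy hy'.
rewrite !scaleN1r addNr => /(diag_graph_bound ag); rewrite rnorm0 mulr0.
move=> h; apply/eqP; rewrite -subr_eq0 -rnorm_eq0 eq_le rnorm_ge0 andbT rnormB addrC.
exact: h.
Qed.

Definition diag_op g x : H := xget 0 [set y | diag_graph g x y].

Lemma diag_opP g K x : admissible g K -> diag_graph g x (diag_op g x).
Proof. by move=> ag; apply: (xgetPex 0); exact: diag_graph_ex ag. Qed.

Lemma diag_op_lin g K : admissible g K -> linear (diag_op g).
Proof.
move=> ag c x y; apply: (diag_graph_uniq ag (diag_opP _ ag)).
by apply: (diag_graph_lin _ ag); exact: diag_opP ag.
Qed.

Lemma diag_op_norm g K x : admissible g K -> rnorm (diag_op g x) <= K * rnorm x.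
Proof. by move=> ag; exact: diag_graph_bound ag (diag_opP _ ag). Qed.

Lemma diag_op_bounded_lin g K : admissible g K -> bounded_lin (diag_op g).
Proof. by move=> ag; split; [exact: diag_op_lin ag | exists K => [|x];
  [case: ag | exact: diag_op_norm ag]]. Qed.

Lemma diag_opE g K x : admissible g K -> joint_eig x -> diag_op g x = g x *:r x.
Proof.
move=> ag Jx; apply: (diag_graph_uniq ag (diag_opP _ ag)) => e e0; exists [:: x]; split.
- by move=> z; rewrite inE => /eqP ->.
- by rewrite /comb big_seq1 subrr rnorm0.
- by rewrite /gcomb big_seq1 subrr rnorm0.
Qed.

(** This reduces operator-norm estimates to scalar ones: the errors of the Riemann sums below are
    diagonal, in the double case after applying V. *)
Lemma diag_norm B g K x : bounded_lin B -> admissible g K ->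
  (forall y, joint_eig y -> B y = g y *:r y) ->
  rnorm (B x) <= K * rnorm x.
Proof.
move=> bB ag h; have -> : B x = diag_op g x.
  by apply: (joint_eig_ext bB (diag_op_bounded_lin ag)) => y Jy;
    rewrite h // (diag_opE ag).
exact: diag_op_norm ag.
Qed.

Lemma diag_symm B g : bounded_lin B -> (forall y, joint_eig y -> B y = g y *:r y) ->
  (forall x y, joint_eig x -> joint_eig y -> same_eig x y -> g x = g y) -> symm B.
Proof.
move=> bB h gs; apply: symm_ext => // x y Jx Jy; rewrite !h // ripZl ripZr.
have [->|xy] := eqVneq '[x, y] 0; first by rewrite !mulr0.
by rewrite (gs x y) //; exact: joint_eig_same.
Qed.

Lemma diag_op_symm g K : admissible g K -> symm (diag_op g).
Proof.
move=> ag; apply: (@diag_symm _ g); [exact: diag_op_bounded_lin ag | by move=> y;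
  exact: diag_opE ag | by case: ag].
Qed.

(** The operator is the square of the symmetric diagonal operator with symbol sqrt g. *)
Lemma diag_op_pos g K x : admissible g K -> (forall y, joint_eig y -> 0 <= g y) ->
  0 <= '[diag_op g x, x].
Proof.
move=> ag g0; have [K0 gK gs] := ag.
have ah : admissible (fun y => Num.sqrt (g y)) (Num.sqrt K).
  split; first exact: sqrtr_ge0.
    by move=> y Jy; rewrite ger0_norm ?sqrtr_ge0 // ler_wsqrtr // (le_trans (ler_norm
      _)) ?gK.
  by move=> y z Jy Jz yz; rewrite (gs y z).
have -> : diag_op g x = diag_op (fun y => Num.sqrt (g y)) (diag_op (fun y => Num.sqrt
  (g y)) x).
  apply: (joint_eig_ext (diag_op_bounded_lin ag) (bounded_lin_comp
    (diag_op_bounded_lin ah) (diag_op_bounded_lin ah))) => y Jy /=.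
  rewrite (diag_opE ag) // (diag_opE ah Jy) (linZ _ _ (diag_op_lin ah)) (diag_opE ah
    Jy) scalerA -rmorphM /=.
  by rewrite -expr2 sqr_sqrtr ?g0.
by rewrite (diag_op_symm ah) ripxx_ge0.
Qed.

Lemma diag_op_le g K c x : admissible g K -> (forall y, joint_eig y -> g y <= c) ->
  '[diag_op g x, x] <= c * '[x, x].
Proof.
move=> ag gc; have [K0 gK gs] := ag; rewrite -subr_ge0.
have ah : admissible (fun y => c - g y) (`|c| + K).
  split; first by rewrite addr_ge0.
    by move=> y Jy; apply: le_trans (ler_normB _ _) _; rewrite lerD2l gK.
  by move=> y z Jy Jz yz; rewrite (gs y z).
have -> : c * '[x, x] - '[diag_op g x, x] = '[diag_op (fun y => c - g y) x, x].
  have -> : diag_op (fun y => c - g y) x = c *:r x - diag_op g x.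
    apply: (joint_eig_ext (diag_op_bounded_lin ah) (bounded_lin_sub
      (bounded_lin_scale c%:C bounded_lin_id) (diag_op_bounded_lin ag))) => y Jy /=.
    by rewrite (diag_opE ah) // (diag_opE ag) // rmorphB scalerBl.
  by rewrite ripBl ripZl.
by apply: (diag_op_pos _ ah) => y Jy; rewrite subr_ge0 gc.
Qed.

Lemma admissible_opp g K : admissible g K -> admissible (fun x => - g x) K.
Proof.
move=> [K0 gK gs]; split=> // [x Jx|x y Jx Jy xy]; first by rewrite normrN gK.
by rewrite (gs x y).
Qed.

Lemma diag_op_opp g K x : admissible g K -> diag_op (fun y => - g y) x = - diag_op g x.
Proof.
move=> ag; have bN := bounded_lin_scale (-1) (diag_op_bounded_lin ag).
rewrite -scaleN1r; apply: (joint_eig_ext (diag_op_bounded_lin (admissible_opp ag))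
  bN) => y Jy.
by rewrite (diag_opE (admissible_opp ag)) // (diag_opE ag) // rmorphN scaleNr scaleN1r.
Qed.

Lemma rayleigh_admissible B : conjugates B -> exists K, admissible (rayleigh B) K.
Proof.
move=> fB; have [_ [C C0 hC]] := conjugates_bounded_lin fB; exists C; split=> //.
  move=> x Jx; rewrite /rayleigh normrM normfV (ger0_norm (ripxx_ge0 x)).
  rewrite ler_pdivrMr ?joint_eig_pos //; apply: le_trans (cauchy_schwarz _ _) _.
  by rewrite ripxx expr2 mulrA ler_wpM2r.
by move=> x y _ _ /(_ B fB).
Qed.

Lemma conjugates_diag_op B : conjugates B -> forall x, B x = diag_op (rayleigh B) x.
Proof.
move=> fB; have [K aK] := rayleigh_admissible fB.
by apply: (joint_eig_ext (conjugates_bounded_lin fB) (diag_op_bounded_lin aK)) => y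
  Jy; rewrite (diag_opE aK) // joint_eig_rayleigh.
Qed.

(** The common bound K reduces the claim to the dense set of finite sums, where pointwise
    convergence of the symbols is enough. *)
Lemma strong_lim (g : nat -> H -> R) h K : (forall n, admissible (g n) K) ->
  admissible h K ->
  (forall x, joint_eig x -> g n x @[n --> \oo] --> h x) ->
  forall x, tends (fun n => diag_op (g n) x) (diag_op h x).
Proof.
move=> ag ah lim x e e0; have [K0 _ _] := ah.
have K1 : 0 < 4 * (K + 1) by rewrite mulr_gt0 // ltr_wpDl.
have [|F JF xF] := @joint_eig_dense x (e / (4 * (K + 1))); first exact: divr_gt0.
have hF : exists N, forall n, (N <= n)%N ->
  rnorm (diag_op (g n) (comb F) - diag_op h (comb F)) < e / 4.
  have : forall d, 0 < d -> exists N, forall n, (N <= n)%N ->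
    rnorm (diag_op (g n) (comb F) - diag_op h (comb F)) < d.
    elim: F JF {xF} => [|y F ih] JF d d0.
      by exists 0%N => n _; rewrite /comb big_nil !(lin0 (diag_op_lin (ag n))) (lin0
        (diag_op_lin ah)) subrr rnorm0.
    have d2 : 0 < d / 2 by rewrite divr_gt0.
    have [|N1 h1] := ih _ _ d2; first by move=> z zF; apply: JF; rewrite inE zF orbT.
    have Jy : joint_eig y by apply: JF; rewrite inE eqxx.
    have ny : 0 < rnorm y by rewrite rnorm_gt0; case: Jy.
    have /cvgrPdist_lt /(_ (d / 2 / rnorm y)) [|N2 _ h2] := lim y Jy;
      first by rewrite divr_gt0.
    exists (maxn N1 N2) => n; rewrite geq_max => /andP[n1 n2].
    rewrite /comb big_cons -/(comb F) (linD _ _ (diag_op_lin (ag n))) (linD _ _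
      (diag_op_lin ah)).
    rewrite (diag_opE (ag n)) // (diag_opE ah) // opprD addrACA -scalerBl -rmorphB.
    apply: le_lt_trans (rnormD _ _) _; rewrite rnormZr.
    have := h1 n n1; have := h2 n n2; rewrite /= distrC ltr_pdivlMr //; lra.
  by apply; rewrite divr_gt0.
have [N hN] := hF; exists N => n /hN h1.
have h2 := diag_op_norm (x - comb F) (ag n); have h3 := diag_op_norm (x - comb F) ah.
have -> : diag_op (g n) x - diag_op h x = diag_op (g n) (x - comb F) - diag_op h (x -
  comb F) +
    (diag_op (g n) (comb F) - diag_op h (comb F)).
  rewrite (linB _ _ (diag_op_lin (ag n))) (linB _ _ (diag_op_lin ah)).
  by rewrite opprB addrAC !addrA !subrK.
apply: le_lt_trans (rnormD _ _) _.
have := rnormD (diag_op (g n) (x - comb F)) (- diag_op h (x - comb F));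
  rewrite rnormN => h4.
have h5 : K * rnorm (x - comb F) <= e / 4.
  move: xF; rewrite ltr_pdivlMr // => xF.
  have := rnorm_ge0 (x - comb F); lra.
lra.
Qed.

(** * Spectral families and double operator integrals *)

(** The symbol of the spectral projection of diag(g) for the half-line up to c. *)
Definition sublevel g c x : R := if g x <= c then 1 else 0.

Lemma sublevel_admissible g K c : admissible g K -> admissible (sublevel g c) 1.
Proof.
move=> [K0 gK gs]; split=> //; first by move=> x _; rewrite /sublevel; case: ifP;
  rewrite ?normr1 ?normr0.
by move=> x y Jx Jy xy; rewrite /sublevel (gs x y).
Qed.

Lemma sublevel_family g K a b : admissible g K -> (forall x, joint_eig x ->
  a < g x <= b) ->
  spectral_family ip a b (fun c => diag_op (sublevel g c)).
Proof.
move=> ag gab; have iad c := sublevel_admissible c ag; split.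
- move=> c; split; first by apply/bounded_linP; exact: diag_op_bounded_lin (iad c).
    apply/funext; apply: (joint_eig_ext (bounded_lin_comp (diag_op_bounded_lin (iad
      c)) (diag_op_bounded_lin (iad c))) (diag_op_bounded_lin (iad c))).
    move=> x Jx /=; rewrite (diag_opE (iad c) Jx) (linZ _ _ (diag_op_lin (iad c)))
      (diag_opE (iad c) Jx).
    by rewrite scalerA -rmorphM /= /sublevel; case: ifP; rewrite ?mulr1 ?mulr0.
  move=> x y; apply: ip_ext => k.
  by rewrite (diag_op_symm (iad c)) (linZ _ _ (diag_op_lin (iad c))).
- move=> c d; apply/funext; apply: (joint_eig_ext (bounded_lin_comp
  (diag_op_bounded_lin (iad c)) (diag_op_bounded_lin (iad d))) (diag_op_bounded_lin
  (iad _))).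
  move=> x Jx /=; rewrite (diag_opE (iad d) Jx) (linZ _ _ (diag_op_lin (iad c)))
    (diag_opE (iad c) Jx).
  rewrite (diag_opE (iad _) Jx) scalerA -rmorphM /= /sublevel le_min.
  by case: (g x <= c); case: (g x <= d); rewrite ?mulr1 ?mulr0.
- move=> c x; apply/cvg_right_rnorm => e e0.
  have [F JF xF] := @joint_eig_dense x (e / 4) (divr_gt0 e0 (ltr0Sn _ _)).
  (* On a finite sum the projections are constant just to the right of c, since each g y is either
     at most c or a positive distance above it. *)
  have [d d0 hd] : exists2 d, 0 < d & forall t, c < t -> t < c + d ->
    diag_op (sublevel g t) (comb F) = diag_op (sublevel g c) (comb F).
    elim: F JF {xF} => [|y F ih] JF.
      by exists 1 => // t _ _; rewrite /comb big_nil !(lin0 (diag_op_lin (iad _))).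
    have [|d d0 hd] := ih; first by move=> z zF; apply: JF; rewrite inE zF orbT.
    have Jy : joint_eig y by apply: JF; rewrite inE eqxx.
    have [d' d'0 hd'] : exists2 d' : R, 0 < d' & forall t, c < t -> t < c + d' ->
      sublevel g t y = sublevel g c y.
      rewrite /sublevel; have [yc|cy] := leP (g y) c.
        by exists 1 => // t ct _; rewrite (le_trans yc) // ltW.
      exists (g y - c); first by rewrite subr_gt0.
      by move=> t ct tc; rewrite leNgt; have -> : t < g y by lra.
    exists (Num.min d d'); first by rewrite lt_min d0.
    move=> t ct; rewrite addr_minr lt_min => /andP[td td'].
    rewrite /comb big_cons -/(comb F) !(linD _ _ (diag_op_lin (iad _))) hd //.
    by rewrite !(diag_opE (iad _) Jy) hd'.
  exists d => // t ct td.
  have -> : diag_op (sublevel g c) x - diag_op (sublevel g t) x = diag_op (sublevel g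
    c) (x - comb F) - diag_op (sublevel g t) (x - comb F).
    rewrite !(linB _ _ (diag_op_lin (iad _))) hd //.
    by rewrite opprB addrA subrK.
  apply: le_lt_trans (rnormD _ _) _; rewrite rnormN.
  have := diag_op_norm (x - comb F) (iad c);
    have := diag_op_norm (x - comb F) (iad t); lra.
- apply/funext; apply: (joint_eig_ext (diag_op_bounded_lin (iad a)) (_ : bounded_lin
  (fun=> 0))).
    by split; [move=> k x y; rewrite scaler0 addr0 | exists 0 => // x;
      rewrite rnorm0 mul0r].
  move=> x Jx; rewrite (diag_opE (iad a) Jx) /sublevel leNgt.
  by have /andP[-> _] := gab x Jx; rewrite scale0r.
- apply/funext; apply: (joint_eig_ext (diag_op_bounded_lin (iad b)) bounded_lin_id).
  move=> x Jx; rewrite (diag_opE (iad b) Jx) /sublevel.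
  by have /andP[_ ->] := gab x Jx; rewrite scale1r.
Qed.

Lemma increment_joint_eig g K E (x : nat -> R) i y : admissible g K ->
  (forall c z, joint_eig z -> E c z = sublevel g c z *:r z) ->
  x i <= x i.+1 -> joint_eig y -> increment E x i y = (x i < g y <= x i.+1)%R%:R *:r y.
Proof.
move=> ag hE xx Jy; rewrite /increment !hE // -scalerBl -rmorphB /sublevel;
  congr (_%:C *: _).
have [h|h] := leP (g y) (x i); first by rewrite (le_trans h xx) subrr.
by case: (_ <= _); rewrite subr0.
Qed.

Lemma spectral_int g K E a b : admissible g K -> (forall x, joint_eig x ->
  a < g x <= b) ->
  (forall c, bounded_lin (E c)) -> (forall c z, joint_eig z ->
    E c z = sublevel g c z *:r z) ->
  is_spectral_integral a b E id (diag_op g).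
Proof.
(* The mesh bound can be e itself: on a joint eigenvector y the sum is the tag of the cell
   containing g y. *)
move=> ag gab bE hE e e0; exists e => // n x xi hp h.
have [_ _ hx] := hp.
pose S := fun h => \sum_(i < n) (id (xi i))%:C *: increment E x i h.
have bS : bounded_lin S by apply: bounded_lin_sum => i; apply: bounded_lin_scale;
  exact: increment_bounded_lin.
have [K0 gK gs] := ag.
pose k y := (\sum_(i < n) xi i * (x i < g y <= x i.+1)%R%:R) - g y.
have kE y : joint_eig y -> S y - diag_op g y = k y *:r y.
  move=> Jy; rewrite (diag_opE ag Jy) /k rmorphB scalerBl; congr (_ - _).
  rewrite raddf_sum /= scaler_suml; apply: eq_bigr => i _.
  have [h1 h2 _] := hx i (ltn_ord i).
  by rewrite (increment_joint_eig ag hE (le_trans h1 h2) Jy) scalerA -rmorphM.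
have kb y : joint_eig y -> `|k y| <= e.
  move=> Jy; have [i [hi hxi _ hj]] := partition_index hp (gab y Jy).
  rewrite /k (bigD1 i) //= hi mulr1 big1 ?addr0 // => j /hj /negbTE ->.
  by rewrite mulr0.
have ak : admissible k e.
  by split=> //; [exact: ltW | move=> y z Jy Jz yz; rewrite /k (gs y z)].
exact: (diag_norm h (bounded_lin_sub bS (diag_op_bounded_lin ag)) ak kE).
Qed.

(** Let F t = '[E t z, z], a monotone function. Testing the integral at z against E c z uses only
    mass up to c and gives g z * F c <= c * F c, so F c = 0 when c < g z; testing against z - E c z
    treats g z < c. Right continuity settles c = g z. *)
Lemma spectral_uniq g K E a b : admissible g K ->
  spectral_decomposition ip a b (diag_op g) E ->
  [/\ forall c, bounded_lin (E c), forall c z, joint_eig z ->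
    E c z = sublevel g c z *:r z & forall x, joint_eig x -> a < g x <= b].
Proof.
move=> ag [[hproj hmin hright Ea Eb] hint].
have bE c : bounded_lin (E c) by have [] := orthproj_facts (hproj c).
have sE c : symm (E c) by have [] := orthproj_facts (hproj c).
have EE c x : E c (E c x) = E c x by have [_ _ ->] := orthproj_facts (hproj c).
have Em c d x : E c (E d x) = E (Num.min c d) x by rewrite -hmin.
have key z : joint_eig z -> forall c, (c < g z -> E c z = 0) /\ (g z < c -> E c z = z).
  move=> Jz c; pose F t := '[E t z, z].
  have FE t : F t = '[E t z, E t z] by rewrite /F -sE EE.
  have Fm t t' : t <= t' -> F t <= F t'.
    move=> tt'; rewrite !FE.
    have -> : E t z = E t (E t' z) by rewrite Em min_l.
    exact: proj_contr.
  have Fmin t : '[E t z, E c z] = F (Num.min t c) by rewrite /F sE Em ripC minC.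
  have Fa t : t <= a -> F t = 0.
    move=> ta; have : F t <= F a by exact: Fm.
    rewrite {2}/F Ea rip0l => h; apply/eqP; rewrite eq_le h /=.
    by rewrite FE ripxx_ge0.
  have Fb : F b = '[z, z] by rewrite /F Eb.
  have Fbc : F (Num.min b c) = F c by rewrite -Fmin Eb ripC.
  have ab : a < b.
    rewrite ltNge; apply/negP => ba; have := joint_eig_pos Jz.
    by rewrite -Fb Fa // ltxx.
  have approx u (e : R) : 0 < e -> exists d n (x : nat -> R), [/\ 0 < d, d <= e,
    tagged_partition a b d n x x &
     `|\sum_(i < n) x i * ('[E (x i.+1) z, u] - '[E (x i) z, u]) - g z * '[z,
       u]| <= e * (rnorm z * rnorm u)].
    move=> e0; have [d d0 hd] := hint e e0.
    have m0 : 0 < Num.min d e by rewrite lt_min d0.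
    have [n [x hp]] := partition_ex (ltW ab) m0.
    exists (Num.min d e), n, x; split => //; first by rewrite ge_min lexx orbT.
    have hp' : tagged_partition a b d n x x.
      have [x0 xn hx] := hp.
      split=> // i /hx [h1 h2 h3]; split=> //; apply: lt_le_trans h3 _;
        by rewrite ge_min lexx.
    have := hd n x x hp' z; rewrite (diag_opE ag Jz); set v := (X in rnorm X) => hv.
    have -> : \sum_(i < n) x i * ('[E (x i.+1) z, u] - '[E (x i) z, u]) - g z * '[z,
      u] = '[v, u].
      rewrite /v ripBl ripZl rip_suml; congr (_ - _); apply: eq_bigr => i _.
      by rewrite ripZl /increment ripBl.
    by apply: le_trans (cauchy_schwarz _ _) _; rewrite mulrA ler_wpM2r.
  (* Of the two multiples of '[z, z], one pays for the mesh and one for the error of the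
     integral. *)
  have small t : (forall e : R, 0 < e -> 0 <= t + e * ('[z, z] *+ 2)) -> 0 <= t.
    move=> h; apply: (@le_eps 0 t) => e e0; have zz := joint_eig_pos Jz.
    have := h (e / ('[z, z] *+ 2)); rewrite divr_gt0 ?mulrn_wgt0 // => /(_ isT).
    by rewrite mulfVK // mulrn_eq0 /= gt_eqF.
  have nE : rnorm z * rnorm (E c z) <= '[z, z].
    rewrite ripxx expr2 ler_wpM2l // -(@ler_pXn2r _ 2) ?nnegrE // -!ripxx.
    exact: proj_contr.
  have FcZ : F c <= '[z, z] by rewrite FE; exact: proj_contr.
  have Fc0 : 0 <= F c by rewrite FE ripxx_ge0.
  have uu : '[z - E c z, z - E c z] = '[z, z] - F c.
    by rewrite !ripE (ripC z) -/(F c) -FE; lra.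
  have nE' : rnorm z * rnorm (z - E c z) <= '[z, z].
    by rewrite ripxx expr2 ler_wpM2l // -(@ler_pXn2r _ 2) ?nnegrE // -!ripxx uu; lra.
  have Fmac : F (Num.min a c) = 0 by apply: Fa; rewrite ge_min lexx.
  split=> hc.
    apply/eqP; rewrite -ripxx_eq0 -FE; apply: contraT => Fn0.
    have Fp : 0 < F c by rewrite lt_def Fn0 Fc0.
    have : 0 <= (c - g z) * F c.
      apply: small => e e0; have [d [n [x [d0 de hp]]]] := approx (E c z) e e0.
      rewrite (ripC z (E c z)) -/(F c).
      under eq_bigr do rewrite !Fmin.
      have := @stieltjes_le a b d n x x (fun t => F (Num.min t c)) c hp.
      rewrite Fbc Fmac subr0 => h1 h2.
      have {}h1 : \sum_(i < n) x i * (F (Num.min (x i.+1) c) - F (Num.min (x i) c))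
        <= (c + d) * F c.
        apply: h1 => [t t' tt'|t t' ct ct']; first by apply: Fm; exact: le_min2.
        by rewrite !min_r.
      have {}h2 : `|\sum_(i < n) x i * (F (Num.min (x i.+1) c) - F (Num.min (x i) c))
        - g z * F c| <=
          e * (rnorm z * rnorm (E c z)) := h2.
      have h3 : d * F c <= e * F c by rewrite ler_wpM2r.
      have h4 : e * F c <= e * '[z, z] by rewrite ler_wpM2l // ltW.
      have h5 : e * (rnorm z * rnorm (E c z)) <= e * '[z,
        z] by rewrite ler_wpM2l // ltW.
      move: h1 h2; set S := \sum_(i < n) _ => h1; rewrite ler_norml => /andP[h2 _];
        move: h1 h2 h3 h4 h5; rewrite mulr2n.
      move: '[z, z] (rnorm z * rnorm (E c z)) (F c) (g z) S => zz rr f gz S; lra.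
    by rewrite pmulr_lge0 // subr_ge0 leNgt hc.
  apply/eqP; rewrite eq_sym -subr_eq0 -ripxx_eq0 uu eq_le subr_ge0 FcZ andbT.
  have : 0 <= (g z - c) * ('[z, z] - F c).
    apply: small => e e0; have [d [n [x [d0 de hp]]]] := approx (z - E c z) e e0.
    have zu : '[z, z - E c z] = '[z, z] - F c by rewrite ripBr (ripC z (E c z)).
    rewrite zu.
    under eq_bigr do rewrite !(ripBr z (E c z)) !Fmin -!/(F _).
    have := @stieltjes_ge a b d n x x (fun t => F t - F (Num.min t c)) c hp.
    rewrite Fbc Fmac Fb (Fa a (lexx a)) !subr0 => h1 h2.
    have {}h1 : (c - d) * ('[z, z] - F c) <=
        \sum_(i < n) x i * (F (x i.+1) - F (Num.min (x i.+1) c) - (F (x i) - F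
          (Num.min (x i) c))).
      apply: h1 => t t'; last by move=> tc tc'; rewrite !min_l // !subrr.
      have [tc|ct] := leP t c; have [tc'|ct'] := leP t' c => tt'.
      - by rewrite !subrr.
      - by rewrite subrr subr_ge0; apply: Fm; exact: ltW.
      - by have := lt_le_trans ct (le_trans tt' tc'); rewrite ltxx.
      - by rewrite lerD2r Fm.
    have {}h2 : `|\sum_(i < n) x i * (F (x i.+1) - F (Num.min (x i.+1) c) - (F (x i)
      - F (Num.min (x i) c)))
      - g z * ('[z, z] - F c)| <= e * (rnorm z * rnorm (z - E c z)) := h2.
    have h3 : d * ('[z, z] - F c) <= e * ('[z,
      z] - F c) by rewrite ler_wpM2r // subr_ge0.
    have h4 : e * ('[z, z] - F c) <= e * '[z,
      z] by rewrite ler_wpM2l ?(ltW e0) // gerBl.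
    have h5 : e * (rnorm z * rnorm (z - E c z)) <= e * '[z,
      z] by rewrite ler_wpM2l // ltW.
    move: h1 h2; set S := \sum_(i < n) _ => h1; rewrite ler_norml => /andP[_ h2].
    move: h1 h2 h3 h4 h5; rewrite mulr2n.
    move: '[z, z] (rnorm z * rnorm (z - E c z)) (F c) (g z) S => zz rr f gz S; lra.
  by rewrite nmulr_rge0 ?subr_lt0.
have keyE c z : joint_eig z -> E c z = sublevel g c z *:r z.
  move=> Jz; rewrite /sublevel; case: (ltgtP (g z) c) => hc.
  - by rewrite scale1r; apply: (key z Jz c).2.
  - by rewrite scale0r; apply: (key z Jz c).1.
  (* At c = g z the value is the limit from the right, where E already fixes z. *)
  - rewrite scale1r; apply/eqP; rewrite -subr_eq0 -rnorm_eq0 eq_le rnorm_ge0 andbT.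
    apply: le_eps => e e0; rewrite add0r.
    have /cvg_right_rnorm /(_ e e0) [d d0 hd] := hright c z.
    have h1 : c < c + d / 2 by rewrite ltrDl divr_gt0.
    have hEz : E (c + d / 2) z = z by apply: (key z Jz _).2; rewrite hc.
    have := hd (c + d / 2) h1; rewrite hEz => h2.
    by apply/ltW/h2; rewrite ltrD2l; lra.
split=> // z Jz; have z0 := joint_eig_neq0 Jz; apply/andP; split.
  rewrite ltNge; apply/negP => ga; have := keyE a z Jz.
  by rewrite Ea /sublevel ga scale1r => /esym/eqP; rewrite (negbTE z0).
rewrite leNgt; apply/negP => gb; have := keyE b z Jz.
by rewrite Eb /sublevel leNgt gb scale0r => /eqP; rewrite (negbTE z0).
Qed.

Lemma joint_eig_nonempty : exists z, joint_eig z.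
Proof.
apply: contrapT => hn; have [u u0 _] := infdim [::] hdim.
move/eqP: u0; apply; apply: joint_eig_total => c y Jy; by case: hn; exists y.
Qed.

Lemma rnormV x : rnorm (V x) = rnorm x.
Proof. by apply/eqP; rewrite -(@eqrXn2 _ 2) // -!ripxx ripVV. Qed.

(** U z is again a joint eigenvector, so dE_t reads g z and dE_s reads g (U z). Applying the
    isometry V makes the error diagonal, and uniform continuity of phi bounds its symbol. *)
Lemma double_int g K g' K' E a b (phi : R -> R -> R) : admissible g K ->
  admissible g' K' ->
  (forall x, joint_eig x -> a < g x <= b) ->
  (forall c, bounded_lin (E c)) -> (forall c z, joint_eig z ->
    E c z = sublevel g c z *:r z) ->
  (forall x, joint_eig x -> g' x = phi (g (U x)) (g x)) ->
  (forall e : R, 0 < e -> exists2 d : R, 0 < d & forall p q p' q', a <= p <= b ->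
    a <= q <= b ->
    a <= p' <= b -> a <= q' <= b -> `|p - p'| <= d -> `|q - q'| <= d ->
    `|phi p q - phi p' q'| <= e) ->
  is_double_operator_integral a b E phi U (U \o diag_op g').
Proof.
move=> ag ag' gab bE hE hg' hphi e e0.
have [d d0 hd] := hphi e e0; exists d => // n x xi m y eta hp hq h.
have [_ _ hx] := hp; have [_ _ hy] := hq.
pose S := fun h => \sum_(i < n) \sum_(j < m)
  (phi (xi i) (eta j))%:C *: increment E x i (U (increment E y j h)).
have bS : bounded_lin S.
  apply: bounded_lin_sum => i; apply: bounded_lin_sum => j; apply: bounded_lin_scale.
  by apply: (bounded_lin_comp (increment_bounded_lin x i bE) (bounded_lin_comp bU
    (increment_bounded_lin y j bE))).
have [K0 gK gs] := ag.
pose ix z (i : nat) := (x i < g (U z) <= x i.+1)%R.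
pose iy z (j : nat) := (y j < g z <= y j.+1)%R.
pose k z := (\sum_(i < n) \sum_(j < m) phi (xi i) (eta j) * ((ix z i)%:R * (iy z
  j)%:R)) - g' z.
have bD : bounded_lin (fun w => S w - (U \o diag_op g') w) :=
  bounded_lin_sub bS (bounded_lin_comp bU (diag_op_bounded_lin ag')).
have kE z : joint_eig z -> V (S z - (U \o diag_op g') z) = k z *:r z.
  move=> Jz; rewrite (linB _ _ bV.1) /= VU (diag_opE ag' Jz) /k rmorphB scalerBl;
    congr (_ - _).
  rewrite /S (lin_sum _ _ bV.1) raddf_sum /= scaler_suml; apply: eq_bigr => i _.
  rewrite (lin_sum _ _ bV.1) raddf_sum /= scaler_suml; apply: eq_bigr => j _.
  have [h1 h2 _] := hx i (ltn_ord i); have [h3 h4 _] := hy j (ltn_ord j).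
  rewrite (increment_joint_eig ag hE (le_trans h3 h4) Jz) (linZ _ _ bU.1).
  rewrite (linZ _ _ (increment_bounded_lin x i bE).1) (increment_joint_eig ag hE
    (le_trans h1 h2) (joint_eigU Jz)).
  rewrite !(linZ _ _ bV.1) VU !scalerA; congr (_ *: _).
  by rewrite -!rmorphM; congr (_%:C); rewrite /ix /iy; ring.
have kb z : joint_eig z -> `|k z| <= e.
  move=> Jz; have [i [hi hxi xb hi']] := partition_index hp (gab _ (joint_eigU Jz)).
  have [j [hj hyj yb hj']] := partition_index hq (gab _ Jz).
  rewrite /k (bigD1 i) //= (bigD1 j) //= {1}/ix {1}/iy hi hj !mulr1 big1 ?addr0;
    last first.
    by move=> j' /hj' /negbTE hj0; rewrite /iy hj0 !mulr0.
  rewrite big1 ?addr0; last first.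
    by move=> i' /hi' /negbTE hi0; apply: big1 => j' _; rewrite /ix hi0 mul0r mulr0.
  rewrite hg' //.
  have cl (v : R) : a < v <= b -> a <= v <= b by move=> /andP[/ltW -> ->].
  by apply: hd => //; apply: cl; apply: gab => //; exact: joint_eigU.
have ak : admissible k e.
  split=> //; first exact: ltW.
  move=> z w Jz Jw zw; rewrite /k; have [_ _ gs'] := ag'; rewrite (gs' z w) //;
    congr (_ - _).
  apply: eq_bigr => i _; apply: eq_bigr => j _.
  by rewrite /ix /iy (gs z w) // (gs (U z) (U w)) //;
    [exact: joint_eigU | exact: joint_eigU | exact: same_eig_U].
rewrite -[rnorm _]rnormV.
exact: (diag_norm h (bounded_lin_comp bV bD) ak kE).
Qed.

Lemma adjU : adj ip U = V.
Proof. by apply: adj_unique; apply: adjointP => //; case: bU. Qed.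

(** * The induced Aluthge transformation of U diag(g) *)

Section Step.
Context (g : H -> R) (m M : R) (m0 : 0 < m) (gmM : forall x, joint_eig x ->
  m <= g x <= M).
Context (gs : forall x y, joint_eig x -> joint_eig y -> same_eig x y -> g x = g y).

Lemma g_gt0 x : joint_eig x -> 0 < g x.
Proof. by move=> /gmM /andP[h _]; exact: lt_le_trans h. Qed.

Lemma M_gt0 : 0 < M.
Proof. by have [z Jz] := joint_eig_nonempty; have /andP[h1 h2] := gmM Jz;
  exact: lt_le_trans m0 (le_trans h1 h2). Qed.

Lemma g_admissible : admissible g M.
Proof.
split=> // [|x Jx]; first exact/ltW/M_gt0.
by rewrite ger0_norm ?(ltW (g_gt0 Jx)) //; have /andP[] := gmM Jx.
Qed.

Lemma ginv_admissible : admissible (fun x => (g x)^-1) m^-1.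
Proof.
split=> [|x Jx|x y Jx Jy xy]; [by rewrite invr_ge0 ltW | | by rewrite (gs Jx Jy)].
rewrite ger0_norm ?invr_ge0 ?(ltW (g_gt0 Jx)) // lef_pV2 ?posrE ?g_gt0 //.
by have /andP[] := gmM Jx.
Qed.

Lemma diag_opK x : diag_op g (diag_op (fun x => (g x)^-1) x) = x.
Proof.
have bg := diag_op_bounded_lin g_admissible;
  have bi := diag_op_bounded_lin ginv_admissible.
apply: (joint_eig_ext (bounded_lin_comp bg bi) bounded_lin_id) => y Jy /=.
rewrite (diag_opE ginv_admissible Jy) (linZ _ _ bg.1) (diag_opE g_admissible Jy)
  scalerA -rmorphM mulVf ?scale1r //.
by rewrite gt_eqF // g_gt0.
Qed.

Lemma diag_opVK x : diag_op (fun x => (g x)^-1) (diag_op g x) = x.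
Proof.
have bg := diag_op_bounded_lin g_admissible;
  have bi := diag_op_bounded_lin ginv_admissible.
apply: (joint_eig_ext (bounded_lin_comp bi bg) bounded_lin_id) => y Jy /=.
rewrite (diag_opE g_admissible Jy) (linZ _ _ bi.1) (diag_opE ginv_admissible Jy)
  scalerA -rmorphM mulfV ?scale1r //.
by rewrite gt_eqF // g_gt0.
Qed.

Local Notation TT := (U \o diag_op g).

Lemma adj_step : adj ip TT = diag_op g \o V.
Proof.
have bg := diag_op_bounded_lin g_admissible; apply: adj_unique; apply: adjointP.
- exact: bounded_lin_comp bg bV.
- by case: (bounded_lin_comp bU bg).
- by move=> x y /=; rewrite adjUV (diag_op_symm g_admissible).
Qed.

(** For uniqueness, another positive root Q of the same square is determined on each joint
    eigenvector by [pos_sqrt], and these are total. *)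
Lemma modulus_step : modulus ip TT = diag_op g.
Proof.
have bg := diag_op_bounded_lin g_admissible.
have pos x : 0 <= '[diag_op g x,
  x] by apply: (diag_op_pos _ g_admissible) => y /g_gt0/ltW.
apply: xget_unique; rewrite /= adj_step.
  split; first exact: (symm_positive bg (diag_op_symm g_admissible) pos).
  by apply/funext => x /=; rewrite VU.
move=> Q [/positive_facts [bQ sQ pQ] QQ].
apply/funext; apply: (joint_eig_ext bQ bg) => y Jy; rewrite (diag_opE g_admissible Jy).
have -> : g y = Num.sqrt (g y ^+ 2) by rewrite sqrtr_sqr ger0_norm // ltW // g_gt0.
apply: pos_sqrt bQ.1 sQ pQ _.
have := congr1 (fun f => f y) QQ; rewrite /= VU => ->.
by rewrite !(diag_opE g_admissible Jy) (linZ _ _ bg.1) (diag_opE g_admissible Jy)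
  scalerA -rmorphM expr2.
Qed.

Lemma polar_step : polar_decomposition ip TT U.
Proof.
split; [exact/bounded_linP | by rewrite adjU; apply/funext => x /=;
  rewrite VU | by rewrite modulus_step |].
have bg := diag_op_bounded_lin g_admissible.
move=> x; split=> [/(congr1 V)|/(congr1 V)]; rewrite /= VU (lin0 bV.1) => h.
  by rewrite h (lin0 bg.1) (lin0 bU.1).
by rewrite -[x]diag_opVK h (lin0 (diag_op_lin ginv_admissible)) (lin0 bU.1).
Qed.

Lemma polar_step_uniq U' : polar_decomposition ip TT U' -> U' = U.
Proof.
move=> [_ _]; rewrite modulus_step => h _; apply/funext => x.
by have := congr1 (fun f => f (diag_op (fun x => (g x)^-1) x)) h; rewrite /= diag_opK.
Qed.

Context (r lam : R) (r0 : r != 0) (lam01 : 0 < lam < 1).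

Definition gnext x := pmean r lam (g (U x)) (g x).

Lemma gnext_bounds x : joint_eig x -> m <= gnext x <= M.
Proof.
move=> Jx; have /andP[h1 h2] := gmM Jx; have /andP[h3 h4] := gmM (joint_eigU Jx).
by rewrite /gnext (pmean_ge r0 lam01 m0 h3 h1) (pmean_le r0 lam01 (lt_le_trans m0 h3)
  (lt_le_trans m0 h1) h4 h2).
Qed.

Lemma gnext_same_eig x y : joint_eig x -> joint_eig y -> same_eig x y ->
  gnext x = gnext y.
Proof.
by move=> Jx Jy xy; rewrite /gnext (gs Jx Jy xy) (gs (joint_eigU Jx) (joint_eigU Jy)
  (same_eig_U xy)).
Qed.

Lemma gnext_admissible : admissible gnext M.
Proof.
split; [exact/ltW/M_gt0 | | exact: gnext_same_eig].
move=> x Jx; have /andP[h1 h2] := gnext_bounds Jx.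
by rewrite ger0_norm // (le_trans (ltW m0)).
Qed.

Lemma double_int_step E a b : 0 < a -> a <= b -> (forall x, joint_eig x ->
  a < g x <= b) ->
  (forall c, bounded_lin (E c)) -> (forall c z, joint_eig z ->
    E c z = sublevel g c z *:r z) ->
  is_double_operator_integral a b E (fun s t => s * power_mean_fun r lam (t / s)) U
    (U \o diag_op gnext).
Proof.
move=> a0 ab gab bE hE; apply: (double_int g_admissible gnext_admissible gab bE hE)
  => // e e0.
exact: (pmean_unif r0 lam01 a0 ab e0).
Qed.

Lemma induced_aluthge_step :
  induced_aluthge ip (power_mean_fun r lam) TT = U \o diag_op gnext.
Proof.
have bn := bounded_lin_comp bU (diag_op_bounded_lin gnext_admissible).
apply: xget_unique.
  split; first exact/bounded_linP.
  (* The family lives on an interval open at its left end and g may take the value m, so the end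
     point is moved to m / 2, still positive. *)
  have m2 : 0 < m / 2 by rewrite divr_gt0.
  have iad c := sublevel_admissible c g_admissible.
  have gab x : joint_eig x -> m / 2 < g x <= M.
    by move=> /gmM /andP[h1 ->]; rewrite andbT; have := m0; lra.
  exists U, (fun c => diag_op (sublevel g c)), (m / 2), M; split=> //.
  - exact: polar_step.
  - rewrite modulus_step; split; first exact: (sublevel_family g_admissible gab).
    apply: (spectral_int g_admissible gab) => [c|c z Jz];
      first exact: diag_op_bounded_lin (iad c).
    exact: (diag_opE (iad c) Jz).
  - apply: double_int_step => // [|c|c z Jz].
    + have [z Jz] := joint_eig_nonempty; have /andP[h1 h2] := gab z Jz; lra.
    + exact: diag_op_bounded_lin (iad c).
    + exact: (diag_opE (iad c) Jz).
(* For a competitor D the polar factor is U and the family is known on joint eigenvectors, so D and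
   U diag(gnext) are limits of the same sums; a partition fine enough for both compares them. *)
move=> D [/bounded_linP bD [U' [E [a [b [a0 /polar_step_uniq -> hsp hD]]]]]].
rewrite modulus_step in hsp; have [bE hE gab] := spectral_uniq g_admissible hsp.
have ab : a < b.
  by have [z Jz] := joint_eig_nonempty; have /andP[h1 h2] := gab z Jz;
    exact: lt_le_trans h2.
have hD' := double_int_step a0 (ltW ab) gab bE hE.
apply/funext => h; apply/eqP; rewrite -subr_eq0 -rnorm_eq0 eq_le rnorm_ge0 andbT.
apply: le_eps => e e0; rewrite add0r.
have h1 : 0 < 2 * (rnorm h + 1) by rewrite mulr_gt0 // ltr_wpDl.
have [d1 d10 hd1] := hD _ (divr_gt0 e0 h1); have [d2 d20 hd2] := hD' _ (divr_gt0 e0 h1).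
have d0 : 0 < Num.min d1 d2 by rewrite lt_min d10.
have [n [x hp]] := partition_ex (ltW ab) d0.
have weaken d : Num.min d1 d2 <= d -> tagged_partition a b d n x x.
  move=> hd; have [x0 xn hx] := hp; split=> // i /hx [k1 k2 k3]; split=> //.
  exact: lt_le_trans hd.
have w1 : Num.min d1 d2 <= d1 by rewrite ge_min lexx.
have w2 : Num.min d1 d2 <= d2 by rewrite ge_min lexx orbT.
have := hd1 n x x n x x (weaken _ w1) (weaken _ w1) h.
have := hd2 n x x n x x (weaken _ w2) (weaken _ w2) h.
set S := \sum_(i < n) _ => k1 k2.
apply: le_trans (rnorm_tri _ S _) _; rewrite (rnormB _ S).
apply: (@le_trans _ _ (2 * (e / (2 * (rnorm h + 1)) * rnorm h)));
  first by rewrite mulr_natl mulr2n lerD.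
have -> : 2 * (e / (2 * (rnorm h + 1)) * rnorm h) = e * (rnorm h / (rnorm h + 1)).
  have q0 : rnorm h + 1 != 0 by rewrite gt_eqF // ltr_wpDl.
  by field.
rewrite ler_piMr ?(ltW e0) // ler_pdivrMr ?ltr_wpDl // mul1r; lra.
Qed.

End Step.

Section Iterates.
Context (r : R) (r0 : r != 0) (m M : R) (m0 : 0 < m) (evM : forall x, joint_eig x ->
  m <= rayleigh P x <= M).

Definition orbit x k := rayleigh P (iter k U x).
Definition giter lam n x := iter n (mean_step r lam) (orbit x) 0%N.

Lemma orbit_bounds x k : joint_eig x -> m <= orbit x k <= M.
Proof. by move=> Jx; exact/evM/joint_eig_iter. Qed.

Lemma orbit_same_eig x y : same_eig x y -> orbit x = orbit y.
Proof. by move=> xy; apply/funext => k; apply: (same_eig_iter k xy);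
  exact: conjugates_self. Qed.

Lemma orbitU x : orbit (U x) = fun k => orbit x k.+1.
Proof. by apply/funext => k; rewrite /orbit -iterSr. Qed.

Lemma giter_bounds lam n x : 0 < lam < 1 -> joint_eig x -> m <= giter lam n x <= M.
Proof.
by move=> lam01 Jx; apply: mean_step_bounds => // k; exact: orbit_bounds.
Qed.

Lemma giter_same_eig lam n x y : same_eig x y -> giter lam n x = giter lam n y.
Proof. by move=> xy; rewrite /giter (orbit_same_eig xy). Qed.

Lemma giter_admissible lam n : 0 < lam < 1 -> admissible (giter lam n) M.
Proof.
move=> lam01; apply: (@g_admissible _ m) => // [x|x y _ _];
  [exact: giter_bounds | exact: giter_same_eig].
Qed.

Lemma giterS lam n : giter lam n.+1 = gnext (giter lam n) r lam.
Proof.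
apply/funext => x; rewrite /gnext /giter orbitU iter_mean_step_shift //.
Qed.

Lemma iter_aluthge lam n : 0 < lam < 1 ->
  iter n (induced_aluthge ip (power_mean_fun r lam)) (U \o P) = U \o diag_op (giter
    lam n).
Proof.
move=> lam01; elim: n => [|n ih].
  by apply/funext => x /=; rewrite (conjugates_diag_op conjugates_self).
rewrite iterS ih (@induced_aluthge_step _ m M m0) ?giterS //.
  by move=> x; exact: giter_bounds.
by move=> x y _ _; exact: giter_same_eig.
Qed.

(** * The limit along the orbits of U *)

Definition glim x := mean_lim r (orbit x).
(** Only the joint eigenvalues repeat; U^p x need not be a multiple of x. *)
Definition periodic x := exists2 p, (0 < p)%N & same_eig x (iter p U x).
(** Containment in the span of finitely many vectors, stated dually so that it combines directly
    with [perp]. *)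
Definition finite_span (S : set H) := exists zs, forall v, perp zs v ->
  forall x, S x -> '[v, x] = 0.
Definition same_eig_closed (S : set H) := (forall x, S x -> joint_eig x) /\
  (forall x y, S x -> joint_eig y -> same_eig x y -> S y).

Lemma iterVU k x : iter k V (iter k U x) = x.
Proof. by elim: k x => // k ih x; rewrite iterSr /= VU ih. Qed.

Lemma iter_adj k x y : '[iter k U x, y] = '[x, iter k V y].
Proof. by elim: k x y => // k ih x y; rewrite /= adjUV ih -iterSr. Qed.

Lemma same_eig_shift i p x : same_eig (iter i U x) (iter (p + i) U x) ->
  same_eig x (iter p U x).
Proof. by move=> /(same_eig_iterV i); rewrite iterVU addnC iterD iterVU. Qed.

(** If the two vectors were not orthogonal, they would have the same joint eigenvalues, and the
    difference of the exponents would be a period. *)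
Lemma nonperiodic_orth x i j : joint_eig x -> ~ periodic x -> i != j ->
  '[iter i U x, iter j U x] = 0.
Proof.
move=> Jx np; wlog ij : i j / (i < j)%N => [h|_].
  by case: ltngtP => // ij _; [|rewrite ripC]; apply: h => //; rewrite neq_ltn ij.
apply/eqP; apply: contraT => nz; case: np; exists (j - i)%N; first by rewrite subn_gt0.
apply: (@same_eig_shift i); rewrite subnK; last exact: ltnW.
by apply: joint_eig_same => //; exact: joint_eig_iter.
Qed.

Lemma finite_span_no_orthogonal_seq S (f : nat -> H) : finite_span S ->
  (forall i, S (f i)) -> (forall i, f i != 0) ->
  (forall i j, i != j -> '[f i, f j] = 0) -> False.
Proof.
move=> [zs hzs] Sf f0 forth.
have [k [i ki] hk] := lin_comb_perp (fun i : 'I_(size zs).+1 => f i) (leqnn _).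
have := hzs _ hk _ (Sf i); rewrite rip_suml (bigD1 i) //= big1 ?addr0; last first.
  by move=> j ji; rewrite ripZl forth ?mulr0.
rewrite ripZl => /eqP; rewrite mulf_eq0 (negbTE ki) /= ripxx_eq0.
by rewrite (negbTE (f0 i)).
Qed.

Lemma indicator_admissible (S : set H) : same_eig_closed S ->
  admissible (fun x => (`[< S x >])%:R) 1.
Proof.
move=> [SJ Ss]; split=> //; first by move=> x _; case: asboolP; rewrite ?normr1 ?normr0.
move=> x y Jx Jy xy; congr (nat_of_bool _)%:R; apply/asboolP/asboolP => h;
  first exact: Ss xy.
exact: Ss (same_eig_sym xy).
Qed.

(* The range of the spectral projection of S meets the orthogonal of zs
   trivially, since the form of k is positive definite on it. *)
Lemma finite_span_form S k K zs : same_eig_closed S -> admissible k K ->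
  (forall x, S x -> 0 < k x) ->
  (forall u, perp zs u -> '[diag_op k u, u] <= 0) -> finite_span S.
Proof.
move=> cS ak kS hz; have [SJ Ss] := cS; have aS := indicator_admissible cS.
set i := (fun x => _) in aS; have bi := diag_op_bounded_lin aS;
  have bk := diag_op_bounded_lin ak.
have [K0 kK ks] := ak.
(* On the range of the projection diag(k) is the square of diag(q), so a nonpositive value of the
   form forces diag(q) u = 0. *)
pose w x := k x * i x; pose q x := Num.sqrt (w x).
have w0 x : 0 <= w x.
  rewrite /w /i; case: asboolP => [Sx|_]; last by rewrite mulr0.
  by rewrite mulr1 ltW // kS.
have aw : admissible w K.
  split=> // [x Jx|x y Jx Jy xy].
    by rewrite /w /i; case: asboolP => _; rewrite ?mulr1 ?mulr0 ?normr0 ?kK.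
  by rewrite /w (ks x y) //; have [_ _ is_] := aS; rewrite (is_ x y).
have aq : admissible q (Num.sqrt K).
  split=> [|x Jx|x y Jx Jy xy]; first exact: sqrtr_ge0.
    rewrite ger0_norm ?sqrtr_ge0 // ler_wsqrtr //.
    by have [_ /(_ x Jx) h _] := aw; apply: le_trans h; exact: ler_norm.
  by rewrite /q; have [_ _ ws] := aw; rewrite (ws x y).
have [||es [oes _ hes]] := @finite_basis [set u | diag_op i u = u] zs.
- split=> [|a x y /= hx hy]; first exact: lin0 bi.1.
  by rewrite bi.1 hx hy.
- move=> u /= iu /hz.
  have -> : diag_op k u = diag_op q (diag_op q u).
    rewrite -{1}iu; apply: (joint_eig_ext (bounded_lin_comp bk bi) (bounded_lin_comp
      (diag_op_bounded_lin aq) (diag_op_bounded_lin aq))) => x Jx /=.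
    rewrite (diag_opE aS Jx) (linZ _ _ bk.1) (diag_opE ak Jx) (diag_opE aq Jx) (linZ
      _ _ (diag_op_lin aq)) (diag_opE aq Jx).
    by rewrite !scalerA -!rmorphM /= -expr2 sqr_sqrtr // mulrC.
  rewrite (diag_op_symm aq) => qq.
  have {}qq : diag_op q u = 0 by apply/eqP; rewrite -ripxx_eq0 eq_le qq ripxx_ge0.
  have uS x : S x -> '[u, x] = 0.
    move=> Sx; have := rip0l x; rewrite -qq (diag_op_symm aq) (diag_opE aq (SJ _ Sx))
      ripZr.
    move/eqP; rewrite mulf_eq0 => /orP[|/eqP //]; rewrite sqrtr_eq0 leNgt.
    by rewrite /w /i; case: asboolP => // _; rewrite mulr1 kS.
  apply: joint_eig_total => c y Jy;
    rewrite -iu (diag_op_symm aS) (linZ _ _ bi.1) (diag_opE aS Jy) /i.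
  case: asboolP => [Sy|_]; last by rewrite scale0r scaler0 rip0r.
  rewrite scale1r; have [->|c0] := eqVneq c 0; first by rewrite scale0r rip0r.
  by apply: uS; apply: Ss Sy (joint_eigZ c0 Jy) _; apply: same_eig_sym;
    exact: same_eigZ.
exists es => v hv x Sx.
have -> : x = proj_list es x.
  by apply: hes => /=; rewrite (diag_opE aS (SJ _ Sx)) /i; case: asboolP => // _;
    rewrite scale1r.
exact: perp_proj_list.
Qed.

(* Otherwise S would contain infinitely many pairwise inequivalent, hence
   orthogonal, joint eigenvectors. *)
Lemma period_bound S : same_eig_closed S -> finite_span S ->
  exists N, forall x, S x -> periodic x ->
  exists p, [/\ (0 < p)%N, (p <= N)%N & same_eig x (iter p U x)].
Proof.
move=> [SJ Ss] fS; apply: contrapT => hn.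
pose Pd N x := exists p, [/\ (0 < p)%N, (p <= N)%N & same_eig x (iter p U x)].
have hn' N : exists x, [/\ S x, periodic x & ~ Pd N x].
  apply: contrapT => hN; apply: hn; exists N => x Sx px; apply: contrapT => hx.
  by apply: hN; exists x.
have transfer N x y : same_eig x y -> Pd N x -> Pd N y.
  move=> xy [p [p0 pN hp]]; exists p; split=> //.
  exact: same_eig_trans (same_eig_trans (same_eig_sym xy) hp) (same_eig_iter p xy).
pose Q (l : seq H) x := [/\ S x, periodic x & forall y, y \in l -> periodic y ->
  ~ same_eig y x].
have [l|f hf] := @choice_with_history H Q.
  (* The periodic vectors of [l] have periods up to a common N; a vector of S with no period up to N
     cannot share their eigenvalues. *)
  have [N hN] : exists N, forall y, y \in l -> periodic y -> Pd N y.
    elim: l => [|y l [N hN]]; first by exists 0%N.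
    have [[p p0 hp]|npy] := pselect (periodic y); last first.
      by exists N => z; rewrite inE => /orP[/eqP -> //|]; exact: hN.
    exists (maxn N p) => z; rewrite inE => /orP[/eqP -> _|zl pz].
      by exists p; rewrite leq_maxr.
    have [p' [p'0 p'N hp']] := hN z zl pz; exists p'; split=> //.
    by rewrite leq_max p'N.
  have [x [Sx px hx]] := hn' N; exists x; split=> // y yl py yx.
  by apply: hx; apply: transfer yx _; exact: hN.
have nsim i j : (i < j)%N -> ~ same_eig (f i) (f j).
  move=> ij; have [_ _ h] := hf j; apply: h; last by case: (hf i).
  by rewrite map_f // mem_iota.
have orth i j : (i < j)%N -> '[f i, f j] = 0.
  move=> ij; apply/eqP; apply: contraT => nz; case: (nsim i j ij).
  by apply: joint_eig_same => //; apply: SJ; [case: (hf i) | case: (hf j)].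
apply: (finite_span_no_orthogonal_seq (f := f) fS).
- by move=> i; case: (hf i).
- by move=> i; apply: joint_eig_neq0; apply: SJ; case: (hf i).
- by move=> i j; rewrite neq_ltn => /orP[/orth //|ji]; rewrite ripC orth.
Qed.

(** A visit at time k also occurs at k modulo the period, hence before the common bound N. So x lies
    in one of finitely many images of the span of S under powers of V. *)
Lemma finite_span_orbit S : same_eig_closed S -> finite_span S ->
  finite_span [set x | [/\ joint_eig x, periodic x & exists k, S (iter k U x)]].
Proof.
move=> cS fS; have [N hN] := period_bound cS fS; have [SJ Ss] := cS;
  have [zs hzs] := fS.
exists (flatten [seq [seq iter k V z | z <- zs] | k <- iota 0 N]) => v hv x [Jx px [k
  Sk]].
have [|p [p0 pN hp]] := hN _ Sk.
  have [q q0 hq] := px; exists q => //; rewrite -iterD addnC iterD.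
  exact: same_eig_iter.
have {}hp : same_eig x (iter p U x).
  by apply: (@same_eig_shift k); rewrite iterD; rewrite -iterD addnC iterD; move: hp;
    rewrite -iterD addnC iterD.
have hm d : same_eig x (iter (d * p) U x).
  elim: d => [|d ih]; first by move=> B fB; rewrite mul0n.
  rewrite mulSn iterD; apply: same_eig_trans hp _; exact: same_eig_iter.
have Sk' : S (iter (k %% p) U x).
  apply: Ss Sk (joint_eig_iter _ Jx) _; rewrite {1}(divn_eq k p) addnC iterD.
  by apply: same_eig_iter; apply: same_eig_sym.
have kN : (k %% p < N)%N by apply: leq_trans pN; rewrite ltn_mod.
rewrite -[x](iterVU (k %% p)) -iter_adj; apply: hzs Sk' => z zzs.
rewrite iter_adj; apply: hv; apply/flattenP.
exists [seq iter (k %% p) V z | z <- zs]; last exact: map_f.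
by apply/mapP; exists (k %% p)%N => //; rewrite mem_iota.
Qed.

(** * Forms of diagonal operators in finite codimension *)

Lemma admissible_val (F : R -> R) g K K' : admissible g K -> 0 <= K' ->
  (forall x, joint_eig x -> `|F (g x)| <= K') ->
  admissible (fun x => F (g x)) K'.
Proof. by move=> [K0 gK gs] K'0 h; split=> // x y Jx Jy xy; rewrite (gs x y). Qed.

Lemma same_eig_closed_val (F : R -> Prop) g K : admissible g K ->
  same_eig_closed [set x | joint_eig x /\ F (g x)].
Proof.
move=> [_ _ gs]; split=> [x []//|x y [Jx Fx] Jy xy]; split=> //.
by rewrite -(gs x y).
Qed.

(** As u is orthogonal to all joint eigenvectors with g > c, truncating g at c does not change the
    value at u. *)
Lemma form_le g K c u zs : admissible g K -> (forall v, perp zs v ->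
  forall x, joint_eig x /\ c < g x -> '[v, x] = 0) ->
  perp zs u -> '[diag_op g u, u] <= c * '[u, u].
Proof.
move=> ag hz pu; have [K0 gK gs] := ag.
have am : admissible (fun x => Num.min (g x) c) (K + `|c|).
  apply: (@admissible_val (fun t => Num.min t c) g K) => //; first by rewrite addr_ge0.
  move=> x Jx; rewrite minElt; case: ifP => _;
    first by rewrite (le_trans (gK x Jx)) // lerDl.
  by rewrite lerDr.
have -> : diag_op g u = diag_op (fun x => Num.min (g x) c) u.
  apply/eqP; rewrite -subr_eq0; apply/eqP/joint_eig_total => k x Jx.
  have -> : '[diag_op g u - diag_op (fun x => Num.min (g x) c) u,
    k *: x] = (g x - Num.min (g x) c) * '[u, k *: x].
    rewrite ripBl (diag_op_symm ag) (diag_op_symm am) (linZ _ _ (diag_op_lin ag))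
      (linZ _ _ (diag_op_lin am)).
    rewrite (diag_opE ag Jx) (diag_opE am Jx) !(scalerA k) ![k * _]mulrC -!scalerA
      !ripZr mulrBl //.
  have [gc|cg] := leP (g x) c; first by rewrite subrr mul0r.
  have [->|k0] := eqVneq k 0; first by rewrite scale0r rip0r mulr0.
  rewrite (hz _ pu) ?mulr0 //; split; first exact: joint_eigZ.
  by rewrite (gs (k *: x) x) //; [exact: joint_eigZ | exact: same_eigZ].
apply: (diag_op_le _ am) => x Jx; by rewrite ge_min lexx orbT.
Qed.

Lemma form_ge g K c u zs : admissible g K -> (forall v, perp zs v ->
  forall x, joint_eig x /\ g x < c -> '[v, x] = 0) ->
  perp zs u -> c * '[u, u] <= '[diag_op g u, u].
Proof.
move=> ag hz pu; have an := admissible_opp ag.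
have -> : '[diag_op g u, u] = - '[diag_op (fun x => - g x) u, u].
  by rewrite (diag_op_opp _ ag) ripNl opprK.
rewrite -[c]opprK mulNr lerN2; apply: (form_le (zs := zs) an) => // v pv x [Jx].
by rewrite ltrN2 => gx; apply: hz pv _ _.
Qed.

Definition signed_val x := s * rayleigh P x ^+ 2.

Lemma s_norm : `|s| = 1.
Proof.
have : s ^+ 2 == 1 by rewrite expr2 ss.
by rewrite sqrf_eq1 => /orP[] /eqP ->; rewrite ?normrN normr1.
Qed.

Lemma rayleigh_bounds2 x : joint_eig x ->
  0 < rayleigh P x /\ `|rayleigh P x ^+ 2| <= M ^+ 2.
Proof.
move=> /evM /andP[h1 h2]; have e0 := lt_le_trans m0 h1; split=> //.
rewrite ger0_norm ?sqr_ge0 // ler_pXn2r ?nnegrE //; first exact: ltW.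
exact: le_trans (ltW e0) h2.
Qed.

Lemma signed_val_admissible : admissible signed_val (M ^+ 2).
Proof.
split; first exact: sqr_ge0.
  by move=> x /rayleigh_bounds2 [_ h]; rewrite /signed_val normrM s_norm mul1r.
by move=> x y _ _ xy; rewrite /signed_val (xy _ conjugates_self).
Qed.

Lemma signed_sq_diag_op x : signed_sq P x = diag_op signed_val x.
Proof.
apply: (joint_eig_ext (signed_sq_bounded_lin conjugates_self) (diag_op_bounded_lin
  signed_val_admissible)) => y Jy.
rewrite (diag_opE signed_val_admissible Jy) /signed_sq (joint_eig_rayleigh
  conjugates_self Jy) (linZ _ _ bP.1) (joint_eig_rayleigh conjugates_self Jy).
by rewrite !scalerA -!rmorphM /= /signed_val expr2 mulrA.
Qed.

(** Infinitely many visits to S would be an infinite orthogonal sequence in a finite-dimensional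
    space. *)
Lemma orbit_leaves S x : joint_eig x -> ~ periodic x -> finite_span S ->
  exists N, forall k, (N <= k)%N -> ~ S (iter k U x).
Proof.
move=> Jx np fS; apply: contrapT => hn.
have /choice [k hk] N : exists k, (N <= k)%N /\ S (iter k U x).
  apply: contrapT => hN; apply: hn; exists N => k Nk Sk.
  by apply: hN; exists k.
pose f i := iter i (fun j => k j.+1) (k 0%N).
have finc i j : (i < j)%N -> (f i < f j)%N.
  elim: j => // j ih; rewrite ltnS leq_eqVlt => /orP[/eqP ->|/ih h].
    by have [] := hk (f j).+1.
  by apply: ltn_trans h _; have [] := hk (f j).+1.
apply: (finite_span_no_orthogonal_seq (f := fun i => iter (f i) U x) fS).
- by case=> [|i]; [have [] := hk 0%N | have [] := hk (f i).+1].
- by move=> i; apply: joint_eig_neq0; exact: joint_eig_iter.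
- move=> i j ij; apply: nonperiodic_orth => //.
  by move: ij; rewrite neq_ltn => /orP[] /finc h; rewrite neq_ltn h ?orbT.
Qed.

Section Essential.
Context (a0 : R) (ess0 : essential_form (signed_sq P) a0).

Lemma admissible_shift c : admissible (fun x => signed_val x - c) (M ^+ 2 + `|c|).
Proof.
apply: (admissible_val (F := fun t => t - c) signed_val_admissible);
  first by rewrite addr_ge0 ?sqr_ge0.
move=> x Jx; apply: le_trans (ler_normB _ _) _; rewrite lerD2r.
by have [_ h _] := signed_val_admissible; exact: h.
Qed.

Lemma form_shift c u : '[diag_op (fun x => signed_val x - c) u, u] = '[signed_sq P u,
  u] - c * '[u, u].
Proof.
have -> : diag_op (fun x => signed_val x - c) u = signed_sq P u - c *:r u.
  have bc := bounded_lin_scale c%:C bounded_lin_id.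
  apply: (joint_eig_ext (diag_op_bounded_lin (admissible_shift c)) (bounded_lin_sub
    (signed_sq_bounded_lin conjugates_self) bc)) => y Jy /=.
  by rewrite signed_sq_diag_op (diag_opE signed_val_admissible Jy) (diag_opE
    (admissible_shift c) Jy) rmorphB scalerBl.
by rewrite ripBl ripZl.
Qed.

(** The upper bound is taken at the midpoint of a0 and c, so that the shifted symbol is strictly
    positive on the set. *)
Lemma finite_span_above c : a0 < c ->
  finite_span [set x | joint_eig x /\ c <= signed_val x].
Proof.
move=> ac; have [ha _] := ess0; have [|zs hz] := ha ((a0 + c) / 2); first by lra.
apply: (@finite_span_form _ (fun x => signed_val x - (a0 + c) / 2) _ zs _
  (admissible_shift _)).
- exact: (same_eig_closed_val (fun t => c <= t) signed_val_admissible).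
- by move=> x [_ cx]; lra.
- by move=> u /hz; rewrite form_shift subr_le0.
Qed.

Lemma finite_span_below : finite_span [set x | joint_eig x /\ signed_val x < a0].
Proof.
have [_ [zs hz]] := ess0; have an := admissible_opp (admissible_shift a0).
apply: (@finite_span_form _ (fun x => - (signed_val x - a0)) _ zs _ an).
- exact: (same_eig_closed_val (fun t => t < a0) signed_val_admissible).
- by move=> x [_ cx]; lra.
- move=> u /hz h.
  by rewrite (diag_op_opp _ (admissible_shift a0)) ripNl form_shift oppr_le0 subr_ge0.
Qed.

(** A nonperiodic orbit eventually leaves both exceptional sets, the values at least a0 + e and
    those below a0. *)
Lemma orbit_cvg x : joint_eig x -> ~ periodic x ->
  signed_val (iter k U x) @[k --> \oo] --> a0.
Proof.
move=> Jx np; apply/cvgrPdist_lt => e e0.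
have ae : a0 < a0 + e by rewrite ltrDl.
have [N1 h1] := orbit_leaves Jx np (finite_span_above ae).
have [N2 h2] := orbit_leaves Jx np finite_span_below.
exists (maxn N1 N2) => // k /=; rewrite geq_max => /andP[/h1 k1 /h2 k2].
have Jk := joint_eig_iter k Jx.
have u1 : signed_val (iter k U x) < a0 + e by rewrite ltNge; apply/negP => h; apply: k1.
have u2 : a0 <= signed_val (iter k U x) by rewrite leNgt; apply/negP => h; apply: k2.
by rewrite ltr_norml; apply/andP; split; lra.
Qed.

Lemma s_cancel (t : R) : s * (s * t) = t.
Proof. by rewrite mulrA ss mul1r. Qed.

Lemma orbit_cvg_sqrt x : joint_eig x -> ~ periodic x ->
  orbit x k @[k --> \oo] --> Num.sqrt (s * a0) /\ 0 <= s * a0.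
Proof.
move=> Jx np; have hc := orbit_cvg Jx np.
have c2 : orbit x k ^+ 2 @[k --> \oo] --> s * a0.
  have -> : (fun k => orbit x k ^+ 2) = (fun k => s * signed_val (iter k U x)).
    by apply/funext => k; rewrite /signed_val s_cancel.
  by apply: cvgM; [exact: cvg_cst | exact: hc].
split.
  have -> : orbit x = (fun k => Num.sqrt (orbit x k ^+ 2)).
    apply/funext => k; rewrite sqrtr_sqr ger0_norm //.
    by have /andP[h _] := orbit_bounds k Jx; exact: le_trans (ltW m0) h.
  by apply: cvg_comp c2 _; exact: sqrt_continuous.
apply/ler_addgt0Pr => e e0; have /cvgrPdist_lt /(_ e e0) [N _ /(_ N (leqnn N))] := c2.
by rewrite /= ltr_norml => /andP[h1 h2]; have := sqr_ge0 (orbit x N); lra.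
Qed.

(** The second clause is the key to the limit operator: an eigenvector whose limit value differs
    from a0 must be periodic. *)
Lemma glim_cvg x : joint_eig x ->
  (forall lam, 0 < lam < 1 -> giter lam n x @[n --> \oo] --> glim x) /\
  (periodic x \/ s * glim x ^+ 2 = a0).
Proof.
move=> Jx; have hb k := orbit_bounds k Jx.
have [px|np] := pselect (periodic x); last first.
  have [h1 h2] := orbit_cvg_sqrt Jx np; have [h3 h4] := mean_lim_const r0 m0 hb h1.
  split=> //; right; rewrite /glim h4 sqr_sqrtr // s_cancel //.
split; last by left.
have [p p0 hp] := px; apply: (mean_lim_periodic r0 m0 hb p0) => k.
by rewrite /orbit iterD; apply/esym; apply: (same_eig_iter k hp);
  exact: conjugates_self.
Qed.

Lemma glim_bounds x (m' M' : R) : joint_eig x -> 0 < m' ->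
  (forall k, m' <= orbit x k <= M') ->
  m' <= glim x <= M'.
Proof.
move=> Jx m'0 hb; apply: (mean_lim_bounds r0 m'0 hb).
have h2 : 0 < (2^-1 : R) < 1 by apply/andP; split; lra.
by have [h _] := glim_cvg Jx; exact: (h _ h2).
Qed.

Lemma glim_mM x : joint_eig x -> m <= glim x <= M.
Proof. by move=> Jx; apply: glim_bounds => // k; exact: orbit_bounds. Qed.

Lemma glim_admissible : admissible glim M.
Proof.
apply: (@g_admissible _ m) => // [x|x y _ _ xy]; first exact: glim_mM.
by rewrite /glim (orbit_same_eig xy).
Qed.

Lemma glim_sq_le x d : joint_eig x -> (forall k, orbit x k ^+ 2 <= d) ->
  glim x ^+ 2 <= d.
Proof.
move=> Jx hd.
have o0 k : 0 < orbit x k by have /andP[h _] := orbit_bounds k Jx;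
  exact: lt_le_trans m0 h.
have d0 : 0 < d by apply: lt_le_trans (hd 0%N); rewrite exprn_gt0.
have g0 : 0 <= glim x by have /andP[h _] := glim_mM Jx; exact: le_trans (ltW m0) h.
have /andP[_] : m <= glim x <= Num.sqrt d.
  apply: glim_bounds => // k; have /andP[-> _] := orbit_bounds k Jx.
  by rewrite -(@ler_pXn2r _ 2) ?nnegrE ?sqrtr_ge0 ?(ltW (o0 k)) // sqr_sqrtr ?hd // ltW.
by rewrite -(@ler_pXn2r _ 2) ?nnegrE ?sqrtr_ge0 // sqr_sqrtr // ltW.
Qed.

Lemma glim_sq_ge x d : joint_eig x -> (forall k, d <= orbit x k ^+ 2) ->
  d <= glim x ^+ 2.
Proof.
move=> Jx hd; have [d0|d0] := leP d 0; first by rewrite (le_trans d0) // sqr_ge0.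
have o0 k : 0 < orbit x k by have /andP[h _] := orbit_bounds k Jx;
  exact: lt_le_trans m0 h.
have g0 : 0 <= glim x by have /andP[h _] := glim_mM Jx; exact: le_trans (ltW m0) h.
have /andP[+ _] : Num.sqrt d <= glim x <= M.
  apply: glim_bounds; rewrite ?sqrtr_gt0 // => k; have /andP[_ ->] := orbit_bounds k Jx.
  by rewrite andbT -(@ler_pXn2r _ 2) ?nnegrE ?sqrtr_ge0 ?(ltW (o0 k)) // sqr_sqrtr
    ?hd // ltW.
by rewrite -(@ler_pXn2r _ 2) ?nnegrE ?sqrtr_ge0 // sqr_sqrtr // ltW.
Qed.

Lemma signed_val_orbit x k : signed_val (iter k U x) = s * orbit x k ^+ 2.
Proof. by []. Qed.

Lemma s_cases : s = 1 \/ s = -1.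
Proof.
have : s ^+ 2 == 1 by rewrite expr2 ss.
by rewrite sqrf_eq1 => /orP[] /eqP ->; [left | right].
Qed.

(** For s = -1 an upper bound on signed values is a lower bound on squares, hence the two cases. *)
Lemma glim_le x c : joint_eig x -> (forall k, signed_val (iter k U x) <= c) ->
  s * glim x ^+ 2 <= c.
Proof.
move=> Jx; case: s_cases => sE hc.
  rewrite sE mul1r; apply: glim_sq_le => // k; have := hc k.
  by rewrite signed_val_orbit sE mul1r.
rewrite sE mulN1r lerNl; apply: glim_sq_ge => // k; have := hc k.
by rewrite signed_val_orbit sE mulN1r lerNl.
Qed.

Lemma glim_ge x c : joint_eig x -> (forall k, c <= signed_val (iter k U x)) ->
  c <= s * glim x ^+ 2.
Proof.
move=> Jx; case: s_cases => sE hc.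
  rewrite sE mul1r; apply: glim_sq_ge => // k; have := hc k.
  by rewrite signed_val_orbit sE mul1r.
rewrite sE mulN1r lerNr; apply: glim_sq_le => // k; have := hc k.
by rewrite signed_val_orbit sE mulN1r lerNr.
Qed.

Definition signed_glim x := s * glim x ^+ 2.

Lemma signed_glim_admissible : admissible signed_glim (M ^+ 2).
Proof.
apply: (admissible_val (F := fun t => s * t ^+ 2) glim_admissible);
  first exact: sqr_ge0.
move=> x Jx; have /andP[h1 h2] := glim_mM Jx; have g0 := lt_le_trans m0 h1.
rewrite normrM s_norm mul1r ger0_norm ?sqr_ge0 // ler_pXn2r ?nnegrE //;
  first exact: ltW.
exact: le_trans (ltW g0) h2.
Qed.

Lemma signed_sq_glim x : signed_sq (diag_op glim) x = diag_op signed_glim x.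
Proof.
have bg := diag_op_bounded_lin glim_admissible.
have bsq : bounded_lin (signed_sq (diag_op glim)) by apply: bounded_lin_scale;
  exact: (bounded_lin_comp bg bg).
apply: (joint_eig_ext bsq (diag_op_bounded_lin signed_glim_admissible)) => y Jy.
rewrite /signed_sq (diag_opE signed_glim_admissible Jy) (diag_opE glim_admissible Jy)
  (linZ _ _ bg.1) (diag_opE glim_admissible Jy).
by rewrite !scalerA -!rmorphM /= /signed_glim expr2 mulrA.
Qed.

(** The same a0 serves. If the limit value of x is beyond the threshold, x is periodic and some
    point of its orbit has a value beyond it too; by [finite_span_orbit] such x span a
    finite-dimensional space. *)
Lemma essential_limit : essential_form (signed_sq (diag_op glim)) a0.
Proof.
split=> [c ac|].
  have [zs hz] := finite_span_orbit (same_eig_closed_val (fun t => c <= t)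
    signed_val_admissible) (finite_span_above ac).
  exists zs => u pu; rewrite signed_sq_glim;
    apply: (form_le signed_glim_admissible) pu => v pv x [Jx cx].
  apply: hz pv _ _; split=> //.
    by have [_ [//|gE]] := glim_cvg Jx; move: cx; rewrite /signed_glim gE ltNge ltW.
  apply: contrapT => hn; move: cx; rewrite ltNge => /negP; apply;
    apply: glim_le => // k.
  rewrite leNgt; apply/negP => h; apply: hn; exists k; split;
    [exact: joint_eig_iter | exact: ltW].
have [zs hz] := finite_span_orbit (same_eig_closed_val (fun t => t < a0)
  signed_val_admissible) finite_span_below.
exists zs => u pu; rewrite signed_sq_glim;
  apply: (form_ge signed_glim_admissible) pu => v pv x [Jx cx].
apply: hz pv _ _; split=> //.
  by have [_ [//|gE]] := glim_cvg Jx; move: cx; rewrite /signed_glim gE ltxx.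
apply: contrapT => hn; move: cx; rewrite ltNge => /negP; apply; apply: glim_ge => // k.
rewrite leNgt; apply/negP => h; apply: hn; exists k; split=> //; exact: joint_eig_iter.
Qed.

End Essential.

Lemma aluthge_limit : exists L, [/\ bounded_lin L, symm L,
  attains_sup (fun x => s *:r L (L x)) &
  forall lam, 0 < lam < 1 -> forall x,
    tends (fun n => iter n (induced_aluthge ip (power_mean_fun r lam)) (U \o P) x) (U
      (L x))].
Proof.
have [a0 ess0] := attains_sup_essential hdim (signed_sq_bounded_lin conjugates_self)
  (signed_sq_symm conjugates_self) (conjugates_attains_sup conjugates_self).
have ag := glim_admissible ess0; have bg := diag_op_bounded_lin ag;
  have sg := diag_op_symm ag.
exists (diag_op glim); split=> //.
- apply: essential_attains_sup (essential_limit ess0);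
  first by apply: bounded_lin_scale; exact: (bounded_lin_comp bg bg).
  by move=> x y; rewrite /signed_sq !ripE !sg.
- move=> lam lam01 x.
  have := strong_lim (fun n => giter_admissible n lam01) ag _ x.
  move=> /(_ (fun y Jy => (glim_cvg ess0 Jy).1 lam lam01)) /(bounded_lin_tends bU).
  by move=> h e /h [N hN]; exists N => n /hN; rewrite /= (iter_aluthge n lam01).
Qed.

End Iterates.
End Centered.

(** * Back to AN and AM *)

Lemma rnormE x : rnorm x = Num.sqrt '[x, x].
Proof. by rewrite ripxx sqrtr_sqr ger0_norm. Qed.

Lemma rnorm1 x : (rnorm x = 1) <-> ('[x, x] = 1).
Proof. by rewrite rnormE; split=> [h|->];
  [rewrite -[LHS]sqr_sqrtr ?ripxx_ge0 // h expr1n | rewrite sqrtr1]. Qed.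

Lemma unit_image_nonempty T M : closed_subspace M -> nonzero_subspace M ->
  unit_image T M !=set0.
Proof.
move=> /csubspP [_ sM] [x Mx x0]; exists (rnorm (T ((rnorm x)^-1 *:r x))).
exists ((rnorm x)^-1 *:r x) => //; split; first exact: subspZ.
by apply/rnorm1; exact: rip_normalize.
Qed.

Lemma homog_le A M b : linear A -> subsp M ->
  (forall y, M y -> '[y, y] = 1 -> '[A y, y] <= b) -> forall y, M y ->
    '[A y, y] <= b * '[y, y].
Proof.
move=> lA sM h y My; have [->|y0] := eqVneq y 0; first by rewrite !rip0r mulr0.
have := h _ (subspZ (rnorm y)^-1%:C sM My) (rip_normalize y0).
rewrite (linZ _ _ lA) !ripE mulrA -expr2 exprVn -ripxx mulrC.
by rewrite ler_pdivrMr ?ripxx_gt0.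
Qed.

Lemma AN_attains_sup T A : bounded_lin T -> linear A ->
  (forall x, '[A x, x] = '[T x, T x]) -> (AN T <-> attains_sup A).
Proof.
move=> bT lA hA; have [lT [C C0 hC]] := bT; split=> [[_ h] M cM nM|h].
  have [x [Mx x1 hx]] := h M cM nM; have [_ sM] : closed M /\ subsp M by apply/csubspP.
  exists x; split=> //; first exact/rnorm1.
  apply: homog_le => // y My /rnorm1 y1; rewrite !hA !ripxx ler_pXn2r ?nnegrE // -hx.
  apply: ub_le_sup; last by exists y.
  by exists C => _ [z [_ z1] <-]; apply: le_trans (hC z) _; rewrite z1 mulr1.
split; first exact/bounded_linP.
move=> M cM nM; have [x [Mx xx hx]] := h M cM nM; exists x; split=> //;
  first exact/rnorm1.
apply/eqP; rewrite eq_le; apply/andP; split.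
  apply: ge_sup; first exact: unit_image_nonempty.
  move=> _ [z [Mz /rnorm1 zz] <-]; rewrite -(@ler_pXn2r _ 2) ?nnegrE // -!ripxx -!hA.
  by have := hx z Mz; rewrite zz mulr1.
apply: ub_le_sup; last by exists x => //; split=> //; exact/rnorm1.
by exists C => _ [z [_ z1] <-]; apply: le_trans (hC z) _; rewrite z1 mulr1.
Qed.

Lemma AM_attains_sup T A : bounded_lin T -> linear A ->
  (forall x, '[A x, x] = - '[T x, T x]) -> (AM T <-> attains_sup A).
Proof.
move=> bT lA hA; have lb M : has_lbound (unit_image T M) by exists 0 => _ [z _ <-].
split=> [[_ h] M cM nM|h].
  have [x [Mx x1 hx]] := h M cM nM; have [_ sM] : closed M /\ subsp M by apply/csubspP.
  exists x; split=> //; first exact/rnorm1.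
  apply: homog_le => // y My /rnorm1 y1;
    rewrite !hA lerN2 !ripxx ler_pXn2r ?nnegrE // -hx.
  by apply: ge_inf; [exact: lb | exists y].
split; first exact/bounded_linP.
move=> M cM nM; have [x [Mx xx hx]] := h M cM nM; exists x; split=> //;
  first exact/rnorm1.
apply/eqP; rewrite eq_le; apply/andP; split.
  by apply: ge_inf; [exact: lb | exists x => //; split=> //; exact/rnorm1].
apply: lb_le_inf; first exact: unit_image_nonempty.
move=> _ [z [Mz /rnorm1 zz] <-]; rewrite -(@ler_pXn2r _ 2) ?nnegrE // -!ripxx.
by have := hx z Mz; rewrite zz mulr1 !hA lerN2.
Qed.

(** * The polar decomposition of an invertible operator *)

Section Polar.
Context (hdim : infinite_dimensional H) (T U : H -> H) (hT : bounded_op T) (hTinv :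
  invertible_op T).
Context (hU : polar_decomposition ip T U) (hcen : centered ip T U).

Let P := modulus ip T.
Let V := adj ip U.

Let TE x : T x = U (P x).
Proof. by have [_ _ h _] := hU; rewrite [in LHS]h. Qed.

Lemma exists_neq0 : exists x : H, x != 0.
Proof. by have [u u0 _] := infdim [::] hdim; exists u. Qed.

Lemma T_inj x : T x = 0 -> x = 0.
Proof.
have [S [/bounded_linP bS ST _]] := hTinv => h.
by rewrite -[x]/(id x) -ST /= h (lin0 bS.1).
Qed.

Lemma U_inj x : U x = 0 -> x = 0.
Proof. by have [_ _ _ h] := hU; move/(h x)/T_inj. Qed.

Lemma bounded_linU : bounded_lin U.
Proof. by apply/bounded_linP; case: hU. Qed.

(** U V U = U, and U is onto because T is. *)
Lemma UV_id x : U (V x) = x.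
Proof.
have [S [_ _ TS]] := hTinv; have [_ h _ _] := hU.
have xE : x = U (P (S x)) by rewrite -TE -[RHS]/((T \o S) x) TS.
move: (P (S x)) xE => w ->; exact: (congr1 (fun f => f w) h).
Qed.

(** If there were no adjoint, [xget] would return the zero map, contradicting [UV_id] at a nonzero
    vector. *)
Lemma adjV : adjoint_of ip U V.
Proof.
have [ex|nex] := pselect (exists S, adjoint_of ip U S); first exact: xgetPex.
have V0 : V = fun=> 0 by apply: xgetPN => S hS; apply: nex; exists S.
have [x x0] := exists_neq0; have := UV_id x; rewrite V0 (lin0 bounded_linU.1) => h.
by rewrite -h eqxx in x0.
Qed.

Lemma bounded_linV : bounded_lin V.
Proof. by apply/bounded_linP; case: adjV. Qed.

Lemma VU_id x : V (U x) = x.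
Proof.
apply/eqP; rewrite -subr_eq0; apply/eqP/U_inj.
by rewrite (linB _ _ bounded_linU.1) UV_id subrr.
Qed.

Lemma adj_rip x y : '[U x, y] = '[x, V y].
Proof. by rewrite /rip; have [_ ->] := adjV. Qed.

(** If there were no square root, the default value 0 of [xget] would make T vanish, although T is
    injective and H is nonzero. *)
Lemma modulusP : positive_op ip P /\ P \o P = adj ip T \o T.
Proof.
pose Q := [set P | positive_op ip P /\ P \o P = adj ip T \o T].
have [ex|nex] := pselect (exists P, Q P); first exact: (xgetPex (fun=> 0) ex).
have P0 : P = fun=> 0 by apply: xgetPN => S hS; apply: nex; exists S.
have [x x0] := exists_neq0; have := TE x; rewrite P0 (lin0 bounded_linU.1) => /T_inj h.
by rewrite h eqxx in x0.
Qed.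

Lemma aluthge_limit_polar (s r : R) : s * s = 1 -> r != 0 ->
  attains_sup (fun x => s *:r P (P x)) ->
  exists L, [/\ bounded_lin L, attains_sup (fun x => s *:r L (L x)), (forall x,
    '[L (L x), x] = '[U (L x), U (L x)]) &
  forall lam, 0 < lam < 1 -> forall x,
    tends (fun n => iter n (induced_aluthge ip (power_mean_fun r lam)) T x) (U (L x))].
Proof.
move=> ss r0 hSA.
have [bP sP pP] := positive_facts modulusP.1.
have conjugatesC B C x : conjugates U V P B -> conjugates U V P C -> B (C x) = C (B x).
  have sub D : conjugates U V P D ->
    [\/ exists2 m, (0 < m)%N & D = iter m V \o P \o iter m U,
      D = P | exists2 n, (0 < n)%N & D = iter n U \o P \o iter n V].
    move=> [[|k] [->|->]]; [by apply: Or32 | by apply: Or32 | |].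
      by apply: Or31; exists k.+1.
    by apply: Or33; exists k.+1.
  by move=> /sub hB /sub hC; have /(congr1 (fun f => f x)) := hcen hB hC.
have [S [/bounded_linP [lS [C C0 hC]] ST _]] := hTinv.
have [_ [D D0 hD]] := bP.
(* The lower bound comes from the bound C of the inverse of T; the added 1 keeps it positive even if
   C = 0. *)
have evP x : joint_eig U V P x -> (C + 1)^-1 <= rayleigh P x <= D.
  move=> [x0 hx]; have fP : conjugates U V P P by exists 0%N; left.
  have nx : 0 < rnorm x by rewrite rnorm_gt0.
  have [c hc] := hx P fP.
  have cE : rayleigh P x = c by rewrite /rayleigh hc ripZl mulfK // ripxx_eq0.
  have e0 : 0 <= rayleigh P x by rewrite /rayleigh divr_ge0 ?ripxx_ge0.
  have Px : rnorm (P x) = rayleigh P x * rnorm x by rewrite {1}hc rnormZr -cE ger0_norm.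
  have Tx : rnorm (T x) = rnorm (P x).
    by rewrite !rnormE TE adj_rip VU_id.
  apply/andP; split; last by rewrite -(ler_pM2r nx) -Px.
  have C1 : 0 < C + 1 by rewrite ltr_wpDl.
  rewrite -(ler_pM2r nx) -Px -Tx mulrC ler_pdivrMr //.
  have h : rnorm x <= C * rnorm (T x) by rewrite -{1}[x]/(id x) -ST; exact: hC.
  by apply: le_trans h _; rewrite mulrC ler_wpM2l // lerDl.
have C1 : 0 < (C + 1)^-1 by rewrite invr_gt0 ltr_wpDl.
have [L [bL sL hL lim]] := aluthge_limit bounded_linU bounded_linV UV_id VU_id
  adj_rip bP sP pP conjugatesC ss hSA hdim r0 C1 evP.
exists L; split=> //; first by move=> x; rewrite adj_rip VU_id sL.
have -> : T = U \o P by apply/funext => x; exact: TE.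
exact: lim.
Qed.

Lemma PP_T x : '[P (P x), x] = '[T x, T x].
Proof.
have [_ sP _] := positive_facts modulusP.1.
by rewrite TE adj_rip VU_id sP.
Qed.

Lemma linPP (c : R) : linear (fun x => c *:r P (P x)).
Proof.
have [bP _ _] := positive_facts modulusP.1.
by case: (bounded_lin_scale c%:C (bounded_lin_comp bP bP)).
Qed.

Lemma AN_limit r : r != 0 -> AN T -> exists L, [/\ bounded_op L, AN (U \o L) &
  forall lam, 0 < lam < 1 -> forall x,
    iter n (induced_aluthge ip (power_mean_fun r lam)) T x @[n --> \oo] --> (U \o L) x].
Proof.
move=> r0 hAN; have bT : bounded_lin T by exact/bounded_linP.
have /(AN_attains_sup bT (linPP 1)) hSA := hAN.
have [||L [bL sL hL lim]] := @aluthge_limit_polar 1 r _ r0.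
- by rewrite mulr1.
- by apply: hSA => x; rewrite scale1r PP_T.
exists L; split; first exact/bounded_linP.
  apply/(AN_attains_sup (bounded_lin_comp bounded_linU bL) (bounded_lin_scale 1%:C
    (bounded_lin_comp bL bL)).1) => [x|]; last exact: sL.
  by rewrite /= scale1r hL.
by move=> lam lam01 x; apply/tendsP; exact: lim.
Qed.

Lemma AM_limit r : r != 0 -> AM T -> exists L, [/\ bounded_op L, AM (U \o L) &
  forall lam, 0 < lam < 1 -> forall x,
    iter n (induced_aluthge ip (power_mean_fun r lam)) T x @[n --> \oo] --> (U \o L) x].
Proof.
move=> r0 hAM; have bT : bounded_lin T by exact/bounded_linP.
have /(AM_attains_sup bT (linPP (-1))) hSA := hAM.
have [||L [bL sL hL lim]] := @aluthge_limit_polar (-1) r _ r0.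
- by rewrite mulrNN mulr1.
- by apply: hSA => x; rewrite ripZl PP_T mulN1r.
exists L; split; first exact/bounded_linP.
  apply/(AM_attains_sup (bounded_lin_comp bounded_linU bL) (bounded_lin_scale (-1)%:C
    (bounded_lin_comp bL bL)).1) => [x|]; last exact: sL.
  by rewrite ripZl hL mulN1r.
by move=> lam lam01 x; apply/tendsP; exact: lim.
Qed.

End Polar.
End Hilbert.

Theorem theorem7p5 (R : realType) (H : completeNormedModType R[i])
    (ip : {dot H for Num.conj}) (hip : induces_norm ip)
    (hdim : infinite_dimensional H)
    (r : R) (hr : -1 <= r <= 1) (hr0 : r != 0)
    (T U : H -> H) (hT : bounded_op T) (hTinv : invertible_op T)
    (hU : polar_decomposition ip T U) (hcen : centered ip T U) :
  (AN T -> exists L : H -> H,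
     [/\ bounded_op L, AN (U \o L) &
         forall lambda : R, 0 < lambda < 1 -> forall x : H,
           iter n (induced_aluthge ip (power_mean_fun r lambda)) T x
             @[n --> \oo] --> (U \o L) x])
  /\
  (AM T -> exists L : H -> H,
     [/\ bounded_op L, AM (U \o L) &
         forall lambda : R, 0 < lambda < 1 -> forall x : H,
           iter n (induced_aluthge ip (power_mean_fun r lambda)) T x
             @[n --> \oo] --> (U \o L) x]).
Proof.
split=> [hAN|hAM].
- exact: (AN_limit hip hdim hT hTinv hU hcen hr0 hAN).
- exact: (AM_limit hip hdim hT hTinv hU hcen hr0 hAM).
Qed.
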